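(* Let $X^*$ be the dual of a weakly compactly generated (WCG) Banach space $X$ and assume that $X^*$ has a weak$^*$ unconditional asymptotic structure. Let $G$ be any non-trivial countably branching bundle graph. Then the following properties are equivalent. (1) $S_Z(X)\le\omega$. (2) $X^*$ admits an equivalent AUC$^*$ norm. (3) $X^*$ admits an equivalent AMUC$^*$ norm. (4) The family $(G^{\oslash n})_{n\ge1}$ does not equi-Lipschitz embed into $X^*$.
   Context: A Banach space $X$ is WCG if there is a weakly compact $K\subset X$ with $\overline{\mathrm{span}}(K)=X$. Szlenk index. For a weak$^*$-compact $K\subset X^*$ and $\varepsilon>0$, let $s_\varepsilon(K)$ be $K$ minus the union of all (relatively) weak$^*$-open subsets $V$ of $K$ with $\operatorname{diam}V\le\varepsilon$. Put $s^1_\varepsilon(K)=s_\varepsilon(K)$, $s^{\alpha+1}_\varepsilon(K)=s_\varepsilon(s^\alpha_\varepsilon(K))$, and $s^\alpha_\varepsilon(K)=\bigcap_{\beta<\alpha}s^\beta_\varepsilon(K)$ for limit $\alpha$. Let $S_Z(K,\varepsilon)$ be the least $\alpha$ with $s^\alpha_\varepsilon(K)=\emptyset$ if it exists and $\infty$ otherwise, and $S_Z(X)=\sup_{\varepsilon>0}S_Z(B_{X^*},\varepsilon)$, $B_{X^*}$ being the closed unit ball of $X^*$. $\omega$ is the first infinite ordinal. Let $\mathrm{cof}_{w^*}(X^* )$ be the set of weak$^*$-closed subspaces of $X^*$ of finite codimension; $S_Y$ denotes the unit sphere of $Y$; $\inf\emptyset=+\infty$. Weak$^*$ unconditional asymptotic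 structure: there is $C\ge1$ such that for every $n\ge1$: $\exists X_1\in\mathrm{cof}_{w^*}(X^* )\ \forall x_1^*\in S_{X_1}\ \cdots\ \exists X_n\in\mathrm{cof}_{w^*}(X^* )\ \forall x_n^*\in S_{X_n}$: $(x_i^* )_{i=1}^n$ is $C$-unconditional, i.e. $\|\sum\epsilon_ia_ix_i^*\|\le C\|\sum a_ix_i^*\|$ for all scalars $a_i$ and signs $\epsilon_i$. A norm on $X^*$ is AUC$^*$ if for all $t>0$, $\inf_{x^*\in S_{X^*}}\sup_{Y\in\mathrm{cof}_{w^*}(X^* )}\inf_{y^*\in S_Y}(\|x^*+ty^*\|-1)>0$, and AMUC$^*$ if for all $t>0$, $\inf_{x^*\in S_{X^*}}\sup_{Y\in\mathrm{cof}_{w^*}(X^* )}\inf_{y^*\in S_Y}(\max\{\|x^*+ty^*\|,\|x^*-ty^*\|\}-1)>0$. Bundle graphs. A top-bottom graph is a (simple) graph with two distinguished vertices, one designated as the top and the other as the bottom. A countably branching bundle graph is a top-bottom graph that can be formed, starting from a path of length $1$, by a finite sequence of the following operations: (i) given two countably branching bundle graphs, identify the top of one with the bottom of the other, the bottom of the first being the new bottom and the top of the second the new top; (ii) take countably infinitely many copies of a countably branching bundle graph and identify all the bottoms with each other and all the tops with each other. It is non-trivial if it is obtained by such a sequence with at least one operation (ii) (applied to a graph other than a single edge). Bundle graphs carry the graph distance. Edges are oriented from bottom to top; $G\oslash H$ is obtained by replacing every edge of $G$ by a copy of $H$ (bottom and top of $H$ placed at the lower and upper endpoint of the edge), and $G^{\oslash1}=G$,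 $G^{\oslash(n+1)}=G\oslash G^{\oslash n}$. A family $(M_n,d_n)$ equi-Lipschitz embeds into $X^*$ if there are $D\ge1$, maps $f_n:M_n\to X^*$ and $s_n>0$ with $s_nd_n(x,y)\le\|f_n(x)-f_n(y)\|\le s_nD\,d_n(x,y)$ for all $n$ and $x,y\in M_n$. *)

(* Defs.v *)
From HB Require Import structures.
From mathcomp Require Import all_boot all_order all_algebra.
From mathcomp Require Import all_classical all_reals all_analysis.

Set Implicit Arguments.
Unset Strict Implicit.
Unset Printing Implicit Defensive.

Import Order.TTheory GRing.Theory Num.Theory.
Import numFieldNormedType.Exports.

Local Open Scope classical_set_scope.
Local Open Scope ring_scope.

Section Dual.
Context {R : realType} (X : normedModType R).

Definition dual_pred : {pred X -> R} :=
  fun f => `[< linear f /\ continuous f >].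

Lemma dual_submod_closed : submod_closed dual_pred.
Proof.
split=> [|a f g]; rewrite ?unfold_in.
  apply/asboolP; split=> [k x y|]; first by rewrite scaler0 addr0.
  exact: cst_continuous.
move=> /asboolP[lf cf] /asboolP[lg cg]; apply/asboolP; split.
  move=> k x y; rewrite !fctE lf lg !scalerDr !scalerA [k * a]mulrC.
  by rewrite !addrA; congr (_ + _); rewrite -!addrA; congr (_ + _); rewrite addrC.
by move=> x; exact: (cvgD (cvgZl_tmp (cf x)) (cg x)).
Qed.

HB.instance Definition _ :=
  GRing.isSubmodClosed.Build R (X -> R) dual_pred dual_submod_closed.

Record dual := Dual { dual_fun :> X -> R; dual_funP : dual_fun \in dual_pred }.

HB.instance Definition _ := [isSub for dual_fun].
HB.instance Definition _ := [Choice of dual by <:].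
HB.instance Definition _ := [SubChoice_isSubLmodule of dual by <:].

Definition dual_norm (f : dual) : R :=
  sup [set `|f x| | x in [set x : X | `|x| <= 1]].

Let pack (f : dual) : {linear X -> R} :=
  HB.pack (f : X -> R)
    (GRing.isLinear.Build _ _ _ _ _ (proj1 (asboolW (dual_funP f)))).

Lemma dual_norm_has_sup (f : dual) :
  has_sup [set `|f x| | x in [set x : X | `|x| <= 1]].
Proof.
split; first by exists `|f 0|, 0 => //=; rewrite normr0.
have /asboolP[_ cf] := dual_funP f.
have /bounded_funP/(_ 1)[M fM] : bounded_near (pack f) (nbhs (0 : X)).
  by apply: continuous_linear_bounded; exact: cf.
by exists M => _ /= [x x1 <-]; exact: fM.
Qed.

Lemma le_dual_norm (f : dual) x : `|f x| <= dual_norm f * `|x|.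
Proof.
have [->|x0] := eqVneq x 0.
  by rewrite [f 0](linear0 (pack f)) !normr0 mulr0.
have nx0 : 0 < `|x| by rewrite normr_gt0.
rewrite -ler_pdivrMr//.
have -> : `|f x| / `|x| = `|f (`|x|^-1 *: x)|.
  rewrite [f (_ *: _)](linearZ_LR (pack f)) normrM mulrC.
  by rewrite [ `|_^-1|]ger0_norm// invr_ge0.
apply: sup_upper_bound; first exact: dual_norm_has_sup.
by exists (`|x|^-1 *: x) => //=; rewrite normrZ ger0_norm ?invr_ge0// mulVf ?gt_eqF.
Qed.

Lemma dual_norm_le (f : dual) M :
  (forall x, `|x| <= 1 -> `|f x| <= M) -> dual_norm f <= M.
Proof.
move=> fM; apply: ge_sup; first by have [] := dual_norm_has_sup f.
by move=> _ [x x1 <-]; exact: fM.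
Qed.

Lemma dual_norm_ge0 (f : dual) : 0 <= dual_norm f.
Proof.
apply: le_trans (normr_ge0 (f 0)) _.
apply: sup_upper_bound; first exact: dual_norm_has_sup.
by exists 0 => //=; rewrite normr0.
Qed.

Lemma dual_normD (f g : dual) : dual_norm (f + g) <= dual_norm f + dual_norm g.
Proof.
apply: dual_norm_le => x x1; apply: le_trans (ler_normD _ _) _.
by apply: lerD; (apply: le_trans (le_dual_norm _ _) _; rewrite ler_piMr// dual_norm_ge0).
Qed.

Lemma dual_normZ (a : R) (f : dual) : dual_norm (a *: f) = `|a| * dual_norm f.
Proof.
have le b g : dual_norm (b *: g) <= `|b| * dual_norm g.
  apply: dual_norm_le => x x1; rewrite [X in X <= _]normrM ler_wpM2l//.
  by apply: le_trans (le_dual_norm _ _) _; rewrite ler_piMr// dual_norm_ge0.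
apply/eqP; rewrite eq_le le /=.
have [->|a0] := eqVneq a 0; first by rewrite normr0 mul0r dual_norm_ge0.
rewrite -ler_pdivlMl ?normr_gt0// -normfV.
by apply: le_trans (le _ _); rewrite scalerA mulVf// scale1r.
Qed.

Lemma dual_norm0_eq0 (f : dual) : dual_norm f = 0 -> f = 0.
Proof.
move=> f0; apply/val_inj/funext => x; apply/eqP; rewrite -normr_le0.
by apply: le_trans (le_dual_norm _ _) _; rewrite f0 mul0r.
Qed.

HB.instance Definition _ :=
  Lmodule_isNormed.Build R dual dual_normD dual_normZ dual_norm0_eq0.

(** [weak_star] is [dual] with the topology of pointwise convergence on [X];
    [weak] is [X] with the topology of pointwise convergence on [dual]. *)
Definition weak_star : topologicalType :=
  initial_topology (fun f : dual => (f : {ptws X -> R})).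

Definition weak : topologicalType :=
  initial_topology (fun x : X => ((fun f : dual => f x) : {ptws dual -> R})).

End Dual.

Definition subspace_set (R : pzRingType) (V : lmodType R) (Y : set V) :=
  Y 0 /\ forall (a : R) u v, Y u -> Y v -> Y (a *: u + v).

Definition linear_span (R : pzRingType) (V : lmodType R) (K : set V) : set V :=
  smallest (@subspace_set R V) K.

Definition WCG (R : realType) (X : normedModType R) :=
  exists2 K : set X, compact (K : set (weak X)) & closure (linear_span K) = setT.

Definition finite_codim (R : pzRingType) (V : lmodType R) (Y : set V) :=
  exists (n : nat) (v : 'I_n -> V), forall x, exists (y : V) (c : 'I_n -> R),
    Y y /\ x = y + \sum_(i < n) c i *: v i.

Definition cof_wstar (R : realType) (X : normedModType R) : set (set (dual X)) :=
  [set Y | [/\ subspace_set Y, finite_codim Y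
             & closed (Y : set (weak_star X))]].

(** Tree notations for ordinals. [osup f] denotes the supremum of the family
    [f], which need be neither increasing nor nonempty; a given ordinal has many
    notations, and [ole a b] compares the ordinals denoted by [a] and [b]. *)
Inductive ord : Type :=
| ozero : ord
| osucc : ord -> ord
| osup : forall I : Type, (I -> ord) -> ord.

Inductive ole : ord -> ord -> Prop :=
| ole_zero b : ole ozero b
| ole_succ a b : ole a b -> ole (osucc a) (osucc b)
| ole_sup_l I (f : I -> ord) b : (forall i, ole (f i) b) -> ole (osup f) b
| ole_sup_r a I (f : I -> ord) i : ole a (f i) -> ole a (osup f).

Definition omega : ord := osup (fun n : nat => iter n osucc ozero).

(** Ordinals extended with a largest element [None], standing for infinity. *)
Definition xole (a b : option ord) : Prop :=
  match a, b with
  | _, None => True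
  | None, Some _ => False
  | Some a, Some b => ole a b
  end.

Definition xosup (I : Type) (f : I -> option ord) : option ord :=
  if pselect (forall i, f i <> None) then
    Some (osup (fun i => odflt ozero (f i)))
  else None.

Definition diam (R : realType) (V : normedModType R) (A : set V) : \bar R :=
  ereal_sup [set (`|p.1 - p.2|)%:E | p in A `*` A].

Section Szlenk.
Context {R : realType} (X : normedModType R).
Implicit Types (K V : set (dual X)) (eps : R).

Definition wstar_rel_open K V :=
  exists2 U : set (dual X), open (U : set (weak_star X)) & V = K `&` U.

Definition szlenk_deriv eps K : set (dual X) :=
  K `\` \bigcup_(V in [set V | wstar_rel_open K V /\
                               (diam V <= eps%:E)%E]) V.

(** The derived sets decrease, so at a supremum it is enough to intersect along
    the given family; [K] itself takes care of an empty family. *)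
Fixpoint szlenk_iter eps K (a : ord) : set (dual X) :=
  match a with
  | ozero => K
  | osucc b => szlenk_deriv eps (szlenk_iter eps K b)
  | osup J f => K `&` \bigcap_(j in [set: J]) szlenk_iter eps K (f j)
  end.

Definition szlenk_least K eps (a : ord) :=
  szlenk_iter eps K a = set0 /\
  forall b, szlenk_iter eps K b = set0 -> ole a b.

(** The choice below is among notations of one ordinal. *)
Definition szlenk_index_at K eps : option ord :=
  if pselect (exists a, szlenk_least K eps a) is left h
  then Some (projT1 (cid h)) else None.

Definition dual_ball : set (dual X) := [set f | `|f| <= 1].

Definition szlenk_index : option ord :=
  xosup (fun eps : {posnum R} => szlenk_index_at dual_ball eps%:num).

End Szlenk.

Section Asymptotic.
Context {R : realType} (X : normedModType R).

Definition unconditional (C : R) (s : seq (dual X)) :=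
  forall (a : nat -> R) (e : nat -> bool),
    `|\sum_(i < size s) ((-1) ^+ e i * a i) *: s`_i|
      <= C * `|\sum_(i < size s) a i *: s`_i|.

(** The [n]-round game continuing from the vectors [s] already played. *)
Fixpoint cof_game (P : seq (dual X) -> Prop) (n : nat) (s : seq (dual X)) :=
  if n is m.+1 then
    exists2 Y, cof_wstar Y &
      forall y, Y y -> `|y| = 1 -> cof_game P m (rcons s y)
  else P s.

Definition wstar_unconditional_asymptotic_structure :=
  exists2 C : R, 1 <= C &
    forall n, (1 <= n)%N -> cof_game (unconditional C) n [::].

(** Definiteness follows from the lower bound. The norm [N] is not required to
    be the dual of a norm on [X]. *)
Definition equivalent_norm (N : dual X -> R) :=
  [/\ forall f g, N (f + g) <= N f + N g,
      forall (a : R) f, N (a *: f) = `|a| * N f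
    & exists a b : R, [/\ 0 < a, 0 < b
        & forall f, a * `|f| <= N f /\ N f <= b * `|f|]].

Definition norm_sphere (N : dual X -> R) (Y : set (dual X)) : set (dual X) :=
  [set y | Y y /\ N y = 1].

Local Open Scope ereal_scope.

Definition AUC_star (N : dual X -> R) := forall t : R, (0 < t)%R ->
  0 < ereal_inf [set
        ereal_sup [set
          ereal_inf [set (N (x + t *: y) - 1)%R%:E | y in norm_sphere N Y]
        | Y in @cof_wstar R X]
      | x in norm_sphere N setT].

Definition AMUC_star (N : dual X -> R) := forall t : R, (0 < t)%R ->
  0 < ereal_inf [set
        ereal_sup [set
          ereal_inf [set (Num.max (N (x + t *: y)) (N (x - t *: y)) - 1)%R%:E
                    | y in norm_sphere N Y]
        | Y in @cof_wstar R X]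
      | x in norm_sphere N setT].

End Asymptotic.

Inductive vertex_of (I : Type) : Type :=
| bot : vertex_of I
| top : vertex_of I
| inn : I -> vertex_of I.
Arguments bot {I}.
Arguments top {I}.

(** A top-bottom graph with its edges oriented: [arc u v] says that there is an
    edge between [u] and [v] and that [u] is its lower endpoint. Listing the
    vertices other than bottom and top separately lets the identifications
    below be expressed without quotients. *)
Record tbgraph := TBGraph {
  inner : Type;
  arc : vertex_of inner -> vertex_of inner -> Prop }.

Definition vertex (G : tbgraph) : Type := vertex_of (inner G).

Definition adjacent (G : tbgraph) (u v : vertex G) := arc u v \/ arc v u.

(** The map on vertices placing the bottom of a graph at [b], its top at [t],
    and its other vertices according to [f]. *)
Definition place (I J : Type) (b t : vertex_of J) (f : I -> J)
    (u : vertex_of I) : vertex_of J :=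
  match u with bot => b | top => t | inn i => inn (f i) end.

Definition edge_graph : tbgraph :=
  @TBGraph void (fun u v => u = bot /\ v = top).

(** [G] below, [H] above; [inr None] is the top of [G] identified with the
    bottom of [H]. *)
Section Series.
Variables G H : tbgraph.
Let I := (inner G + option (inner H))%type.
Let mid : vertex_of I := inn (inr None).

Definition series_graph : tbgraph := @TBGraph I (fun u v =>
  (exists p q : vertex G, [/\ arc p q,
     u = place bot mid (@inl _ _) p & v = place bot mid (@inl _ _) q]) \/
  (exists p q : vertex H, [/\ arc p q,
     u = place mid top (fun i => inr (Some i)) p
   & v = place mid top (fun i => inr (Some i)) q])).
End Series.

Definition branch_graph (G : tbgraph) : tbgraph :=
  @TBGraph (nat * inner G)%type (fun u v =>
    exists (n : nat) (p q : vertex G), [/\ arc p q,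
      u = place bot top (pair n) p & v = place bot top (pair n) q]).

Definition single_edge (G : tbgraph) :=
  (inner G -> False) /\ adjacent (bot : vertex G) top.

Inductive bundle_graph : tbgraph -> Prop :=
| bundle_edge : bundle_graph edge_graph
| bundle_series G H :
    bundle_graph G -> bundle_graph H -> bundle_graph (series_graph G H)
| bundle_branch G : bundle_graph G -> bundle_graph (branch_graph G).

(** A branching of a single edge is again a single edge, since edges are given
    by a relation; such a branching does not count. *)
Inductive nontrivial_bundle_graph : tbgraph -> Prop :=
| nontrivial_series_l G H : nontrivial_bundle_graph G -> bundle_graph H ->
    nontrivial_bundle_graph (series_graph G H)
| nontrivial_series_r G H : bundle_graph G -> nontrivial_bundle_graph H ->
    nontrivial_bundle_graph (series_graph G H)
| nontrivial_branch G : bundle_graph G -> ~ single_edge G ->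
    nontrivial_bundle_graph (branch_graph G).

Section Oslash.
Variables G H : tbgraph.
Let E := {e : vertex G * vertex G | arc e.1 e.2}.
Let I := (inner G + E * inner H)%type.
Let old : vertex G -> vertex_of I := place bot top (@inl _ _).
Let copy (e : E) : vertex H -> vertex_of I :=
  place (old (sval e).1) (old (sval e).2) (fun i => inr (e, i)).

Definition oslash : tbgraph := @TBGraph I (fun u v =>
  exists (e : E) (p q : vertex H), [/\ arc p q, u = copy e p & v = copy e q]).
End Oslash.

(** [oslash_power G n] is the [n.+1]-st power: [oslash_power G 0] is [G]. *)
Fixpoint oslash_power (G : tbgraph) (n : nat) : tbgraph :=
  if n is m.+1 then oslash G (oslash_power G m) else G.

Definition walk_length (G : tbgraph) (u v : vertex G) (n : nat) :=
  exists p : seq (vertex G),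
    [/\ path (fun x y => `[< adjacent x y >]) u p, last u p = v & size p = n].

(** Bundle graphs and their powers are connected; the value 0 for vertices
    joined by no walk is never used. *)
Definition graph_dist (G : tbgraph) (u v : vertex G) : nat :=
  if pselect (exists n, `[< walk_length u v n >]) is left h
  then ex_minn h else 0%N.

Definition equi_lipschitz_embeds (R : realType) (V : normedModType R)
    (M : nat -> tbgraph) :=
  exists D : R, 1 <= D /\ forall n, exists (f : vertex (M n) -> V) (s : R),
    0 < s /\ forall x y : vertex (M n),
      s * (graph_dist x y)%:R <= `|f x - f y| /\
      `|f x - f y| <= s * D * (graph_dist x y)%:R.

(* Main.v *)
Require Import Defs.
From mathcomp Require Import all_boot all_order all_algebra.
From mathcomp Require Import all_classical all_reals all_analysis.
From mathcomp Require Import ring lra zify.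

Set Implicit Arguments.
Unset Strict Implicit.
Unset Printing Implicit Defensive.

Import Order.TTheory GRing.Theory Num.Theory.
Import numFieldNormedType.Exports.

Local Open Scope classical_set_scope.

Local Notation adjacent := Defs.adjacent.
Local Notation arc := Defs.arc.

(** Each implication of the cycle has its own mechanism.

    From [S_Z(X) <= omega] to an AUC* norm.  By weak* compactness of the dual
    ball, [S_Z(X) <= omega] says that for every [eps] finitely many derivations
    exhaust the ball.  This is turned into a game on [X] ([small_game]): one
    player announces finite sets of functionals, the other answers with
    vectors of the unit ball on which these functionals are small.  The first player can ensure
    that after [n] rounds [f (z_1 + ... + z_n) <= eta * n] for all [f] in the
    dual ball ([small_game_won]); otherwise functionals that violate this bound,
    followed by weak* cluster points from the last round back to the first,
    would produce points in derived sets of too high an order.  Now let [W]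
    consist of the vectors [lam k *: (z_0 + (z_1 + ... + z_k) / n)], where
    [z_1, ..., z_k] is the beginning of a play and the weights [lam k] decrease
    slightly with [k].  The supremum of [`|f w|] over [w] in [W] is a norm
    whatever the shape of [W].  Complete plays contribute too little for their
    reduced weight and are not nearly norming; an incomplete play which nearly
    norms [f] can be continued by a vector [v] on which [f] almost vanishes and
    a given late [y] is large, so the norm of [f + y] exceeds the norm of [f] by
    a fixed amount ([level_norm]).  A weighted sum of these norms over
    [eps = 1, 1/2, 1/3, ...] is AUC* ([szlenk_AUC_star]).

    AUC* implies AMUC*, a maximum being at least its first term.

    From an AMUC* norm to the failure of the embeddings.  The set of the [w]
    with [N (u + w) <= rho] and [N (u - w) <= rho] is convex and symmetric, so
    it contains [(w_i - w_j) / 2] along with [w_i] and [w_j].  If the [w_i] are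
    infinitely many separated points, then by pigeonhole in a quotient of finite
    dimension some of these half-differences is almost in a prescribed subspace
    of finite codimension, and AMUC* bounds [N u] away from [rho]
    ([midpoints_close]).  A non-trivial bundle graph contains a [fork], that is
    two vertices joined by infinitely many geodesics with distinct vertices at
    the same height; hence the image of the bottom-top distance of [G] is
    shorter than the edges of [G] allow, by a factor that depends only on [G],
    on the norm and on the distortion.  As [G^(m+1)] is [G] with its edges replaced by copies of [G^m],
    the factors multiply ([power_contraction]), which no bounded distortion
    permits.

    From the failure of the embeddings to [S_Z(X) <= omega], by contraposition.
    If no finite number of [eps]-derivations exhausts the ball, then for every
    [K] there are vectors indexed by the nodes of the tree of finite sequences
    of natural numbers, of norm at least [eps / 4], whose sums along branches of
    length [K] stay bounded, because they telescope in the ball.  Every new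
    vector can be taken in the intersection of the finitely many subspaces that
    the asymptotic game prescribes after the earlier ones, so finite families
    are unconditional with a uniform constant ([tree_vectors]).  A bundle graph
    has coordinates on this tree: the height of the vertex at the root and, at
    the node of each branch copy containing the vertex, the smaller of the two
    heights measured from the ends of that copy ([coords]).  Along an edge each
    coordinate varies by at most one and only those on a single branch vary, so
    the corresponding sum of tree vectors is a Lipschitz function of the vertex;
    some coordinate separates any two vertices by a third of their distance, and
    unconditionality makes coordinates bounded by the norm
    ([tree_embedding_bilipschitz]). *)

(** * Walks and coordinates on bundle graphs *)

Section Walks.
Variable G : tbgraph.
Implicit Types u v w : vertex G.

Lemma walk0 u : walk_length u u 0.
Proof. by exists [::]. Qed.

Lemma walkS u w v n : adjacent u w -> walk_length w v n -> walk_length u v n.+1.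
Proof.
move=> uw [p [pp pl ps]]; exists (w :: p); split=> //=; last by rewrite ps.
by rewrite pp andbT; exact/asboolP.
Qed.

Lemma walk_ind (P : vertex G -> nat -> Prop) v :
  P v 0 -> (forall u w n, adjacent u w -> walk_length w v n -> P w n -> P u n.+1) ->
  forall u n, walk_length u v n -> P u n.
Proof.
move=> P0 PS u n; elim: n u => [|n IH] u [[|w p] [//= pp pl ps]].
  by rewrite pl.
move: pp => /andP[/asboolP uw pp]; have wv : walk_length w v n.
  by exists p; split=> //; case: ps.
exact: PS uw wv (IH _ wv).
Qed.

Lemma walk0_eq u v : walk_length u v 0 -> u = v.
Proof. by move=> [[|w p] [_ /= pl ps]]. Qed.

Lemma walk1 u v : adjacent u v -> walk_length u v 1.
Proof. by move=> uv; apply: walkS uv (walk0 v). Qed.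

Lemma walk_trans u v w m n :
  walk_length u v m -> walk_length v w n -> walk_length u w (m + n).
Proof.
move=> uv vw; move: u m uv; apply: walk_ind => // u u' m uu' _.
by rewrite addSn; exact: walkS.
Qed.

Lemma adjacent_sym u v : adjacent u v -> adjacent v u.
Proof. by case; [right|left]. Qed.

Lemma walk_sym u v n : walk_length u v n -> walk_length v u n.
Proof.
move: u n; apply: walk_ind => [|u w n uw _ IH]; first exact: walk0.
by rewrite -addn1; apply: walk_trans IH _; exact/walk1/adjacent_sym.
Qed.

Lemma walk_potential (phi : vertex G -> nat) :
  (forall u v, arc u v -> phi u <= (phi v).+1 /\ phi v <= (phi u).+1) ->
  forall u v n, walk_length u v n -> phi u <= phi v + n.
Proof.
move=> phi1 u v; move: u; apply: walk_ind => [|u w n uw _ IH]; first by rewrite addn0.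
by case: uw => /phi1[]; lia.
Qed.

Lemma graph_dist_le u v n : walk_length u v n -> graph_dist u v <= n.
Proof.
move=> uv; rewrite /graph_dist; case: pselect => [h|//].
by case: ex_minnP => m _; apply; exact/asboolP.
Qed.

Lemma graph_dist_walk u v n : walk_length u v n -> walk_length u v (graph_dist u v).
Proof.
move=> uv; rewrite /graph_dist; case: pselect => [h|[]].
  by case: ex_minnP => m /asboolP.
by exists n; exact/asboolP.
Qed.

End Walks.

Lemma walk_scale (G H : tbgraph) (F : vertex G -> vertex H) k :
  (forall u v, arc u v -> walk_length (F u) (F v) k) ->
  forall u v n, walk_length u v n -> walk_length (F u) (F v) (n * k).
Proof.
move=> Fk u v; move: u; apply: walk_ind => [|u w n uw _ IH]; first exact: walk0.
rewrite mulSn; apply: walk_trans IH.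
by case: uw => /Fk//; exact: walk_sym.
Qed.

Lemma walk_hom (G H : tbgraph) (F : vertex G -> vertex H) :
  (forall u v, arc u v -> arc (F u) (F v)) ->
  forall u v n, walk_length u v n -> walk_length (F u) (F v) n.
Proof.
move=> Fa u v n; rewrite -{2}[n]muln1; apply: walk_scale => {}u {}v uv.
by apply: walk1; left; exact: Fa.
Qed.

(** Edges may collapse: the shape needed for retractions onto a subgraph. *)
Lemma walk_contract (G H : tbgraph) (F : vertex G -> vertex H) :
  (forall u v, arc u v -> F u = F v \/ arc (F u) (F v)) ->
  forall u v n, walk_length u v n -> exists2 m, m <= n & walk_length (F u) (F v) m.
Proof.
move=> Fa u v; move: u; apply: walk_ind => [|u w n uw _ [m mn IH]].
  by exists 0 => //; exact: walk0.
have [->|a] : F u = F w \/ adjacent (F u) (F w).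
  case: uw => /Fa[->|a]; by [left|right; left|right; right].
  by exists m => //; exact: leqW.
by exists m.+1 => //; exact: walkS IH.
Qed.

(** [c v t] is the coordinate of the vertex [v] at the node [t] of the tree
    of finite sequences of natural numbers, a node listing the indices of nested
    branch copies from the outermost inwards. The coordinate at [[::]] is the
    height of [v]; [h] is the height of the top and [K] bounds the nesting. The
    field [coords_dist] compares walks with coordinates without mentioning the
    distance, so that it survives the constructions below directly. *)
Record coords (G : tbgraph) (K h : nat) (c : vertex G -> seq nat -> nat) : Prop := Coords {
  coords_bot : forall t, c bot t = 0;
  coords_top : forall t, c top t = if t is [::] then h else 0;
  coords_arc : forall p q, arc p q -> c q [::] = (c p [::]).+1;
  coords_arc1 : forall p q, arc p q -> forall t,
    c p t <= (c q t).+1 /\ c q t <= (c p t).+1;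
  coords_chain : forall p q, arc p q -> exists2 s, size s <= K &
    forall t, c p t != 0 \/ c q t != 0 -> prefix t s;
  coords_supp : forall v, exists2 s, size s <= K & forall t, c v t != 0 -> prefix t s;
  coords_up : forall v, walk_length bot v (c v [::]);
  coords_down : forall v, exists2 m, c v [::] + m = h & walk_length v top m;
  coords_dist : forall u v, exists t, exists2 n, walk_length u v n &
    n + 3 * c u t <= 3 * c v t \/ n + 3 * c v t <= 3 * c u t }.

Lemma coords_edge : coords 0 1
  (fun (v : vertex edge_graph) t => if v is top then if t is [::] then 1 else 0 else 0).
Proof.
have w01 : walk_length (bot : vertex edge_graph) top 1 by apply: walk1; left.
split=> //.
- by move=> _ _ [-> ->].
- by move=> _ _ [-> ->] [].
- by move=> _ _ [-> ->]; exists [::] => // -[|? ?] [].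
- by move=> [||//]; exists [::] => // -[].
- by move=> [||//]; [exact: walk0|].
- by move=> [||//]; [exists 1|exists 0 => //; exact: walk0].
- move=> [||//] [||//]; exists [::].
  + by exists 0; [exact: walk0|left].
  + by exists 1 => //; left.
  + by exists 1; [exact: walk_sym|right].
  + by exists 0; [exact: walk0|left].
Qed.

Section SeriesCoords.
Variables G H : tbgraph.
Let S := series_graph G H.

Definition series_low : vertex G -> vertex S := place bot (inn (inr None)) (@inl _ _).
Definition series_high : vertex H -> vertex S :=
  place (inn (inr None)) top (fun i => inr (Some i)).

Lemma series_vertexP (v : vertex S) :
  (exists p, v = series_low p) \/ (exists q, v = series_high q).
Proof.
case: v => [||[i|[j|]]].
- by left; exists bot.
- by right; exists top.
- by left; exists (inn i).
- by right; exists (inn j).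
- by left; exists top.
Qed.

Lemma series_arcP (u v : vertex S) : arc u v ->
  (exists p q, [/\ arc p q, u = series_low p & v = series_low q]) \/
  (exists p q, [/\ arc p q, u = series_high p & v = series_high q]).
Proof. by []. Qed.

Lemma series_low_arc p q : arc p q -> arc (series_low p) (series_low q).
Proof. by move=> pq; left; exists p, q. Qed.

Lemma series_high_arc p q : arc p q -> arc (series_high p) (series_high q).
Proof. by move=> pq; right; exists p, q. Qed.

Variables (K1 K2 h1 h2 : nat) (c1 : vertex G -> seq nat -> nat)
  (c2 : vertex H -> seq nat -> nat).
Hypotheses (C1 : coords K1 h1 c1) (C2 : coords K2 h2 c2).

Let shift (d : seq nat -> nat) t := d t + if t is [::] then h1 else 0.

Definition series_coords (v : vertex S) : seq nat -> nat :=
  match v with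
  | bot => c1 bot
  | top => shift (c2 top)
  | inn (inl i) => c1 (inn i)
  | inn (inr None) => c1 top
  | inn (inr (Some j)) => shift (c2 (inn j))
  end.

Lemma series_coords_low p t : series_coords (series_low p) t = c1 p t.
Proof. by case: p. Qed.

Lemma series_coords_high q t : series_coords (series_high q) t = shift (c2 q) t.
Proof.
case: q => //=; rewrite /shift (coords_bot C2) (coords_top C1).
by case: t.
Qed.

Let cE := (series_coords_low, series_coords_high).

(** The upper graph only has its heights shifted. The two graphs may share
    nodes of the tree: vertices of different factors are already at a distance
    equal to the difference of their heights. *)
Lemma coords_series : coords (maxn K1 K2) (h1 + h2) series_coords.
Proof.
have wl := walk_hom series_low_arc; have wh := walk_hom series_high_arc.
have low_top v : exists2 m, series_coords (series_low v) [::] + m = h1 &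
    walk_length (series_low v) (series_low top) m.
  have [m mh vm] := coords_down C1 v.
  by exists m; [rewrite cE|exact: wl].
split.
- by move=> t; rewrite (series_coords_low bot) (coords_bot C1).
- move=> t; rewrite (series_coords_high top) /shift (coords_top C2).
  by case: t => //; rewrite addnC.
- move=> _ _ /series_arcP[] [p [q [pq -> ->]]]; rewrite !cE /shift.
    exact: (coords_arc C1).
  by rewrite (coords_arc C2 pq).
- move=> _ _ /series_arcP[] [p [q [pq -> ->]]] t; rewrite !cE /shift.
    exact: (coords_arc1 C1).
  by have := coords_arc1 C2 pq t; lia.
- move=> _ _ /series_arcP[] [p [q [pq -> ->]]].
    have [s sK sP] := coords_chain C1 pq.
    exists s; first by rewrite leq_max sK.
    by move=> t; rewrite !cE; exact: sP.
  have [s sK sP] := coords_chain C2 pq.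
  exists s; first by rewrite leq_max sK orbT.
  by move=> [|a t]; [rewrite prefix0s|rewrite !cE /shift /= !addn0; exact: sP].
- move=> v; have [[p ->]|[q ->]] := series_vertexP v.
    have [s sK sP] := coords_supp C1 p.
    exists s; first by rewrite leq_max sK.
    by move=> t; rewrite !cE; exact: sP.
  have [s sK sP] := coords_supp C2 q.
  exists s; first by rewrite leq_max sK orbT.
  by move=> [|a t]; [rewrite prefix0s|rewrite !cE /shift /= !addn0; exact: sP].
- move=> v; have [[p ->]|[q ->]] := series_vertexP v; rewrite cE.
    exact: (wl bot p _ (coords_up C1 p)).
  rewrite /shift addnC; apply: (@walk_trans _ _ (series_low top)).
    by have := wl bot top _ (coords_up C1 top); rewrite (coords_top C1).
  exact: (wh bot q _ (coords_up C2 q)).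
- move=> v; have [[p ->]|[q ->]] := series_vertexP v.
    have [m mh pm] := low_top p; exists (m + h2); first by rewrite addnA mh.
    apply: walk_trans pm _.
    by have := wh bot top _ (coords_up C2 top); rewrite (coords_top C2).
  have [m mh qm] := coords_down C2 q; exists m; last exact: wh qm.
  by rewrite cE /shift; lia.
- have mixed p q : exists t, exists2 n, walk_length (series_low p) (series_high q) n &
      n + 3 * series_coords (series_low p) t <= 3 * series_coords (series_high q) t.
    exists [::]; have [m mh pm] := low_top p.
    exists (m + c2 q [::]).
      by apply: walk_trans pm _; exact: (wh bot q _ (coords_up C2 q)).
    by rewrite series_coords_high /shift; lia.
  move=> u v; have [[p ->]|[p ->]] := series_vertexP u;
    have [[q ->]|[q ->]] := series_vertexP v.
  + have [t [n pq nt]] := coords_dist C1 p q.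
    by exists t, n; [exact: wl|rewrite !cE].
  + by have [t [n pq nt]] := mixed p q; exists t, n => //; left.
  + have [t [n pq nt]] := mixed q p; exists t, n; first exact: walk_sym.
    by right.
  + have [t [n pq nt]] := coords_dist C2 p q.
    by exists t, n; [exact: wh|rewrite !cE /shift; lia].
Qed.

End SeriesCoords.

Section BranchCoords.
Variable G : tbgraph.
Let B := branch_graph G.

Definition branch_copy (n : nat) : vertex G -> vertex B := place bot top (pair n).

Lemma branch_vertexP (v : vertex B) : exists n p, v = branch_copy n p.
Proof.
case: v => [||[n i]]; by [exists 0, bot|exists 0, top|exists n, (inn i)].
Qed.

Lemma branch_copy_arc n p q : arc p q -> arc (branch_copy n p) (branch_copy n q).
Proof. by move=> pq; exists n, p, q. Qed.

Variables (K h : nat) (c : vertex G -> seq nat -> nat).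
Hypothesis C : coords K h c.

Let lift (n : nat) (d : seq nat -> nat) (t : seq nat) :=
  match t with
  | [::] => d [::]
  | m :: t' => if m == n then
      (if t' is [::] then minn (d [::]) (h - d [::]) else d t') else 0
  end.

(** In the copy of index [n] the node [[:: n]] receives the distance to the
    nearer end of the copy, and the nodes below it the former coordinates. *)
Definition branch_coords (v : vertex B) : seq nat -> nat :=
  match v with
  | bot => c bot
  | top => c top
  | inn (n, i) => lift n (c (inn i))
  end.

Lemma branch_coordsE n p t : branch_coords (branch_copy n p) t = lift n (c p) t.
Proof.
case: p => [||//] /=; case: t => [//|m [|b t]] /=;
  by rewrite ?(coords_bot C) ?(coords_top C) ?if_same ?subnn ?min0n ?minn0 ?if_same.
Qed.

(** For heights [a <= b] in two different copies of height [h], either the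
    way through the bottom or the way through the top is at most three times the
    largest of [b - a], [min a (h - a)] and [min b (h - b)]. *)
Lemma coords_branch : coords K.+1 h branch_coords.
Proof.
have w n := walk_hom (@branch_copy_arc n).
have ch p : c p [::] <= h by have [m] := coords_down C p; lia.
split.
- by move=> t; rewrite /= (coords_bot C).
- by move=> t; rewrite /= (coords_top C).
- by move=> _ _ [n [p [q [pq -> ->]]]]; rewrite !branch_coordsE /= (coords_arc C pq).
- move=> _ _ [n [p [q [pq -> ->]]]] t; rewrite !branch_coordsE.
  have pq1 := coords_arc1 C pq; have pq0 := coords_arc C pq.
  have := ch q; have := ch p; case: t => [|m [|b t]] /=; first by lia.
    by case: (m =P n) => _; lia.
  by case: (m =P n) => // _; exact: pq1.
- move=> _ _ [n [p [q [pq -> ->]]]]; have [s sK sP] := coords_chain C pq.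
  exists (n :: s); first by [].
  move=> [|m t]; first by rewrite prefix0s.
  rewrite !branch_coordsE /=; case: (m =P n) => [_|_] /=; last by case.
  case: t => [|b t] H; first by rewrite prefix0s.
  exact: sP.
- move=> v; have [n [p ->]] := branch_vertexP v; have [s sK sP] := coords_supp C p.
  exists (n :: s); first by [].
  move=> [|m t]; first by rewrite prefix0s.
  rewrite !branch_coordsE /=; case: (m =P n) => [_|_] //=.
  case: t => [|b t] H; first by rewrite prefix0s.
  exact: sP.
- move=> v; have [n [p ->]] := branch_vertexP v; rewrite branch_coordsE.
  exact: (w n bot p _ (coords_up C p)).
- move=> v; have [n [p ->]] := branch_vertexP v; rewrite branch_coordsE.
  by have [m mh pm] := coords_down C p; exists m => //; exact: (w n p top).
- move=> u v; have [n [p ->]] := branch_vertexP u; have [m [q ->]] := branch_vertexP v.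
  have [<-|nm] := eqVneq n m.
    have [t [k pq kt]] := coords_dist C p q.
    exists (if t is [::] then [::] else n :: t), k; first exact: w.
    by rewrite !branch_coordsE; case: t kt => //= b t; rewrite eqxx.
  have up : walk_length (branch_copy n p) (branch_copy m q) (c p [::] + c q [::]).
    apply: (@walk_trans _ _ bot); last exact: (w m bot q _ (coords_up C q)).
    by apply: walk_sym; exact: (w n bot p _ (coords_up C p)).
  have [a ah pa] := coords_down C p; have [b bh qb] := coords_down C q.
  have down : walk_length (branch_copy n p) (branch_copy m q) (a + b).
    apply: (@walk_trans _ _ top); first exact: (w n p top).
    by apply: walk_sym; exact: (w m q top).
  have x0 : branch_coords (branch_copy n p) [::] = c p [::] by rewrite branch_coordsE.
  have y0 : branch_coords (branch_copy m q) [::] = c q [::] by rewrite branch_coordsE.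
  have xn : branch_coords (branch_copy n p) [:: n] = minn (c p [::]) a.
    by rewrite branch_coordsE /= eqxx -ah addKn.
  have ym : branch_coords (branch_copy m q) [:: m] = minn (c q [::]) b.
    by rewrite branch_coordsE /= eqxx -bh addKn.
  have xm : branch_coords (branch_copy n p) [:: m] = 0.
    by rewrite branch_coordsE /= eq_sym (negbTE nm).
  have yn : branch_coords (branch_copy m q) [:: n] = 0.
    by rewrite branch_coordsE /= (negbTE nm).
  have [pq|qp] := leqP (c p [::]) (c q [::]).
    have [pa'|ap] := leqP (c p [::]) a.
      have [e|e] := leqP (c q [::]) (2 * c p [::]).
        by exists [:: n], (c p [::] + c q [::]) => //; rewrite xn yn; lia.
      by exists [::], (c p [::] + c q [::]) => //; rewrite x0 y0; lia.
    by exists [:: n], (a + b) => //; rewrite xn yn; lia.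
  have [qb'|bq] := leqP (c q [::]) b.
    have [e|e] := leqP (c p [::]) (2 * c q [::]).
      by exists [:: m], (c p [::] + c q [::]) => //; rewrite xm ym; lia.
    by exists [::], (c p [::] + c q [::]) => //; rewrite x0 y0; lia.
  by exists [:: m], (a + b) => //; rewrite xm ym; lia.
Qed.

End BranchCoords.

Lemma coords_bundle G : bundle_graph G -> exists K h c, @coords G K h c.
Proof.
elim=> [|{}G H _ [K1 [h1 [c1 C1]]] _ [K2 [h2 [c2 C2]]]|{}G _ [K [h [c C]]]].
- by do 3!eexists; exact: coords_edge.
- by do 3!eexists; exact: coords_series C1 C2.
- by do 3!eexists; exact: coords_branch C.
Qed.

(** * Coordinates on the powers of a bundle graph *)

(** Arcs lift, instead of being reflected, because the arcs of products, series
    and branchings are given by the existence of preimages. *)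
Record tb_iso (G H : tbgraph) (F : vertex G -> vertex H) : Prop := TbIso {
  iso_inj : injective F;
  iso_surj : forall v, exists u, F u = v;
  iso_bot : F bot = bot;
  iso_top : F top = top;
  iso_arc : forall u v, arc u v -> arc (F u) (F v);
  iso_arcP : forall u v, arc u v -> exists u' v', [/\ arc u' v', F u' = u & F v' = v] }.

Lemma coords_iso (G H : tbgraph) (F : vertex G -> vertex H) K h (c : vertex G -> seq nat -> nat) :
  tb_iso F -> coords K h c -> exists c', @coords H K h c'.
Proof.
move=> [Finj Fsurj Fbot Ftop Farc FarcP] C.
have [g gK] := choice Fsurj.
have Kg u : g (F u) = u by apply: Finj; rewrite gK.
have wF := walk_hom Farc.
have gbot : g bot = bot by rewrite -Fbot.
have gtop : g top = top by rewrite -Ftop.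
have garc u v : arc u v -> arc (g u) (g v).
  by move=> /FarcP[u' [v' [u'v' <- <-]]]; rewrite !Kg.
have wg u v n : walk_length (g u) (g v) n -> walk_length u v n.
  by move=> /wF; rewrite !gK.
exists (fun v => c (g v)); split.
- by rewrite gbot; exact: coords_bot C.
- by rewrite gtop; exact: coords_top C.
- by move=> p q /garc pq; exact: (coords_arc C pq).
- by move=> p q /garc pq; exact: (coords_arc1 C pq).
- by move=> p q /garc pq; exact: (coords_chain C pq).
- by move=> v; exact: (coords_supp C (g v)).
- by move=> v; apply: wg; rewrite gbot; exact: (coords_up C (g v)).
- move=> v; have [m mh vm] := coords_down C (g v); exists m => //.
  by apply: wg; rewrite gtop.
- move=> u v; have [t [n uv nt]] := coords_dist C (g u) (g v).
  by exists t, n => //; exact: wg.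
Qed.

Section OslashBasics.
Variables G H : tbgraph.

Definition edges (A : tbgraph) := {e : vertex A * vertex A | arc e.1 e.2}.

(** The vertices of [G] inside [oslash G H]. *)
Definition oslash_old : vertex G -> vertex (oslash G H) := place bot top (@inl _ _).
(** The copy of [H] that replaces the edge [e]. *)
Definition oslash_copy (e : edges G) : vertex H -> vertex (oslash G H) :=
  place (oslash_old (sval e).1) (oslash_old (sval e).2) (fun i => inr (e, i)).

Lemma oslash_copy_arc e p q : arc p q -> arc (oslash_copy e p) (oslash_copy e q).
Proof. by move=> pq; exists e, p, q. Qed.

Lemma oslash_vertexP (v : vertex (oslash G H)) :
  (exists u, v = oslash_old u) \/ (exists e i, v = oslash_copy e (inn i)).
Proof.
case: v => [||[a|[e i]]].
- by left; exists bot.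
- by left; exists top.
- by left; exists (inn a).
- by right; exists e, i.
Qed.

End OslashBasics.

Lemma edges_eq (A : tbgraph) (e e' : edges A) : sval e = sval e' -> e = e'.
Proof. by case: e e' => [e a] [e' a'] /= ee'; exact: eq_exist. Qed.

Lemma inn_inr_inj (I A B : Type) (x y : A) (i j : B) :
  @inn (I + A * B)%type (inr (x, i)) = inn (inr (y, j)) -> x = y /\ i = j.
Proof. by case. Qed.

Section OslashSingle.
Variables G H : tbgraph.
Hypothesis Gbt : arc (bot : vertex G) top.
Hypothesis Garc : forall u v : vertex G, arc u v -> u = bot /\ v = top.
Hypothesis Ginn : inner G -> False.

(** Covers the graphs that branching leaves a single edge, for which
    [oslash_branch] fails. *)
Lemma oslash_single : exists F : vertex H -> vertex (oslash G H), tb_iso F.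
Proof.
pose e0 : edges G := exist _ (bot, top) Gbt.
have eE e : e = e0.
  apply: edges_eq; case: e => -[u v] uv /=.
  by have /= [-> ->] := Garc uv.
exists (oslash_copy e0); split=> //.
- by move=> [||i] [||j] //= [->].
- move=> v; have [[[||a] ->]|[e [i ->]]] := oslash_vertexP v.
  + by exists bot.
  + by exists top.
  + by case: (Ginn a).
  + by exists (inn i); rewrite (eE e).
- exact: oslash_copy_arc.
- by move=> u v [e [p [q [pq -> ->]]]]; exists p, q; rewrite (eE e).
Qed.

End OslashSingle.

Section OslashSeries.
Variables G1 G2 H : tbgraph.
Hypothesis irr1 : forall u : vertex G1, ~ arc u u.

Let K := series_graph (oslash G1 H) (oslash G2 H).
Let M := oslash (series_graph G1 G2) H.

Let E1 (e : edges G1) : edges (series_graph G1 G2) :=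
  exist _ (series_low G2 (sval e).1, series_low G2 (sval e).2)
    (series_low_arc G2 (svalP e)).
Let E2 (e : edges G2) : edges (series_graph G1 G2) :=
  exist _ (series_high G1 (sval e).1, series_high G1 (sval e).2)
    (series_high_arc G1 (svalP e)).

Let F (v : vertex K) : vertex M :=
  match v with
  | bot => bot
  | top => top
  | inn (inl (inl a)) => inn (inl (inl a))
  | inn (inl (inr (e, i))) => inn (inr (E1 e, i))
  | inn (inr None) => inn (inl (inr None))
  | inn (inr (Some (inl b))) => inn (inl (inr (Some b)))
  | inn (inr (Some (inr (e, i)))) => inn (inr (E2 e, i))
  end.

Let F_low e p : F (series_low _ (oslash_copy e p)) = oslash_copy (E1 e) p.
Proof. by case: p => //=; case: e => -[[||a] [||b]] ab. Qed.

Let F_high e p : F (series_high _ (oslash_copy e p)) = oslash_copy (E2 e) p.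
Proof. by case: p => //=; case: e => -[[||a] [||b]] ab. Qed.

Let low_inj : injective (series_low (G := G1) G2).
Proof. by move=> [||a] [||b] //= [->]. Qed.

Let high_inj : injective (series_high G1 (H := G2)).
Proof. by move=> [||a] [||b] //= [->]. Qed.

Let E1_inj e e' : E1 e = E1 e' -> e = e'.
Proof.
move=> /(congr1 sval) /= [/low_inj e1 /low_inj e2]; apply: edges_eq.
by move: e1 e2; case: (sval e) (sval e') => ? ? [? ?] /= -> ->.
Qed.

Let E2_inj e e' : E2 e = E2 e' -> e = e'.
Proof.
move=> /(congr1 sval) /= [/high_inj e1 /high_inj e2]; apply: edges_eq.
by move: e1 e2; case: (sval e) (sval e') => ? ? [? ?] /= -> ->.
Qed.

Let low_high p q : series_low G2 p = series_high G1 q -> p = top.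
Proof. by case: p q => [||a] [||b]. Qed.

Let E12 e e' : E1 e <> E2 e'.
Proof.
move=> /(congr1 sval) /= [/low_high e1 /low_high e2].
by have := svalP e; rewrite /= e1 e2; exact: irr1.
Qed.

Let edge_case (e : edges (series_graph G1 G2)) :
  (exists e1, e = E1 e1) \/ (exists e2, e = E2 e2).
Proof.
case: e => -[u v] /= uv; have [[p [q [pq ? ?]]]|[p [q [pq ? ?]]]] := uv.
  by left; exists (exist _ (p, q) pq); apply: edges_eq; subst.
by right; exists (exist _ (p, q) pq); apply: edges_eq; subst.
Qed.

(** Irreflexivity keeps the edges of the two factors apart at the middle vertex. *)
Lemma oslash_series : exists F : vertex K -> vertex M, tb_iso F.
Proof.
exists F; split=> //.
- move=> [||[[a|[e i]]|[[b|[e i]]|]]] [||[[a'|[e' i']]|[[b'|[e' i']]|]]] //=.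
  + by case=> ->.
  + by move=> HH; have [ee ii] := inn_inr_inj HH; rewrite ii (E1_inj ee).
  + by move=> HH; have [ee _] := inn_inr_inj HH; case: (E12 ee).
  + by case=> ->.
  + by move=> HH; have [ee _] := inn_inr_inj HH; case: (E12 (esym ee)).
  + by move=> HH; have [ee ii] := inn_inr_inj HH; rewrite ii (E2_inj ee).
- move=> v; have [[[||[a|[b|]]] ->]|[e [i ->]]] := oslash_vertexP v.
  + by exists bot.
  + by exists top.
  + by exists (inn (inl (inl a))).
  + by exists (inn (inr (Some (inl b)))).
  + by exists (inn (inr None)).
  + have [[e1 ->]|[e2 ->]] := edge_case e.
      by exists (series_low _ (oslash_copy e1 (inn i))).
    by exists (series_high _ (oslash_copy e2 (inn i))).
- move=> _ _ [[_ [_ [[e [p [q [pq -> ->]]]] -> ->]]]|[_ [_ [[e [p [q [pq -> ->]]]] -> ->]]]].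
    by have := oslash_copy_arc (E1 e) pq; rewrite -!F_low.
  by have := oslash_copy_arc (E2 e) pq; rewrite -!F_high.
- move=> _ _ [e [p [q [pq -> ->]]]]; have [[e1 ->]|[e2 ->]] := edge_case e.
    exists (series_low _ (oslash_copy e1 p)), (series_low _ (oslash_copy e1 q)).
    by split; [exact/series_low_arc/oslash_copy_arc|exact: F_low|exact: F_low].
  exists (series_high _ (oslash_copy e2 p)), (series_high _ (oslash_copy e2 q)).
  by split; [exact/series_high_arc/oslash_copy_arc|exact: F_high|exact: F_high].
Qed.

End OslashSeries.

Section OslashBranch.
Variables G H : tbgraph.
Hypothesis arc_inner : forall u v : vertex G, arc u v ->
  (exists i, u = inn i) \/ (exists i, v = inn i).

Let K := branch_graph (oslash G H).
Let M := oslash (branch_graph G) H.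

Let E (n : nat) (e : edges G) : edges (branch_graph G) :=
  exist _ (branch_copy n (sval e).1, branch_copy n (sval e).2)
    (branch_copy_arc n (svalP e)).

Let F (v : vertex K) : vertex M :=
  match v with
  | bot => bot
  | top => top
  | inn (n, inl a) => inn (inl (n, a))
  | inn (n, inr (e, i)) => inn (inr (E n e, i))
  end.

Let F_copy n e p : F (branch_copy n (oslash_copy e p)) = oslash_copy (E n e) p.
Proof. by case: p => //=; case: e => -[[||a] [||b]] ab. Qed.

Let copy_inj n m (p q : vertex G) : branch_copy n p = branch_copy m q -> p = q.
Proof. by case: p q => [||a] [||b] //= [_ ->]. Qed.

Let E_inj n m e e' : E n e = E m e' -> n = m /\ e = e'.
Proof.
move=> /(congr1 sval) /= ee'.
have [e1 e2] : branch_copy n (sval e).1 = branch_copy m (sval e').1 /\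
  branch_copy n (sval e).2 = branch_copy m (sval e').2 by case: ee'.
split.
  have [[i ui]|[i ui]] := arc_inner (svalP e).
    by move: e1; rewrite ui; case: (sval e').1 => [||j] //= [].
  by move: e2; rewrite ui; case: (sval e').2 => [||j] //= [].
apply: edges_eq; move: (copy_inj e1) (copy_inj e2).
by case: (sval e) (sval e') => ? ? [? ?] /= -> ->.
Qed.

Let edge_case (e : edges (branch_graph G)) : exists n e', e = E n e'.
Proof.
case: e => -[u v] /= uv; have [n [p [q [pq ? ?]]]] := uv.
by exists n, (exist _ (p, q) pq); apply: edges_eq; subst.
Qed.

(** An edge without inner endpoint would be shared by all the copies in
    [branch_graph G], whereas [branch_graph (oslash G H)] has one copy of [H]
    for each of them. *)
Lemma oslash_branch : exists F : vertex K -> vertex M, tb_iso F.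
Proof.
exists F; split=> //.
- move=> [||[n [a|[e i]]]] [||[n' [a'|[e' i']]]] //=.
    by case=> -> ->.
  by move=> HH; have [ee ii] := inn_inr_inj HH; rewrite ii; have [-> ->] := E_inj ee.
- move=> v; have [[[||[n a]] ->]|[e [i ->]]] := oslash_vertexP v.
  + by exists bot.
  + by exists top.
  + by exists (inn (n, inl a)).
  + have [n [e' ->]] := edge_case e.
    by exists (branch_copy n (oslash_copy e' (inn i))).
- move=> _ _ [n [_ [_ [[e [p [q [pq -> ->]]]] -> ->]]]].
  by have := oslash_copy_arc (E n e) pq; rewrite -!F_copy.
- move=> _ _ [e [p [q [pq -> ->]]]]; have [n [e' ->]] := edge_case e.
  exists (branch_copy n (oslash_copy e' p)), (branch_copy n (oslash_copy e' q)).
  by split; [exact/branch_copy_arc/oslash_copy_arc|exact: F_copy|exact: F_copy].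
Qed.

End OslashBranch.

Section CoordsInner.
Variables (G : tbgraph) (K h : nat) (c : vertex G -> seq nat -> nat).
Hypothesis C : coords K h c.

Lemma coords_irr (u : vertex G) : ~ arc u u.
Proof. by move=> /(coords_arc C); lia. Qed.

(** A walk of length zero would identify an inner vertex with an end. *)
Lemma coords_inner (i : inner G) : 0 < c (inn i) [::] < h.
Proof.
have [m mh im] := coords_down C (inn i); have iu := coords_up C (inn i).
have m0 : m != 0 by apply/negP => /eqP m0; move: im; rewrite m0 => /walk0_eq.
have c0 : c (inn i) [::] != 0.
  by apply/negP => /eqP c0; move: iu; rewrite c0 => /walk0_eq.
lia.
Qed.

Lemma coords_no_inner_arc (u v : vertex G) : arc u v ->
  (exists i, u = inn i) \/ (exists i, v = inn i) \/ (u = bot /\ v = top /\ h = 1).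
Proof.
move=> uv; have := coords_arc C uv; move: uv; case: u => [||i] uv; last by left; exists i.
- case: v uv => [||i] uv; last by right; left; exists i.
    by rewrite !(coords_bot C).
  by rewrite (coords_bot C) (coords_top C) => ->; right; right.
- case: v uv => [||i] uv; last by right; left; exists i.
    by rewrite (coords_bot C).
  by move=> e; case: (coords_irr uv).
Qed.

End CoordsInner.

(** Induction on [G]: the product with [H] commutes with series and branching
    up to isomorphism, except for the branching of single edges. *)
Lemma coords_oslash G H K h (c : vertex H -> seq nat -> nat) : bundle_graph G -> @coords H K h c ->
  exists K' h' c', @coords (oslash G H) K' h' c'.
Proof.
move=> bG C; elim: bG => [|G1 G2 bG1 [K1 [h1 [c1 C1]]] _ [K2 [h2 [c2 C2]]]
  |G1 bG1 [K1 [h1 [c1 C1]]]].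
- have [||//|F Fiso] := @oslash_single edge_graph H.
  + by [].
  + by move=> u v [].
  + by have [c' C'] := coords_iso Fiso C; exists K, h, c'.
- have [K0 [h0 [c0 C0]]] := coords_bundle bG1.
  have [F Fiso] := @oslash_series G1 G2 H (coords_irr C0).
  have [c' C'] := coords_iso Fiso (coords_series C1 C2).
  by do 3!eexists; exact: C'.
- have [K0 [h0 [c0 C0]]] := coords_bundle bG1.
  (* A graph of height one is a single edge, and so is its branching. *)
  have [h01|h01] := eqVneq h0 1.
    have Ginn : inner (branch_graph G1) -> False.
      by move=> [_ i]; have := coords_inner C0 i; rewrite h01; lia.
    have CB := coords_branch C0.
    have Garc (u v : vertex (branch_graph G1)) : arc u v -> u = bot /\ v = top.
      by move=> /(coords_no_inner_arc CB) [[i]|[[i]|[-> [-> _]]]] //; case: (Ginn i).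
    have Gbt : arc (bot : vertex (branch_graph G1)) top.
      have := coords_up CB top; rewrite (coords_top CB) h01 => -[p [pp pl ps]].
      case: p pp pl ps => [|w [|? ?]] //= /andP[/asboolP bw _] wt _.
      by case: bw => bw; [rewrite wt in bw|have [] := Garc _ _ bw].
    have [F Fiso] := @oslash_single _ H Gbt Garc Ginn.
    by have [c' C'] := coords_iso Fiso C; exists K, h, c'.
  have [|F Fiso] := @oslash_branch G1 H.
    by move=> u v /(coords_no_inner_arc C0) [|[|[_ [_ h1']]]]; [left|right|rewrite h1' in h01].
  have [c' C'] := coords_iso Fiso (coords_branch C1).
  by do 3!eexists; exact: C'.
Qed.

Lemma coords_oslash_power G n : bundle_graph G ->
  exists K h c, @coords (oslash_power G n) K h c.
Proof.
move=> bG; elim: n => [|n [K [h [c C]]]]; first exact: coords_bundle.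
exact: coords_oslash C.
Qed.

(** * Heights in a product of graphs, and forks *)

(** The part of [coords] that concerns heights alone. *)
Record ranked (G : tbgraph) (h : nat) (r : vertex G -> nat) : Prop := Ranked {
  rank_bot : r bot = 0;
  rank_top : r top = h;
  rank_arc : forall p q, arc p q -> r q = (r p).+1;
  rank_up : forall v, walk_length bot v (r v);
  rank_down : forall v, exists2 m, r v + m = h & walk_length v top m }.

Lemma coords_ranked (G : tbgraph) K h (c : vertex G -> seq nat -> nat) :
  coords K h c -> ranked h (fun v => c v [::]).
Proof.
move=> C; split; first by rewrite (coords_bot C).
- by rewrite (coords_top C).
- by move=> p q /(coords_arc C).
- exact: coords_up C.
- exact: coords_down C.
Qed.

Lemma ranked_connected (G : tbgraph) h (r : vertex G -> nat) (u v : vertex G) :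
  ranked h r -> exists n, walk_length u v n.
Proof.
move=> Gr; exists (r u + r v).
by apply: walk_trans (rank_up Gr v); apply: walk_sym; exact: rank_up Gr u.
Qed.

Lemma ranked_dist (G : tbgraph) h (r : vertex G -> nat) :
  ranked h r -> h <= graph_dist (bot : vertex G) top.
Proof.
move=> Gr; have [n w] := ranked_connected bot top Gr.
have := walk_potential (phi := r) _ (graph_dist_walk (walk_sym w)).
rewrite (rank_top Gr) (rank_bot Gr) add0n => H.
have -> : graph_dist (bot : vertex G) top = graph_dist (top : vertex G) bot.
  apply/eqP; rewrite eqn_leq.
  apply/andP; split; apply: graph_dist_le; apply: walk_sym; apply: graph_dist_walk.
    exact: walk_sym w.
  exact: w.
by apply: H => p q /(rank_arc Gr) ->; lia.
Qed.

Section OslashRank.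
Variables (G H : tbgraph) (h h' : nat) (r : vertex G -> nat) (r' : vertex H -> nat).
Hypotheses (Gr : ranked h r) (Hr : ranked h' r').

Definition oslash_rank (v : vertex (oslash G H)) : nat :=
  match v with
  | bot => 0
  | top => h * h'
  | inn (inl a) => r (inn a) * h'
  | inn (inr (e, i)) => r (sval e).1 * h' + r' (inn i)
  end.

Lemma oslash_rank_old u : oslash_rank (oslash_old H u) = r u * h'.
Proof. by case: u => [||a] //=; rewrite ?(rank_bot Gr) ?(rank_top Gr). Qed.

Lemma oslash_rank_copy (e : edges G) p :
  oslash_rank (oslash_copy e p) = r (sval e).1 * h' + r' p.
Proof.
case: p => [||i] //=; rewrite oslash_rank_old ?(rank_bot Hr) ?(rank_top Hr) ?addn0//.
by rewrite (rank_arc Gr (svalP e)) mulSn addnC.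
Qed.

Lemma oslash_old_walk (u v : vertex G) n :
  walk_length u v n -> walk_length (oslash_old H u) (oslash_old H v) (n * h').
Proof.
apply: walk_scale => {}u {}v uv; pose e : edges G := exist _ (u, v) uv.
have := walk_hom (@oslash_copy_arc _ _ e) (rank_up Hr top).
by rewrite (rank_top Hr).
Qed.

Lemma ranked_oslash : ranked (h * h') oslash_rank.
Proof.
split=> //.
- by move=> _ _ [e [p [q [pq -> ->]]]]; rewrite !oslash_rank_copy (rank_arc Hr pq) addnS.
- move=> v; have [[u ->]|[e [i ->]]] := oslash_vertexP v.
    by rewrite oslash_rank_old; exact: oslash_old_walk (rank_up Gr u).
  rewrite oslash_rank_copy; apply: walk_trans (oslash_old_walk (rank_up Gr (sval e).1)) _.
  exact: (walk_hom (@oslash_copy_arc _ _ e) (rank_up Hr (inn i))).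
- move=> v; have [[u ->]|[e [i ->]]] := oslash_vertexP v.
    have [m mh um] := rank_down Gr u; exists (m * h'); last exact: oslash_old_walk um.
    by rewrite oslash_rank_old -mulnDl mh.
  have [m mh im] := rank_down Hr (inn i); have [k kh ek] := rank_down Gr (sval e).2.
  exists (m + k * h').
    rewrite oslash_rank_copy -kh (rank_arc Gr (svalP e)) -mh; lia.
  apply: walk_trans (oslash_old_walk ek).
  exact: (walk_hom (@oslash_copy_arc _ _ e) im).
Qed.

(** The copy is a retract: everything below its level goes to the bottom,
    everything above to the top, and the other copies at the same level are
    folded onto it. *)
Lemma oslash_copy_dist (e : edges G) (x y : vertex H) :
  graph_dist x y <= graph_dist (oslash_copy e x) (oslash_copy e y).
Proof.
pose k := r (sval e).1.
(* [a] is the height in [G] at which a copy of [H] starts. *)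
pose clamp (a : nat) (p : vertex H) : vertex H :=
  if a == k then p else if a < k then bot else top.
pose ret (v : vertex (oslash G H)) : vertex H :=
  match v with
  | bot => clamp (r bot) bot
  | top => clamp (r top) bot
  | inn (inl a) => clamp (r (inn a)) bot
  | inn (inr (e', i)) => clamp (r (sval e').1) (inn i)
  end.
have ret_old u : ret (oslash_old H u) = clamp (r u) bot by case: u.
have ret_copy e' p : ret (oslash_copy e' p) = clamp (r (sval e').1) p.
  case: p => [||i] //=; rewrite ret_old // (rank_arc Gr (svalP e')) /clamp.
  set a := r _; have [ak|ak|->] := ltngtP a k.
  - by have [ak'|ak'|_] := ltngtP a.+1 k => //; move: ak ak'; lia.
  - by have [ak'|ak'|ak'] := ltngtP a.+1 k => //; move: ak ak'; lia.
  - by have [ak'|ak'|ak'] := ltngtP k.+1 k => //; move: ak'; lia.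
have ret_arc u v : arc u v -> ret u = ret v \/ arc (ret u) (ret v).
  move=> [e' [p [q [pq -> ->]]]]; rewrite !ret_copy /clamp.
  by case: eqP => _; [right|left].
have [n w] := ranked_connected (oslash_copy e x) (oslash_copy e y) ranked_oslash.
have [m mn wm] := walk_contract ret_arc (graph_dist_walk w).
apply: leq_trans mn; apply: graph_dist_le.
by move: wm; rewrite !ret_copy /clamp eqxx.
Qed.

(** The indicator of [u], multiplied by the height of [H] and interpolated
    linearly along the copies of [H], is a 1-Lipschitz function. *)
Lemma oslash_old_dist (u v : vertex G) : u <> v ->
  h' <= graph_dist (oslash_old H u) (oslash_old H v).
Proof.
move=> uv.
pose at_u (w : vertex G) := `[< w = u >].
pose phi (w : vertex (oslash G H)) : nat :=
  match w with
  | bot => if at_u bot then h' else 0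
  | top => if at_u top then h' else 0
  | inn (inl a) => if at_u (inn a) then h' else 0
  | inn (inr (e, i)) => if at_u (sval e).1 then h' - r' (inn i)
      else if at_u (sval e).2 then r' (inn i) else 0
  end.
have phi_old w : phi (oslash_old H w) = if at_u w then h' else 0 by case: w.
have phi_copy e p : phi (oslash_copy e p) = if at_u (sval e).1 then h' - r' p
      else if at_u (sval e).2 then r' p else 0.
  case: p => [||i] //=; rewrite phi_old ?(rank_bot Hr) ?(rank_top Hr) ?subn0 ?subnn.
    by case: ifP => // _; case: ifP.
  case: ifP => // /asboolP e1; case: ifP => // /asboolP e2.
    by have := rank_arc Gr (svalP e); rewrite e1 e2; lia.
have [n w] := ranked_connected (oslash_old H u) (oslash_old H v) ranked_oslash.
have := walk_potential (phi := phi) _ (graph_dist_walk w).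
rewrite !phi_old /at_u asboolT// asboolF; last by move=> vu; apply: uv.
rewrite add0n; apply=> _ _ [e [p [q [pq -> ->]]]]; rewrite !phi_copy.
by case: ifP => _; [|case: ifP => _]; have := rank_arc Hr pq; lia.
Qed.

End OslashRank.

(** Together with the two ends, infinitely many distinct vertices [v i] at the
    same level lie on geodesics from bottom to top that agree outside the
    portion from [A] to [B]. *)
Definition fork (G : tbgraph) (h : nat) := exists (A B : vertex G) (v : nat -> vertex G) n1 k l n2,
  [/\ walk_length bot A n1, (forall i, walk_length A (v i) k /\ walk_length (v i) B l),
      walk_length B top n2, injective v & [/\ 0 < k, 0 < l & n1 + (k + l) + n2 = h]].

Lemma nontrivial_fork G : nontrivial_bundle_graph G ->
  exists K h c, @coords G K h c /\ fork G h.
Proof.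
elim=> [{}G H _ [K1 [h1 [c1 [C1 F1]]]] /coords_bundle[K2 [h2 [c2 C2]]]
  |{}G H /coords_bundle[K1 [h1 [c1 C1]]] _ [K2 [h2 [c2 [C2 F2]]]]
  |{}G bG nG].
- exists (maxn K1 K2), (h1 + h2), (series_coords h1 c1 c2); split; first exact: coords_series.
  have [A [B [v [n1 [k [l [n2 [A1 v1 B1 vinj [k0 l0 hE]]]]]]]]] := F1.
  have wl := walk_hom (@series_low_arc G H); have wh := walk_hom (@series_high_arc G H).
  exists (series_low H A), (series_low H B), (fun i => series_low H (v i)), n1, k, l, (n2 + h2).
  split; first exact: (wl bot A).
  + by move=> i; have [vA vB] := v1 i; split; exact: wl.
  + apply: walk_trans (wl _ _ _ B1) _.
    by have := wh bot top _ (coords_up C2 top); rewrite (coords_top C2).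
  + by move=> i j E; apply: vinj; move: E; case: (v i) (v j) => [||a] [||b] //= [->].
  + by split=> //; lia.
- exists (maxn K1 K2), (h1 + h2), (series_coords h1 c1 c2); split; first exact: coords_series.
  have [A [B [v [n1 [k [l [n2 [A1 v1 B1 vinj [k0 l0 hE]]]]]]]]] := F2.
  have wl := walk_hom (@series_low_arc G H); have wh := walk_hom (@series_high_arc G H).
  exists (series_high G A), (series_high G B), (fun i => series_high G (v i)), (h1 + n1), k, l, n2.
  split.
  + apply: walk_trans (wh _ _ _ A1).
    by have := wl bot top _ (coords_up C1 top); rewrite (coords_top C1).
  + by move=> i; have [vA vB] := v1 i; split; exact: wh.
  + exact: (wh B top).
  + by move=> i j E; apply: vinj; move: E; case: (v i) (v j) => [||a] [||b] //= [->].
  + by split=> //; lia.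
- have [K [h [c C]]] := coords_bundle bG.
  have [x0 _] : exists x : inner G, True.
    apply: contrapT => /forallNP noinn; apply: nG.
    have Ginn : inner G -> False by move=> x; exact: noinn x I.
    split=> //.
    have : walk_length (bot : vertex G) top h.
      by have := coords_up C top; rewrite (coords_top C).
    move=> [p [pp pl _]]; case: p pp pl => [//|w p] /= /andP[/asboolP bw pp] wp.
    case: w bw pp wp => [||i] bw pp wp; last by case: (Ginn i).
      by case: bw => bw; case: (coords_irr C bw).
    exact: bw.
  exists K.+1, h, (branch_coords h c); split; first exact: coords_branch.
  have [m mh xm] := coords_down C (inn x0).
  have := coords_inner C x0 => /andP[cx0 cx1].
  have w n := walk_hom (@branch_copy_arc G n).
  exists bot, top, (fun i => branch_copy i (inn x0)), 0, (c (inn x0) [::]), m, 0.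
  split; [exact: walk0| |exact: walk0| |].
  + by move=> i; split; [exact: (w i bot _ _ (coords_up C _))|exact: (w i _ top)].
  + by move=> i j [].
  + by split=> //; lia.
Qed.

Local Open Scope ring_scope.

(** * The weak-star topology of a dual space *)

Section WeakStar.
Context {R : realType} (X : normedModType R).
Implicit Types (f g v : dual X) (x : X) (xs : seq X) (Y : set (dual X)).

Lemma dualD f x y : f (x + y) = f x + f y.
Proof.
have /asboolP[lf _] := dual_funP f.
by have := lf 1 x y; rewrite !scale1r.
Qed.

Lemma dual0 f : f 0 = 0.
Proof. by apply: (@addrI _ (f 0)); rewrite -dualD !addr0. Qed.

Lemma dualZ f a x : f (a *: x) = a * f x.
Proof.
have /asboolP[lf _] := dual_funP f.
by have := lf a x 0; rewrite !addr0 dual0 addr0.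
Qed.

Lemma dualN f x : f (- x) = - f x.
Proof. by rewrite -scaleN1r dualZ mulN1r. Qed.

Lemma dualB f x y : f (x - y) = f x - f y.
Proof. by rewrite dualD dualN. Qed.

Lemma dual_addE f g x : (f + g) x = f x + g x. Proof. by []. Qed.
Lemma dual_scaleE (a : R) f x : (a *: f) x = a * f x. Proof. by []. Qed.
Lemma dual_oppE f x : (- f) x = - f x. Proof. by []. Qed.
Lemma dual_subE f g x : (f - g) x = f x - g x. Proof. by []. Qed.
Lemma le_dual f x : `|f x| <= `|f| * `|x|.
Proof. exact: le_dual_norm. Qed.

Lemma dual_le f M : (forall x, `|x| <= 1 -> `|f x| <= M) -> `|f| <= M.
Proof. exact: dual_norm_le. Qed.

Definition wball v xs (e : R) : set (dual X) :=
  [set f | forall x, x \in xs -> `|f x - v x| < e].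

Lemma eval_wstar_continuous x : continuous (fun f : weak_star X => f x : R^o).
Proof.
move=> f.
have cvgF : {ptws, (fun h : weak_star X => (h : dual X) : X -> R) @
    nbhs (f : weak_star X) --> (f : X -> R)}.
  exact: (@initial_continuous _ _ (fun f : dual X => (f : {ptws X -> R})) f).
have /pointwise_cvgP/(_ x) := cvgF; exact.
Qed.

Lemma wball_filter v :
  Filter (filter_from [set p : seq X * R | 0 < p.2] (fun p => wball v p.1 p.2)).
Proof.
apply: filter_from_filter; first by exists ([::], 1) => /=.
move=> [xs1 e1] [xs2 e2] /= e10 e20; exists (xs1 ++ xs2, Num.min e1 e2) => /=.
  by rewrite lt_min e10 e20.
move=> f Hf; split=> x xs; have := Hf x.
  by rewrite mem_cat xs lt_min => /(_ isT) /andP[].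
by rewrite mem_cat xs orbT lt_min => /(_ isT) /andP[].
Qed.

(** The sets [wball v xs e] are the base of a filter converging to [v] pointwise. *)
Lemma wstar_nbhs_wball v (A : set (dual X)) :
  nbhs (v : weak_star X) (A : set (weak_star X)) ->
  exists xs e, 0 < e /\ wball v xs e `<=` A.
Proof.
pose W := filter_from [set p : seq X * R | 0 < p.2] (fun p => wball v p.1 p.2).
have WF : Filter W := wball_filter v.
suff WA : W --> (v : weak_star X).
  by move=> /WA [[xs e] /= e0 sub]; exists xs, e.
have cvgW : {ptws, (fun f : dual X => f : X -> R) @ W --> (v : X -> R)}.
  apply/pointwise_cvgP => x; apply/cvgrPdist_lt => e e0.
  exists ([:: x], e) => //= f /(_ x); rewrite inE eqxx distrC.
  exact.
move=> B [C [[U oU UC] Cv] CB]; have Uv : nbhs (v : {ptws X -> R}) U.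
  by apply: open_nbhs_nbhs; split=> //; move: Cv; rewrite -UC.
by apply: filterS CB _; rewrite -UC; exact: cvgW.
Qed.

Lemma wball_nbhs v xs e : 0 < e ->
  nbhs (v : weak_star X) (wball v xs e : set (weak_star X)).
Proof.
move=> e0; elim: xs => [|x xs IH]; first by apply: filterE => f x; rewrite in_nil.
have ex : nbhs (v : weak_star X)
    ([set f : dual X | `|f x - v x| < e] : set (weak_star X)).
  have /cvgrPdist_lt/(_ e e0) := @eval_wstar_continuous x v.
  by apply: filterS => f; rewrite distrC.
apply: filterS (filterI ex IH) => f [fx fxs] z.
by rewrite inE => /orP[/eqP->|/fxs].
Qed.

Lemma wball_open v xs e : 0 < e ->
  exists2 U : set (dual X), open (U : set (weak_star X)) & U v /\ U `<=` wball v xs e.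
Proof. by move=> /(wball_nbhs v xs) [U [oU Uv] sub]; exists U. Qed.

(** Evaluations at finitely many vectors either send [v] into the image of [Y]
    or separate it from that image by a linear combination of them. *)
Lemma separate_aux xs Y v : subspace_set Y ->
  (exists2 y, Y y & forall x, x \in xs -> y x = v x) \/
  (exists2 x, (forall y, Y y -> y x = 0) & v x != 0).
Proof.
elim: xs Y v => [|x xs IH] Y v [Y0 YD]; first by left; exists 0.
have [[u Yu ux]|/forall2NP nu] := pselect (exists2 u, Y u & u x = 1).
  have Y'S : subspace_set [set y | Y y /\ y x = 0].
    split=> [|a y z [Yy y0] [Yz z0]]; first by split.
    by split; [exact: YD|rewrite dual_addE dual_scaleE y0 z0 mulr0 addr0].
  have [[y [Yy y0] yv]|[x1 x1Y x1v]] := IH _ (v - v x *: u) Y'S.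
    left; exists (v x *: u + y); first exact: YD.
    move=> z; rewrite inE => /orP[/eqP->|/yv].
      by rewrite dual_addE dual_scaleE ux y0 mulr1 addr0.
    move=> yz; rewrite dual_addE dual_scaleE yz.
    by rewrite dual_subE dual_scaleE addrC subrK.
  right; exists (x1 - u x1 *: x) => [y Yy|].
    have /x1Y : [set y | Y y /\ y x = 0] (- y x *: u + y).
      by split; [exact: YD|rewrite dual_addE dual_scaleE ux mulr1 addNr].
    rewrite dual_addE dual_scaleE dualB dualZ => /eqP; rewrite addrC mulNr.
    by rewrite mulrC => /eqP.
  move: x1v; rewrite dual_subE dual_scaleE dualB dualZ; congr (_ != _).
  by rewrite mulrC.
have Yx0 y : Y y -> y x = 0.
  move=> Yy; apply: contrapT => /eqP yx0; case: (nu ((y x)^-1 *: y + 0)).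
    by apply; exact: YD.
  by apply; rewrite addr0 dual_scaleE mulVf.
have [vx0|vx0] := eqVneq (v x) 0; last by right; exists x.
have [[y Yy yv]|[z zY zv]] := IH Y v (conj Y0 YD); last by right; exists z.
left; exists y => // z; rewrite inE => /orP[/eqP->|/yv//].
by rewrite vx0 Yx0.
Qed.

(** Weak* closedness of a subspace in linear terms; this form of it passes to
    the sum with a line. *)
Definition separated Y := forall v, ~ Y v ->
  exists2 x, (forall y, Y y -> y x = 0) & v x != 0.

Lemma wstar_closed_separated Y :
  subspace_set Y -> closed (Y : set (weak_star X)) -> separated Y.
Proof.
move=> sY cY v nYv.
have : nbhs (v : weak_star X) (~` Y : set (weak_star X)).
  by apply: open_nbhs_nbhs; split=> //; exact: closed_openC.
move=> /wstar_nbhs_wball[xs [e [e0 sub]]].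
have [[y Yy yv]|//] := @separate_aux xs Y v sY.
by case: (sub y) => // x /yv ->; rewrite subrr normr0.
Qed.

Definition ker_set xs : set (dual X) := [set f | forall x, x \in xs -> f x = 0].

Lemma ker_set_subspace xs : subspace_set (ker_set xs).
Proof.
split=> [//|a u v uxs vxs x xxs].
by rewrite dual_addE dual_scaleE uxs// vxs// mulr0 addr0.
Qed.

(** Each step down in codimension costs one more vector [x1], which vanishes on
    [Y] and not on the missing direction. *)
Lemma separated_ker Y (n : nat) (v : 'I_n -> dual X) :
  subspace_set Y -> separated Y ->
  (forall f, exists (y : dual X) (c : 'I_n -> R),
     Y y /\ f = y + \sum_(i < n) c i *: v i) ->
  exists xs, ker_set xs `<=` Y.
Proof.
elim: n Y v => [|n IH] Y v sY spY Yv.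
  exists [::] => f _; have [y [c [Yy ->]]] := Yv f.
  by rewrite big_ord0 addr0.
pose w := v ord_max.
pose Z : set (dual X) := [set f | exists2 a : R, Y (f - a *: w) & True].
have ZP y a : Y y -> Z (y + a *: w) by move=> Yy; exists a => //; rewrite addrK.
have sZ : subspace_set Z.
  have [Y0 YD] := sY; split; first by exists 0 => //; rewrite scale0r subr0.
  move=> a f g [b Yf _] [c Yg _]; exists (a * b + c) => //.
  have -> : a *: f + g - (a * b + c) *: w = a *: (f - b *: w) + (g - c *: w).
    by rewrite scalerDl scalerBr scalerA opprD addrACA.
  exact: YD.
have [Yw|nYw] := pselect (Y w).
  apply: (IH Y (fun i => v (widen_ord (leqnSn n) i))) => // f.
  have [y [c [Yy ->]]] := Yv f.
  exists (c ord_max *: w + y), (fun i => c (widen_ord (leqnSn n) i)); split.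
    by have [_] := sY; apply.
  by rewrite big_ord_recr /= -/w [c ord_max *: w + y]addrC -addrA [X in y + X]addrC.
have [x0 x0Y x0w] := spY w nYw.
have [x1 x1w x1Y] : exists2 x1, w x1 = 1 & forall y, Y y -> y x1 = 0.
  exists ((w x0)^-1 *: x0); first by rewrite dualZ mulVf.
  by move=> y /x0Y yx; rewrite dualZ yx mulr0.
have spZ : separated Z.
  move=> u nZu.
  have /spY[x2 x2Y x2u] : ~ Y (u - u x1 *: w) by move=> Yu; apply: nZu; exists (u x1).
  exists (x2 - w x2 *: x1).
    move=> y [a Yy _]; have := x2Y _ Yy; have := x1Y _ Yy.
    rewrite !dual_subE !dual_scaleE dualB dualZ x1w mulr1.
    move=> /subr0_eq -> /subr0_eq ->.
    by rewrite mulrC subrr.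
  by move: x2u; rewrite dual_subE dual_scaleE dualB dualZ [w x2 * _]mulrC.
have [|xs xsZ] := IH Z (fun i => v (widen_ord (leqnSn n) i)) sZ spZ.
  move=> f; have [y [c [Yy ->]]] := Yv f.
  exists (y + c ord_max *: w), (fun i => c (widen_ord (leqnSn n) i)); split.
    exact: ZP.
  by rewrite big_ord_recr /= -/w -addrA [X in y + X]addrC.
exists (x1 :: xs) => f Hf.
have [a Yf _] : Z f by apply: xsZ => x xxs; apply: Hf; rewrite inE xxs orbT.
have := x1Y _ Yf; rewrite dual_subE dual_scaleE x1w Hf ?inE ?eqxx// mulr1 sub0r.
by move=> /eqP; rewrite oppr_eq0 => /eqP a0; move: Yf; rewrite a0 scale0r subr0.
Qed.

(** Thus the weak* closed subspaces of finite codimension can be replaced by the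
    sets [ker_set xs], which are stable under finite intersections. *)
Lemma cof_wstar_ker Y : cof_wstar Y -> exists xs, ker_set xs `<=` Y.
Proof.
move=> [sY [n [v Yv]] cY].
by apply: (@separated_ker Y n v) => //; exact: wstar_closed_separated.
Qed.

(** Functionals that are small on [xs] are close in norm to [ker_set xs]; this
    is how weak* small vectors are moved into a given subspace. *)
Lemma ker_set_near xs : exists2 M : R, 0 <= M & forall f, exists2 y, ker_set xs y &
  `|f - y| <= M * \sum_(x <- xs) `|f x|.
Proof.
elim: xs => [|x xs [M M0 IH]].
  by exists 0 => // f; exists f => //; rewrite subrr normr0 mul0r.
have [[u xsu ux]|/forall2NP nu] := pselect (exists2 u, ker_set xs u & u x = 1).
  exists (M * (1 + `|x| * `|u|) + `|u|).
    by rewrite addr_ge0 ?mulr_ge0 ?addr_ge0 ?mulr_ge0.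
  move=> f; have [y xsy fy] := IH f.
  exists (- y x *: u + y).
    move=> z; rewrite inE dual_addE dual_scaleE => /orP[/eqP->|zxs].
      by rewrite ux mulr1 addNr.
    by rewrite (xsy z zxs) xsu// mulr0 addr0.
  have -> : f - (- y x *: u + y) = (f - y) + y x *: u.
    by rewrite scaleNr opprD opprK addrCA addrC.
  rewrite (le_trans (ler_normD _ _))// normrZ big_cons.
  have yx : `|y x| <= `|f x| + `|f - y| * `|x|.
    have -> : y x = f x - (f - y) x by rewrite dual_subE opprB addrCA subrr addr0.
    by rewrite (le_trans (ler_normB _ _))// lerD2l le_dual.
  set S := \sum_(j <- xs) _ in fy *.
  have S0 : 0 <= S by rewrite sumr_ge0.
  have h1 : `|f - y| * (1 + `|x| * `|u|) <= M * S * (1 + `|x| * `|u|).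
    by rewrite ler_wpM2r// addr_ge0// mulr_ge0.
  have h2 : `|y x| * `|u| <= (`|f x| + `|f - y| * `|x|) * `|u| by rewrite ler_wpM2r.
  have h3 : 0 <= M * `|f x| * (1 + `|x| * `|u|).
    by rewrite !mulr_ge0// addr_ge0// mulr_ge0.
  have h4 : 0 <= S * `|u| by rewrite mulr_ge0.
  nra.
exists M => // f; have [y xsy fy] := IH f; exists y.
  move=> z; rewrite inE => /orP[/eqP->|/xsy//].
  apply: contrapT => /eqP yx0; case: (nu ((y x)^-1 *: y)); apply.
    by move=> t /xsy yt; rewrite dual_scaleE yt mulr0.
  by rewrite dual_scaleE mulVf.
rewrite (le_trans fy)// ler_wpM2l// big_cons lerDr normr_ge0//.
Qed.

Lemma ker_set_codim xs : finite_codim (ker_set xs).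
Proof.
elim: xs => [|x xs [n [v IH]]].
  by exists 0%N, (fun=> 0) => f; exists f, (fun=> 0); rewrite big_ord0 addr0.
have [[u xsu ux]|/forall2NP nu] := pselect (exists2 u, ker_set xs u & u x = 1).
  exists n.+1, (fun i => if unlift ord0 i is Some j then v j else u) => f.
  have [y [c [xsy ->]]] := IH f.
  exists (- y x *: u + y), (fun i => if unlift ord0 i is Some j then c j else y x).
  split.
    move=> z; rewrite inE dual_addE dual_scaleE => /orP[/eqP->|zxs].
      by rewrite ux mulr1 addNr.
    by rewrite (xsy z zxs) xsu// mulr0 addr0.
  rewrite big_ord_recl unlift_none.
  under [X in _ + (_ + X)]eq_bigr => i _ do rewrite liftK.
  by rewrite scaleNr [- _ + y]addrC addrA subrK.
exists n, v => f; have [y [c [xsy ->]]] := IH f; exists y, c; split=> // z.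
rewrite inE => /orP[/eqP->|/xsy//].
apply: contrapT => /eqP yx0; case: (nu ((y x)^-1 *: y)); apply.
  by move=> t /xsy yt; rewrite dual_scaleE yt mulr0.
by rewrite dual_scaleE mulVf.
Qed.

Lemma wstar_closed_le x (a : R) :
  closed ([set f : dual X | a <= f x] : set (weak_star X)).
Proof.
have -> : [set f : dual X | a <= f x] =
  (fun f : weak_star X => f x : R^o) @^-1` [set r | a <= r] by [].
apply: closed_comp => [f _|]; first exact: eval_wstar_continuous.
exact: closed_ge.
Qed.

Lemma wstar_closed_ker xs : closed (ker_set xs : set (weak_star X)).
Proof.
have -> : ker_set xs = \bigcap_(x in [set x | x \in xs])
   ((fun f : weak_star X => f x : R^o) @^-1` [set 0]) by [].
apply: closed_bigI => x _; apply: closed_comp => [f _|].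
  exact: eval_wstar_continuous.
exact: closed_eq.
Qed.

Lemma ker_set_cof xs : cof_wstar (ker_set xs).
Proof.
by split; [exact: ker_set_subspace|exact: ker_set_codim|exact: wstar_closed_ker].
Qed.

End WeakStar.

(** * Weak-star compactness and Szlenk derivations *)

Section Alaoglu.
Context {R : realType} (X : normedModType R).

(** A pointwise limit of elements of the dual ball is again bounded and linear. *)
Lemma dual_of (p : X -> R) : (forall (k : R) x y, p (k *: x + y) = k * p x + p y) ->
  (forall x, `|p x| <= `|x|) -> exists f : dual X, p = f.
Proof.
move=> plin pbd.
suff pd : p \in @dual_pred R X by exists (Dual pd).
apply/asboolP; split; first exact: plin.
move=> x; apply/(@cvgrPdist_lt _ R^o) => e e0; near=> z.
have -> : p x - p z = p (- 1 *: z + x) by rewrite plin mulN1r addrC.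
rewrite (le_lt_trans (pbd _))// scaleN1r addrC.
by near: z; exact: cvgr_dist_lt.
Unshelve. all: by end_near. Qed.

(** Banach-Alaoglu, from Tychonoff's theorem. *)
Lemma dual_ball_compact : compact (@dual_ball R X : set (weak_star X)).
Proof.
move=> F PF FB.
pose T : topologicalType := {ptws X -> R^o}.
pose inj : dual X -> T := fun f => (f : X -> R).
pose A (x : X) : set R^o := [set r | `|r| <= `|x|].
have Acpt : compact [set f : {ptws X -> R^o} | forall x, A x (f x)].
  apply: (@tychonoff X (fun=> R^o)) => x.
  have -> : A x = `[- `|x|, `|x|]%classic.
    by apply/seteqP; split => r; rewrite /A /= in_itv /= ler_norml.
  exact: segment_compact.
have PG : ProperFilter (inj @ F) := fmap_proper_filter inj PF.
have [p [pA pG]] : [set f : T | forall x, A x (f x)] `&` cluster (inj @ F) !=set0.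
  apply: Acpt; rewrite nbhs_simpl /=.
  apply: (@filterS _ F _ (@dual_ball R X)) FB => f fB x.
  by rewrite /A /inj /= (le_trans (le_dual f x))// ler_piMl.
have evc (x : X) : continuous (fun h : T => h x : R^o).
  exact: (@proj_continuous X (fun=> R^o) x).
have plin (k : R) x y : p (k *: x + y) = k * p x + p y.
  pose L : set T := [set h : T | h (k *: x + y) - (k * h x + h y) = 0].
  have cL : closed L.
    have -> : L = (fun h : T => h (k *: x + y) - (k *: h x + h y) : R^o) @^-1` [set 0].
      by [].
    apply: closed_comp; last exact: closed_eq.
    have lin (S : topologicalType) (a b c : S -> R^o) : continuous a -> continuous b ->
        continuous c -> continuous (fun s => a s - (k *: b s + c s)).
      move=> ca cb cc s.
      by apply: cvgB; [exact: ca|apply: cvgD; [apply: cvgZl_tmp; exact: cb|exact: cc]].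
    by move=> h _; apply: (lin T _ _ _ (evc (k *: x + y)) (evc x) (evc y) h).
  have : closure L p.
    move: pG; rewrite clusterE; apply; apply: (@filterE _ F) => f /=.
    by rewrite /L /= /inj dualD dualZ subrr.
  rewrite -(closure_id L).1// => /eqP; rewrite subr_eq0 => /eqP.
  exact.
have [f pf] := dual_of plin pA.
exists f; split.
  by apply: dual_le => x x1; rewrite -pf (le_trans (pA x)).
move=> B C FB' [D [[U oU UD] Df] DC].
have Up : nbhs (p : T) U.
  by apply: open_nbhs_nbhs; split=> //; rewrite pf; move: Df; rewrite -UD.
have GB : (inj @ F) (inj @` B) by apply: (@filterS _ F _ B) FB' => g Bg; exists g.
have [_ [[g Bg <-] Ug]] := pG _ _ GB Up.
by exists g; split=> //; apply: DC; rewrite -UD.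
Qed.

End Alaoglu.

Section Szlenk.
Context {R : realType} (X : normedModType R).
Implicit Types (K A : set (dual X)) (eps : R).
Local Notation nat_ord n := (iter n osucc ozero).

Lemma szlenk_derivP eps K f : szlenk_deriv eps K f <->
  K f /\ forall U : set (dual X), open (U : set (weak_star X)) -> U f ->
    (eps%:E < diam (K `&` U))%E.
Proof.
split=> [[Kf nU]|[Kf fU]]; split=> //.
  move=> U oU Uf; rewrite ltNge; apply/negP => dU; apply: nU.
  by exists (K `&` U) => //; split=> //; exists U.
move=> [V [[U oU ->] dU] [_ Uf]].
by have := fU U oU Uf; rewrite ltNge dU.
Qed.

Lemma diam_subset A K : A `<=` K -> (diam A <= diam K)%E.
Proof.
move=> AK; apply: ge_ereal_sup => _ [p [A1 A2] <-].
by apply: ereal_sup_ubound; exists p => //; split; exact: AK.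
Qed.

Lemma lt_diam eps K : (eps%:E < diam K)%E ->
  exists f g, [/\ K f, K g & eps < `|f - g|].
Proof.
move=> /ereal_sup_gt[_ [[f g] [/= Kf Kg] <-]]; rewrite lte_fin => fg.
by exists f, g.
Qed.

Lemma szlenk_deriv_sub eps K : szlenk_deriv eps K `<=` K.
Proof. by move=> f /szlenk_derivP[]. Qed.

Lemma szlenk_deriv_mono eps A K :
  A `<=` K -> szlenk_deriv eps A `<=` szlenk_deriv eps K.
Proof.
move=> AK f /szlenk_derivP[Af fU]; apply/szlenk_derivP; split; first exact: AK.
move=> U oU Uf; apply: lt_le_trans (fU U oU Uf) _.
by apply: diam_subset; exact: setSI.
Qed.

Lemma szlenk_iter_sub eps K a : szlenk_iter eps K a `<=` K.
Proof.
elim: a => [//|b IH|J f IH] /=; last by move=> ? [].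
exact: subset_trans (@szlenk_deriv_sub _ _) IH.
Qed.

(** The derived sets depend monotonically on notations of ordinals, hence only
    on the ordinals denoted. *)
Lemma szlenk_iter_ole eps K a b :
  ole a b -> szlenk_iter eps K b `<=` szlenk_iter eps K a.
Proof.
elim=> [c|c d _ IH|I f c _ IH|c I f i _ IH] /=.
- exact: szlenk_iter_sub.
- exact: szlenk_deriv_mono.
- by move=> g gc; split=> [|i _]; [exact: szlenk_iter_sub gc|exact: IH].
- by move=> g [_ /(_ i)] gi; apply: IH; exact: gi.
Qed.

Lemma ole_nat n m : (n <= m)%N -> ole (nat_ord n) (nat_ord m).
Proof.
elim: n m => [|n IH] [|m] //= nm; try exact: ole_zero.
by apply: ole_succ; exact: IH.
Qed.

(** Finite ordinals are comparable with every notation; this suffices to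
    recognise the least index as soon as some finite derived set is empty. *)
Lemma ole_nat_total n b :
  ole (nat_ord n) b \/ exists2 k, (k < n)%N & forall m, (k <= m)%N -> ole b (nat_ord m).
Proof.
elim: b n => [|b IH|I f IH] [|n]; try by left; exact: ole_zero.
- by right; exists 0%N => // m _; exact: ole_zero.
- have [bn|[k kn bk]] := IH n; first by left; exact: ole_succ.
  by right; exists k.+1 => // -[//|m] km; exact/ole_succ/bk.
- have [[i fi]|nf] := pselect (exists i, ole (nat_ord n.+1) (f i)).
    by left; exact: ole_sup_r fi.
  right; exists n => // m nm; apply: ole_sup_l => i.
  have [fi|[k kn fk]] := IH i n.+1; first by case: nf; exists i.
  by apply: fk; exact: leq_trans nm.
Qed.

(** An empty derived set of finite order makes the least index exist and be
    finite, by [ole_nat_total]. *)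
Lemma szlenk_index_at_finite K eps n : szlenk_iter eps K (nat_ord n) = set0 ->
  exists2 a, szlenk_index_at K eps = Some a & ole a omega.
Proof.
move=> Kn.
have ex : exists n, `[< szlenk_iter eps K (nat_ord n) = set0 >].
  by exists n; exact/asboolP.
case: (ex_minnP ex) => {Kn} {}n /asboolP Kn nmin.
have ln : szlenk_least K eps (nat_ord n).
  split=> // b Kb; have [//|[k kn bk]] := ole_nat_total n b.
  suff /nmin : `[< szlenk_iter eps K (nat_ord k) = set0 >] by rewrite leqNgt kn.
  apply/asboolP/seteqP; split=> // f /(szlenk_iter_ole (bk k (leqnn k))).
  by rewrite Kb.
rewrite /szlenk_index_at; case: pselect => [h|]; last by case; exists (nat_ord n).
exists (projT1 (cid h)) => //; case: (cid h) => a [Ka amin] /=.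
by apply: (@ole_sup_r _ nat _ n); exact: amin.
Qed.

Lemma szlenk_index_le_omega :
  (forall eps, 0 < eps -> exists n, szlenk_iter eps (@dual_ball R X) (nat_ord n) = set0) ->
  xole (szlenk_index X) (Some omega).
Proof.
move=> H; rewrite /szlenk_index /xosup; case: pselect => [_|[]] /=.
  apply: ole_sup_l => e; have [n /szlenk_index_at_finite[a -> //]] := H e%:num [gt0 of e%:num].
by move=> e; have [n /szlenk_index_at_finite[a -> //]] := H e%:num [gt0 of e%:num].
Qed.

(** Inversion of [ole] at a supremum on the left, by induction on the derivation. *)
Lemma ole_supE a b : ole a b ->
  match a with osup J f => forall j : J, ole (f j) b | _ => True end.
Proof.
elim=> [c|c d _ _|I f c fc _|c I f i _] //=.
by case: c => // J g gi j; exact: ole_sup_r (gi j).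
Qed.

Lemma szlenk_deriv_closed eps K : closed (K : set (weak_star X)) ->
  closed (szlenk_deriv eps K : set (weak_star X)).
Proof.
move=> cK f clf; apply/szlenk_derivP; split.
  by apply: cK => U /clf [g [/szlenk_deriv_sub Kg Ug]]; exists g.
move=> U oU Uf; have [] := clf U; first exact: open_nbhs_nbhs.
by move=> g [/szlenk_derivP[_ gU] Ug]; exact: gU.
Qed.

Lemma dual_ball_closed : closed (@dual_ball R X : set (weak_star X)).
Proof.
have -> : @dual_ball R X = \bigcap_(x in [set x : X | `|x| <= 1])
   [set f : dual X | - 1 <= f x].
  apply/seteqP; split => f.
    move=> fB x /= x1; have : `|f x| <= 1.
      by rewrite (le_trans (le_dual f x))// mulr_ile1.
    by rewrite ler_norml => /andP[].
  move=> fx; apply: dual_le => x x1; rewrite ler_norml fx//=.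
  by rewrite -lerN2 -dualN fx//= normrN.
by apply: closed_bigI => x _; exact: wstar_closed_le.
Qed.

Lemma szlenk_iter_nat_closed eps n :
  closed (szlenk_iter eps (@dual_ball R X) (nat_ord n) : set (weak_star X)).
Proof.
elim: n => [|n IH] /=; first exact: dual_ball_closed.
exact: szlenk_deriv_closed.
Qed.

(** The derived sets of finite order are weak* compact and decreasing, so if
    none is empty their intersection, the derived set of order [omega], is not
    empty either. *)
Lemma szlenk_finite eps : 0 < eps -> xole (szlenk_index X) (Some omega) ->
  exists n, szlenk_iter eps (@dual_ball R X) (nat_ord n) = set0.
Proof.
move=> e0 Sz; apply: contrapT => /forallNP nn.
pose B n := szlenk_iter eps (@dual_ball R X) (nat_ord n).
pose F : set_system (weak_star X) := filter_from [set: nat] B.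
have Bdec n m : (n <= m)%N -> B m `<=` B n.
  by move=> nm; apply: szlenk_iter_ole; exact: ole_nat.
have PF : ProperFilter F.
  apply: filter_from_proper.
    apply: filter_from_filter; first by exists 0%N.
    move=> i j _ _; exists (maxn i j) => // f fB.
    by split; apply: Bdec fB; rewrite ?leq_maxl ?leq_maxr.
  by move=> i _; have /eqP/set0P := nn i.
have [|f [fB fF]] := @dual_ball_compact R X F PF; first by exists 0%N.
have fomega : szlenk_iter eps (@dual_ball R X) omega f.
  split=> // n _; apply: szlenk_iter_nat_closed.
  by move: fF; rewrite clusterE; apply; exists n.
move: Sz; rewrite /szlenk_index /xosup; case: pselect => //= nN.
move=> /ole_supE /(_ (PosNum e0)); have := nN (PosNum e0).
rewrite /szlenk_index_at /=; case: pselect => // h _.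
case: (cid h) => a [Ba _] /= ao.
by have := szlenk_iter_ole ao fomega; rewrite Ba.
Qed.

End Szlenk.

(** * The Szlenk index and games on the predual *)

Section Game.
Context {R : realType} (X : normedModType R).
Implicit Types (f g y : dual X) (x z : X) (s xs : seq X) (F : seq (dual X)).
Local Notation nat_ord n := (iter n osucc ozero).

(** The [k] remaining rounds after the vectors [s]; [P] judges complete plays. *)
Fixpoint small_game (kap : R) (P : seq X -> Prop) (k : nat) s :=
  if k is m.+1 then
    exists F, forall z, `|z| <= 1 -> (forall g, g \in F -> `|g z| <= kap) ->
      small_game kap P m (rcons s z)
  else P s.

(** If every [c] failed for some [F_ c], all would fail for the union of these. *)
Lemma finite_choice (C : finType) (Q : seq (dual X) -> C -> Prop) :
  (forall F F' c, {subset F' <= F} -> Q F c -> Q F' c) ->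
  (forall F, exists c, Q F c) -> exists c, forall F, Q F c.
Proof.
move=> Qanti QF; apply: contrapT => /forallNP/= nQ.
have /choice[F_ QF_] : forall c, exists F, ~ Q F c by move=> c; exact/existsNP.
have [c Qc] := QF (flatten [seq F_ c | c <- enum C]).
apply: (QF_ c); apply: Qanti Qc => g gF; apply/flattenP.
by exists (F_ c) => //; apply: map_f; rewrite mem_enum.
Qed.

(** In a lost position some [f] of the ball keeps the total above the
    threshold: a remaining round contributes at most [eta / 2], or else at most
    1 at the price of one derivation. Going back one round, the functionals
    obtained for larger and larger [F] have a weak* cluster point [f]. If they
    exceed [eta / 2] on vectors where [f] itself is at most [eta / 4], then they
    stay at a distance from [f], and [f] lies in the next derived set. *)
Lemma small_game_lost (eta : R) (n k : nat) s : 0 < eta ->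
  ~ small_game (eta / 4) (fun s => forall f, `|f| <= 1 ->
      f (\sum_(z <- s) z) <= eta * n%:R) k s ->
  exists j f, [/\ (j <= k)%N, szlenk_iter (eta / 8) (@dual_ball R X) (nat_ord j) f
    & eta * n%:R <= f (\sum_(z <- s) z) + j%:R + k%:R * (eta / 2)].
Proof.
move=> eta0; elim: k s => [|k IH] s /=.
  move=> /existsNP[f /not_implyP[f1 /negP]]; rewrite -ltNge => fs.
  by exists 0%N, f; split=> //; rewrite mul0r !addr0 ltW.
move=> /forallNP lost.
pose B j := szlenk_iter (eta / 8) (@dual_ball R X) (nat_ord j).
pose A (c : 'I_k.+1 * bool) F : set (dual X) := [set f | B c.1 f /\ exists z,
  [/\ `|z| <= 1, forall g, g \in F -> `|g z| <= eta / 4,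
      eta * n%:R <= f (\sum_(z <- s) z) + f z + c.1%:R + k%:R * (eta / 2)
    & if c.2 then eta / 2 < f z else f z <= eta / 2]].
have Asub c F F' : {subset F' <= F} -> A c F `<=` A c F'.
  move=> FF' f [Bf [z [z1 zF fz bz]]]; split=> //; exists z; split=> // g /FF'.
  exact: zF.
have [[j b] /= AjF] : exists c, forall F, A c F !=set0.
  apply: finite_choice => [F F' c FF' [f Af]|F]; first by exists f; exact: Asub Af.
  have /existsNP[z /not_implyP[z1 /not_implyP[zF /IH[j [f [jk Bf fz]]]]]] := lost F.
  have jk' : (j < k.+1)%N by [].
  exists (Ordinal jk', eta / 2 < f z), f; split=> //; exists z; split=> //=.
    by move: fz; rewrite -cats1 big_cat big_seq1 /= dualD -natr1; lra.
  by case: ltP.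
pose Fl : set_system (weak_star X) := filter_from [set: seq (dual X)] (A (j, b)).
have PF : ProperFilter Fl.
  apply: filter_from_proper.
    apply: filter_from_filter; first by exists [::].
    move=> F F' _ _; exists (F ++ F') => // f Af.
    by split; apply: Asub Af => g gF; rewrite mem_cat gF ?orbT.
  by move=> F _; exact: AjF.
have Bdual : B j `<=` @dual_ball R X by exact: szlenk_iter_sub.
have [|f [fB fF]] := @dual_ball_compact R X Fl PF.
  by exists [::] => // f [Bf _]; exact: Bdual.
have fcl (C : set (dual X)) F :
    closed (C : set (weak_star X)) -> A (j, b) F `<=` C -> C f.
  move=> cC AC; apply: cC; move: fF; rewrite clusterE; apply.
  by exists F.
have Bf : B j f by apply: (fcl _ [::]) => [|g []//]; exact: szlenk_iter_nat_closed.
(* [r] bounds the contribution of the round that is undone. *)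
have fs (r : R) : (forall g z, dual_ball g -> `|z| <= 1 ->
     (if b then eta / 2 < g z else g z <= eta / 2) -> g z <= r) ->
   eta * n%:R - r - j%:R - k%:R * (eta / 2) <= f (\sum_(z <- s) z).
  move=> gr; apply: (fcl [set f | _ <= f _] [::]); first exact: wstar_closed_le.
  move=> g [Bg [z [z1 _ gz bz]]] /=; have := gr g z (Bdual _ Bg) z1 bz.
  by move: gz => /=; lra.
have [bT|bF] : b = true \/ b = false by case: (b); [left|right].
- exists j.+1, f; split=> //.
    apply/szlenk_derivP; split=> // U oU Uf.
    have [||g [[Bg [z [z1 zF _ /= gz]]] Ug]] := fF (A (j, b) [:: f]) U.
    - by exists [:: f].
    - exact: open_nbhs_nbhs.
    rewrite bT in gz.
    apply: (@lt_le_trans _ _ (`|g - f|)%:E); last first.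
      by apply: ereal_sup_ubound; exists (g, f).
    rewrite lte_fin; have := zF f; rewrite inE eqxx => /(_ isT).
    rewrite ler_norml => /andP[_ fz].
    have : (g - f) z <= `|g - f|.
      rewrite (le_trans (ler_norm _))// (le_trans (le_dual _ _))//.
      by rewrite ler_piMr.
    rewrite dual_subE; lra.
  have fs1 := fs 1.
  have {}fs1 : eta * n%:R - 1 - j%:R - k%:R * (eta / 2) <= f (\sum_(z <- s) z).
    apply: fs1 => g z gB z1 _; rewrite (le_trans (ler_norm _))//.
    by rewrite (le_trans (le_dual _ _))// mulr_ile1.
  by rewrite -(natr1 j) -(natr1 k); lra.
- exists j, f; split=> //; first by rewrite ltnW.
  rewrite bF in fs; have fs1 := fs (eta / 2).
  have {}fs1 : eta * n%:R - eta / 2 - j%:R - k%:R * (eta / 2) <= f (\sum_(z <- s) z).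
    exact: fs1.
  by rewrite -(natr1 k); lra.
Qed.

(** A lost game of [n] rounds gives a point in a derived set of order at least
    [n * eta / 2], and these sets are empty for large [n]. *)
Lemma small_game_won (eta : R) : 0 < eta -> xole (szlenk_index X) (Some omega) ->
  exists2 n : nat, (0 < n)%N & small_game (eta / 4) (fun s => forall f, `|f| <= 1 ->
      f (\sum_(z <- s) z) <= eta * n%:R) n [::].
Proof.
move=> eta0 Sz; have [||m Bm] := @szlenk_finite R X (eta / 8) => //; first by rewrite divr_gt0.
pose n := (Num.truncn (m%:R / (eta / 2) : R)).+1.
have nm : m%:R < n%:R * (eta / 2).
  by rewrite -ltr_pdivrMr ?divr_gt0// /n truncnS_gt.
exists n => //; apply: contrapT => /small_game_lost-/(_ eta0)[j [f [_ Bf]]].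
rewrite big_nil dual0 add0r => nj.
have jm : (m <= j)%N.
  rewrite -(ler_nat R); move: nm nj; set a := n%:R; set b := m%:R; set c := j%:R.
  lra.
by have := szlenk_iter_ole (ole_nat jm) Bf; rewrite Bm.
Qed.

End Game.

(** * Norms with a uniform weak-star gain *)

Section SupNorm.
Context {R : realType} (X : normedModType R).
Implicit Types (f g y : dual X) (x z w : X) (s xs : seq X) (W : set X).

Definition sup_norm W f : R := sup [set `|f w| | w in W].

Definition between_balls W :=
  (forall w, `|w| <= 1 -> W w) /\ (forall w, W w -> `|w| <= 2).

Section Basic.
Variable W : set X.
Hypothesis WB : between_balls W.

Lemma sup_norm_has_sup f : has_sup [set `|f w| | w in W].
Proof.
split; first by exists `|f 0|, 0 => //; apply WB.1; rewrite normr0.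
exists (`|f| * 2) => _ [w Ww <-]; rewrite (le_trans (le_dual _ _))//.
by rewrite ler_wpM2l// WB.2.
Qed.

Lemma le_sup_norm f w : W w -> `|f w| <= sup_norm W f.
Proof. by move=> Ww; apply: sup_upper_bound; [exact: sup_norm_has_sup|exists w]. Qed.

Lemma sup_norm_le f M : (forall w, W w -> `|f w| <= M) -> sup_norm W f <= M.
Proof.
move=> fM; apply: ge_sup; first by have [] := sup_norm_has_sup f.
by move=> _ [w Ww <-]; exact: fM.
Qed.

Lemma sup_normD f g : sup_norm W (f + g) <= sup_norm W f + sup_norm W g.
Proof.
apply: sup_norm_le => w Ww; rewrite dual_addE (le_trans (ler_normD _ _))//.
by rewrite lerD// le_sup_norm.
Qed.

Lemma sup_norm_scale_le (a : R) f : sup_norm W (a *: f) <= `|a| * sup_norm W f.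
Proof.
apply: sup_norm_le => w Ww; rewrite dual_scaleE normrM ler_wpM2l//.
exact: le_sup_norm.
Qed.

Lemma le_norm_sup_norm f : `|f| <= sup_norm W f.
Proof. by apply: dual_le => x x1; apply: le_sup_norm; exact: WB.1. Qed.

Lemma sup_norm_le_norm f : sup_norm W f <= 2 * `|f|.
Proof.
apply: sup_norm_le => w Ww; rewrite (le_trans (le_dual _ _))// mulrC.
by rewrite ler_wpM2r// WB.2.
Qed.

Lemma sup_norm_gt f (e : R) : 0 < e -> exists2 w, W w & sup_norm W f - e < `|f w|.
Proof.
move=> e0; have [_ [w Ww <-] fw] := sup_adherent e0 (sup_norm_has_sup f).
by exists w.
Qed.

(** A vector [w] that nearly norms [f] serves for [f + y] as well when [y w = 0]. *)
Lemma sup_norm_lsc f (e : R) : 0 < e ->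
  exists xs, forall y, ker_set xs y -> sup_norm W f - e <= sup_norm W (f + y).
Proof.
move=> e0; have [w Ww fw] := sup_norm_gt f e0.
exists [:: w] => y yw; rewrite (le_trans (ltW fw))//.
by have := le_sup_norm (f + y) Ww; rewrite dual_addE yw ?inE ?eqxx// addr0.
Qed.

End Basic.

Lemma unit_ball_cells (F : seq (dual X)) (A : set X) (kap : R) : 0 < kap ->
  A `<=` [set x | `|x| <= 1] ->
  exists ws : seq X, (forall w, w \in ws -> A w) /\
    forall x, A x -> exists2 w, w \in ws & forall g, g \in F -> `|g x - g w| <= kap.
Proof.
move=> kap0; elim: F A => [|g F IH] A A1.
  have [->|/set0P[a Aa]] := eqVneq A set0.
    by exists [::]; split=> // x [].
  by exists [:: a]; split=> [w|x Ax]; [rewrite inE => /eqP->|exists a; rewrite ?inE].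
pose c x := Num.truncn ((g x + `|g|) / kap).
have c0 x : A x -> 0 <= (g x + `|g|) / kap.
  move=> Ax; rewrite divr_ge0 ?(ltW kap0)//.
  have : `|g x| <= `|g| by rewrite (le_trans (le_dual _ _))// ler_piMr// A1.
  by rewrite ler_norml => /andP[]; rewrite -subr_ge0 opprK.
pose m := (Num.truncn ((`|g| + `|g|) / kap)).+1.
have cm x : A x -> (c x < m)%N.
  move=> Ax; rewrite /m ltnS /c; apply: le_truncn; rewrite ler_pM2r ?invr_gt0//.
  rewrite lerD2r (le_trans (ler_norm _))// (le_trans (le_dual _ _))//.
  by rewrite ler_piMr// A1.
have /choice[ws_ wsP] : forall i : nat, exists ws : seq X,
    (forall w, w \in ws -> A w /\ c w = i) /\ forall x, A x -> c x = i ->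
    exists2 w, w \in ws & forall g, g \in F -> `|g x - g w| <= kap.
  move=> i; have [|ws [wsA wsx]] := IH [set x | A x /\ c x = i].
    by move=> x [/A1].
  by exists ws; split=> // x Ax cx; exact: wsx.
exists (flatten [seq ws_ i | i <- iota 0 m]); split.
  by move=> w /flattenP[_ /mapP[i _ ->]] /(wsP i).1[].
move=> x Ax; have [w ww wF] := (wsP (c x)).2 x Ax erefl.
exists w; first by apply/flattenP; exists (ws_ (c x)) => //; rewrite map_f// mem_iota cm.
have [Aw cw] := (wsP _).1 w ww.
move=> h; rewrite inE => /orP[/eqP->|/wF//].
have := truncn_itv (c0 x Ax); have := truncn_itv (c0 w Aw).
rewrite -/(c x) -/(c w) cw; set n := c x.
rewrite !ler_pdivlMr// !ltr_pdivrMr// -natr1 => /andP[a1 a2] /andP[a3 a4].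
by rewrite ler_norml; apply/andP; split; lra.
Qed.

Lemma dual_almost_attained f (a : R) : 0 <= a -> a < `|f| ->
  exists2 x, `|x| <= 1 & a < `|f x|.
Proof.
move=> a0 af; apply: contrapT => /forall2NP nf.
suff : `|f| <= a by rewrite leNgt af.
apply: dual_le => x x1; have [//|/negP] := nf x.
by rewrite -leNgt.
Qed.

(** Cut the unit ball into finitely many cells on which the functionals of [F]
    are nearly constant and let [xs] represent the cells. If [y] vanishes on
    [xs] and is large at [x], then half the difference of [x] and the
    representative of its cell is, up to its sign, the vector sought. *)
Lemma late_vector (F : seq (dual X)) (kap : R) : 0 < kap ->
  exists xs, forall y (e : R), ker_set xs y -> 0 < e -> e <= `|y| ->
    exists v, [/\ `|v| <= 1, forall g, g \in F -> `|g v| <= kap & e / 4 <= y v].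
Proof.
move=> kap0; have [ws [ws1 wsP]] :=
  @unit_ball_cells F [set x | `|x| <= 1] kap kap0 (fun _ => id).
exists ws => y e yws e0 ey; have [||x x1 yx] := @dual_almost_attained y (e / 2).
- by rewrite divr_ge0// ltW.
- by rewrite (lt_le_trans _ ey)// ltr_pdivrMr// ltr_pMr// ltr1n.
have [w ww xw] := wsP x x1.
pose v := 2^-1 *: (x - w).
have v1 : `|v| <= 1.
  rewrite /v normrZ ger0_norm ?invr_ge0//.
  by have := ler_normB x w; have := ws1 w ww; rewrite /=; lra.
have gv g : g \in F -> `|g v| <= kap.
  move=> /xw; rewrite /v dualZ dualB normrM ger0_norm ?invr_ge0//.
  by have := normr_ge0 (g x - g w); lra.
have yv : e / 4 <= `|y v|.
  rewrite /v dualZ dualB (yws w ww) subr0 normrM ger0_norm ?invr_ge0//; lra.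
have [y0|y0] := leP 0 (y v); first by exists v; split=> //; move: yv; rewrite ger0_norm.
exists (- v); split=> [||]; first by rewrite normrN.
  by move=> g /gv; rewrite dualN normrN.
by move: yv; rewrite dualN ltr0_norm.
Qed.

End SupNorm.

Section LevelNorm.
Context {R : realType} (X : normedModType R).
Hypothesis Sz : xole (szlenk_index X) (Some omega).
Implicit Types (f g y : dual X) (x z w : X) (s xs : seq X) (W : set X).

(** The vectors [lam k *: (z + th *: (x_1 + ... + x_k))], for the beginnings
    [x_1, ..., x_k] of winning plays of [n] rounds and with [th = 1 / n]. The
    weights decrease by [th * e / 64] per round. As values of [f] are at most 4,
    a round costs [th * e / 16] at most, less than the gain of about [th * e / 8]
    from prolonging a play; over a complete play the weight has lost [e / 64],
    and its vectors contribute only [2 * eta]. *)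
Lemma level_norm (e : R) : 0 < e -> e <= 1 -> exists W (gain : R),
  [/\ between_balls W, 0 < gain & forall f, 1 / 2 <= `|f| -> `|f| <= 2 ->
    exists xs, forall y, ker_set xs y -> e <= `|y| ->
      sup_norm W f + gain <= sup_norm W (f + y)].
Proof.
(* Complete plays then contribute at most [2 * eta = e / 512]. *)
move=> e0 e1; pose eta := e / 16 / 64.
have eta0 : 0 < eta by rewrite /eta; lra.
have [n n0 gn] := small_game_won eta0 Sz.
pose P s := forall f, `|f| <= 1 -> f (\sum_(z <- s) z) <= eta * n%:R.
rewrite -/P in gn.
pose th : R := n%:R^-1.
have n0' : 0 < n%:R :> R by rewrite ltr0n.
have th0 : 0 < th by rewrite invr_gt0.
have th1 : th <= 1 by rewrite invf_le1// ler1n.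
have thn : th * n%:R = 1 by rewrite mulVf// gt_eqF.
pose lam (k : nat) : R := 1 - k%:R * (th * e / 64).
have lamn k : (k <= n)%N -> 1 / 2 <= lam k /\ lam k <= 1.
  move=> kn; have : th * k%:R <= th * n%:R by rewrite ler_pM2l// ler_nat.
  rewrite thn mulrC.
  have : 0 <= k%:R * th by rewrite mulr_ge0// ltW.
  rewrite /lam => a b; split; nra.
pose W : set X := [set w | exists z s, [/\ (size s <= n)%N, `|z| <= 1,
   (forall x, x \in s -> `|x| <= 1), small_game (eta / 4) P (n - size s) s &
   w = lam (size s) *: (z + th *: \sum_(x <- s) x)]].
have sum_le s : (forall x, x \in s -> `|x| <= 1) -> (size s <= n)%N ->
    `|th *: \sum_(x <- s) x| <= 1.
  move=> s1 sn; rewrite normrZ gtr0_norm// -thn ler_pM2l//.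
  apply: (@le_trans _ _ (size s)%:R); last by rewrite ler_nat.
  rewrite (le_trans (ler_norm_sum _ _ _))// -sum1_size natr_sum.
  by rewrite [leLHS]big_seq [leRHS]big_seq ler_sum.
have WB : between_balls W.
  split=> [w w1|w [z [s [sn z1 s1 _ ->]]]].
    exists w, [::]; split=> //; first by rewrite subn0.
    by rewrite /lam mul0r subr0 big_nil scaler0 addr0 scale1r.
  have [l1 l2] := lamn _ sn.
  rewrite normrZ ger0_norm; last by lra.
  have := ler_normD z (th *: \sum_(x <- s) x); have := sum_le s s1 sn => a b.
  set u := `|z + _| in b *; have u0 : 0 <= u by exact: normr_ge0.
  nra.
pose tol := th * e / 16 / 16.
have tol0 : 0 < tol by rewrite /tol; nra.
exists W, (th * e / 64); split=> //; first by nra.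
move=> f f1 f2; have [w [z [s [sn z1 s1 gs ->]]]] := sup_norm_gt WB f tol0.
set u := z + _; rewrite dualZ normrM.
have [l1 l2] := lamn _ sn.
rewrite ger0_norm; last by lra.
move=> fu.
have u2 : `|u| <= 2.
  by rewrite (le_trans (ler_normD _ _))//; have := sum_le s s1 sn; lra.
have fu4 : `|f u| <= 4.
  have := le_dual f u; have := normr_ge0 f; have := normr_ge0 u; nra.
have the1 : th * e <= e by rewrite ler_piMl// ltW.
have the0 : 0 < th * e by rewrite mulr_gt0.
have sltn : (size s < n)%N.
  rewrite ltn_neqAle sn andbT; apply/negP => /eqP ssn.
  move: gs; rewrite ssn subnn /= => gs.
  have half (g : dual X) : `|g| <= 2 -> g (\sum_(x <- s) x) <= 2 * (eta * n%:R).
    move=> g2; have := gs (2^-1 *: g); rewrite dual_scaleE normrZ ger0_norm ?invr_ge0//.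
    move=> H; have g1 : 2^-1 * `|g| <= 1 by lra.
    by have := H g1; lra.
  have fS : `|f (th *: \sum_(x <- s) x)| <= e / 16 / 32.
    rewrite dualZ normrM gtr0_norm//.
    have fS : `|f (\sum_(x <- s) x)| <= 2 * (eta * n%:R).
      rewrite ler_norml half// andbT -lerNl -dual_oppE half// normrN//.
    have := ler_wpM2l (ltW th0) fS.
    have -> : th * (2 * (eta * n%:R)) = e / 16 / 32 * (th * n%:R) by rewrite /eta; field.
    by rewrite thn mulr1.
  have fz : `|f z| <= `|f| by rewrite (le_trans (le_dual _ _))// ler_piMr.
  have : `|f u| <= `|f| + e / 16 / 32.
    by rewrite /u dualD (le_trans (ler_normD _ _))// lerD.
  have := le_norm_sup_norm WB f.
  have lamE : lam (size s) = 1 - e / 64.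
    by rewrite /lam ssn !mulrA [_ * th]mulrC thn mul1r.
  move: fu; rewrite lamE /tol => a b c.
  have : (1 - e / 64) * `|f u| <= (1 - e / 64) * (`|f| + e / 16 / 32).
    by rewrite ler_wpM2l//; lra.
  nra.
have uE : u = z + th *: \sum_(x <- s) x by [].
clearbody u.
have [m nm] : exists m, (n - size s = m.+1)%N.
  by exists (n - size s).-1; rewrite prednK// subn_gt0.
move: gs; rewrite nm /= => -[F gF].
have eta4 : 0 < eta / 4 by lra.
have [xs xsP] := late_vector (f :: F) eta4.
exists (u :: xs) => y yxs ey.
have [|v [v1 vF yv]] := xsP y e _ e0 ey.
  by move=> x xxs; apply: yxs; rewrite inE xxs orbT.
have yu : y u = 0 by apply: yxs; rewrite inE eqxx.
have [v' [v'1 v'F yv' fv']] : exists v', [/\ `|v'| <= 1,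
    forall g, g \in f :: F -> `|g v'| <= eta / 4, e / 4 <= `|y v'|
    & `|f u| + th * (e / 4) - th * (eta / 4) <= `|(f + y) (u + th *: v')|].
  have key (a : R) (b : X) : `|a| = 1 -> b = a *: v -> [/\ `|b| <= 1,
    forall g, g \in f :: F -> `|g b| <= eta / 4 & e / 4 <= `|y b|].
    move=> a1 ->; split; first by rewrite normrZ a1 mul1r.
      by move=> g gF'; rewrite dualZ normrM a1 mul1r vF.
    by rewrite dualZ normrM a1 mul1r (le_trans yv)// ler_norm.
  have E b : (f + y) (u + th *: b) = f u + th * f b + th * y b.
    by rewrite dual_addE !dualD !dualZ yu add0r.
  have fv := vF f; rewrite inE eqxx in fv; have {}fv := fv isT.
  move: fv; rewrite ler_norml => /andP[fva fvb].
  (* The sign of [v] is chosen so that [f u] and [y v] have the same sign. *)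
  have [fu0|fu0] := leP 0 (f u).
    have [k1 k2 k3] := key 1 v (normr1 _) (esym (scale1r v)).
    exists v; split=> //; rewrite E (le_trans _ (ler_norm _))// ger0_norm//.
    have h1 : th * - (eta / 4) <= th * f v by rewrite ler_pM2l.
    have h2 : th * (e / 4) <= th * y v by rewrite ler_pM2l.
    lra.
  have [k1 k2 k3] := key (-1) (- v) (normrN1 _) (esym (scaleN1r v)).
  exists (- v); split=> //; rewrite E (ltr0_norm fu0) !dualN.
  rewrite -[`|_ + _ + _|]normrN (le_trans _ (ler_norm _))//.
  have h1 : th * f v <= th * (eta / 4) by rewrite ler_pM2l.
  have h2 : th * (e / 4) <= th * y v by rewrite ler_pM2l.
  have h3 : th * - (eta / 4) <= th * f v by rewrite ler_pM2l.
  lra.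
have [l1' l2'] := lamn _ sltn.
have Wnew : W (lam (size s).+1 *: (u + th *: v')).
  exists z, (rcons s v'); split=> //.
  - by rewrite size_rcons.
  - by move=> x; rewrite mem_rcons inE => /orP[/eqP->//|/s1].
  - rewrite size_rcons subnS nm /=; apply: gF => // g gF'.
    by apply: v'F; rewrite inE gF' orbT.
  - rewrite size_rcons -cats1 big_cat big_seq1 uE; congr (_ *: _).
    by rewrite /= [th *: (_ + _)]scalerDr addrA.
have := le_sup_norm WB (f + y) Wnew; rewrite dualZ normrM.
rewrite ger0_norm; last by lra.
move: fv'; set q := `|(f + y) _| => qlo qhi.
have lamS : lam (size s).+1 = lam (size s) - th * e / 64.
  by rewrite /lam -natr1; ring.
have qlo' : `|f u| + th * e / 4 - th * (eta / 4) <= q.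
  by apply: le_trans qlo; lra.
have A1 : lam (size s).+1 * (`|f u| + th * e / 4 - th * (eta / 4)) <= lam (size s).+1 * q.
  by rewrite ler_wpM2l//; lra.
have A2 : lam (size s).+1 * `|f u| = lam (size s) * `|f u| - th * e / 64 * `|f u|.
  by rewrite lamS; ring.
have A3 : th * e / 64 * `|f u| <= th * e / 64 * 4 by rewrite ler_pM2l// divr_gt0.
have A5 : th * (eta / 4) = th * e / 16 / 64 / 4 by rewrite /eta; field.
have A4 : 1 / 2 * (th * e / 4 - th * (eta / 4)) <=
    lam (size s).+1 * (th * e / 4 - th * (eta / 4)).
  by rewrite ler_wpM2r//; rewrite A5; lra.
rewrite /tol in fu; rewrite A5 in A1 A4.
lra.
Qed.

End LevelNorm.

Section AUC.
Context {R : realType} (X : normedModType R).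
Hypothesis Sz : xole (szlenk_index X) (Some omega).
Implicit Types (f g y : dual X).

Local Notation wt j := ((2^-1 : R) ^+ j.+1).

Section Sum.
Variable W : nat -> set X.
Hypothesis WB : forall j, between_balls (W j).

(** The set [W j] is meant for [e = 1 / (j + 1)]; the weights sum to less than
    one. A supremum of partial sums takes the place of the sum of the series. *)
Definition partial_norm J f : R := \sum_(j < J) wt j * sup_norm (W j) f.
Definition total_norm f : R := sup (range (partial_norm^~ f)).

Lemma wt_gt0 j : 0 < wt j. Proof. by rewrite exprn_gt0// invr_gt0. Qed.

Lemma sum_wt J : \sum_(j < J) wt j <= 1.
Proof.
suff -> : \sum_(j < J) wt j = 1 - 2^-1 ^+ J.
  by rewrite gerBl exprn_ge0// invr_ge0.
elim: J => [|J IH]; first by rewrite big_ord0 expr0 subrr.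
rewrite big_ord_recr /= IH exprS; lra.
Qed.

Lemma partial_norm_le J f : partial_norm J f <= 2 * `|f|.
Proof.
apply: (@le_trans _ _ (\sum_(j < J) wt j * (2 * `|f|))).
  apply: ler_sum => j _; rewrite ler_pM2l ?wt_gt0//; exact: sup_norm_le_norm.
rewrite -mulr_suml -[leRHS]mul1r ler_wpM2r ?mulr_ge0//; exact: sum_wt.
Qed.

Lemma total_norm_has_sup f : has_sup (range (partial_norm^~ f)).
Proof.
split; first by exists (partial_norm 0 f), 0%N.
by exists (2 * `|f|) => _ [J _ <-]; exact: partial_norm_le.
Qed.

Lemma partial_le_total J f : partial_norm J f <= total_norm f.
Proof. by apply: sup_upper_bound; [exact: total_norm_has_sup|exists J]. Qed.

Lemma total_norm_ub f M : (forall J, partial_norm J f <= M) -> total_norm f <= M.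
Proof.
move=> fM; apply: ge_sup; first by have [] := total_norm_has_sup f.
by move=> _ [J _ <-].
Qed.

Lemma total_norm_scale_le (a : R) f : total_norm (a *: f) <= `|a| * total_norm f.
Proof.
apply: total_norm_ub => J; apply: le_trans (ler_wpM2l (normr_ge0 a) (partial_le_total J f)).
rewrite /partial_norm mulr_sumr; apply: ler_sum => j _.
by rewrite mulrCA ler_pM2l ?wt_gt0//; exact: sup_norm_scale_le.
Qed.

Lemma total_normZ (a : R) f : total_norm (a *: f) = `|a| * total_norm f.
Proof.
apply/eqP; rewrite eq_le total_norm_scale_le /=.
have [->|a0] := eqVneq a 0.
  rewrite normr0 mul0r; apply: le_trans (partial_le_total 0 _).
  by rewrite /partial_norm big_ord0.
rewrite -ler_pdivlMl ?normr_gt0// -normfV.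
by apply: le_trans (total_norm_scale_le _ _); rewrite scalerA mulVf// scale1r.
Qed.

Lemma total_norm_lower f : 2^-1 * `|f| <= total_norm f.
Proof.
apply: le_trans (partial_le_total 1 f).
rewrite /partial_norm big_ord_recl big_ord0 addr0 expr1 ler_pM2l ?invr_gt0//.
exact: le_norm_sup_norm.
Qed.

Lemma total_norm_equivalent : equivalent_norm total_norm.
Proof.
split; [move=> f g|exact: total_normZ|exists 2^-1, 2; split=> // f; split].
- apply: total_norm_ub => J; apply: le_trans (lerD (partial_le_total J f) (partial_le_total J g)).
  rewrite /partial_norm -big_split /=; apply: ler_sum => j _.
  by rewrite -mulrDr ler_pM2l ?wt_gt0//; exact: sup_normD.
- exact: total_norm_lower.
- by apply: total_norm_ub => J; exact: partial_norm_le.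
Qed.

Lemma partial_lsc J f (e : R) : 0 < e -> exists xs, forall y, ker_set xs y ->
  forall j, (j < J)%N -> sup_norm (W j) f - e <= sup_norm (W j) (f + y).
Proof.
move=> e0; elim: J => [|J [xs IH]]; first by exists [::].
have [xs' xs'P] := sup_norm_lsc (WB J) f e0.
exists (xs ++ xs') => y yxs j; rewrite ltnS leq_eqVlt => /orP[/eqP->|jJ].
  by apply: xs'P => x xx; apply: yxs; rewrite mem_cat xx orbT.
by apply: IH => // x xx; apply: yxs; rewrite mem_cat xx.
Qed.

(** The component [k] gains, and finitely many of the others nearly exhaust the
    norm at [f] and lose arbitrarily little by lower semicontinuity. *)
Lemma total_norm_gain k (gain : R) f : 0 < gain ->
  (exists xs, forall y, ker_set xs y -> k.+1%:R^-1 <= `|y| ->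
     sup_norm (W k) f + gain <= sup_norm (W k) (f + y)) ->
  exists xs, forall y, ker_set xs y -> k.+1%:R^-1 <= `|y| ->
    total_norm f + wt k * gain / 2 <= total_norm (f + y).
Proof.
move=> g0 [xs xsP]; set G := wt k * gain.
have G0 : 0 < G by rewrite mulr_gt0// wt_gt0.
have G4 : 0 < G / 4 by lra.
have [_ [J0 _ <-] fJ0] := sup_adherent G4 (total_norm_has_sup f).
have [J [kJ fJ]] : exists J, (k < J)%N /\ total_norm f - G / 4 <= partial_norm J f.
  exists (maxn J0 k.+1); split; first by rewrite leq_maxr.
  rewrite (le_trans (ltW fJ0))// /partial_norm.
  rewrite -(subnKC (leq_maxl J0 k.+1)) big_split_ord /= lerDl sumr_ge0// => j _.
  apply: mulr_ge0; first exact/ltW/wt_gt0.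
  by apply: le_trans (le_norm_sup_norm (WB _) _); exact: normr_ge0.
have [xs' xs'P] := partial_lsc J f G4.
exists (xs ++ xs') => y yxs yk.
have y1 : ker_set xs y by move=> x xx; apply: yxs; rewrite mem_cat xx.
have y2 : ker_set xs' y by move=> x xx; apply: yxs; rewrite mem_cat xx orbT.
apply: le_trans (partial_le_total J (f + y)).
have : partial_norm J f - G / 4 + G <= partial_norm J (f + y).
  rewrite /partial_norm (bigD1 (Ordinal kJ)) //= [leRHS](bigD1 (Ordinal kJ)) //=.
  have h1 : wt k * sup_norm (W k) f + G <= wt k * sup_norm (W k) (f + y).
    by rewrite -mulrDr ler_pM2l ?wt_gt0// xsP.
  have h2 : \sum_(j < J | j != Ordinal kJ) wt j * sup_norm (W j) f - G / 4 <=
      \sum_(j < J | j != Ordinal kJ) wt j * sup_norm (W j) (f + y).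
    apply: (@le_trans _ _ (\sum_(j < J | j != Ordinal kJ) wt j * (sup_norm (W j) f - G / 4))).
      under [leRHS]eq_bigr do rewrite mulrBr.
      rewrite sumrB lerD2l lerN2 -mulr_suml ler_piMl ?(ltW G4)//.
      apply: le_trans (sum_wt J).
      rewrite [leRHS](bigD1 (Ordinal kJ)) //= lerDr ltW ?wt_gt0//.
    by apply: ler_sum => j _; rewrite ler_pM2l ?wt_gt0// xs'P.
  lra.
lra.
Qed.

End Sum.

Theorem szlenk_AUC_star : exists2 N : dual X -> R, equivalent_norm N & AUC_star N.
Proof.
have /choice[W] : forall j : nat, exists W : set X, between_balls W /\ exists gain : R,
    0 < gain /\ forall f, 1 / 2 <= `|f| -> `|f| <= 2 -> exists xs, forall y, ker_set xs y ->
    j.+1%:R^-1 <= `|y| -> sup_norm W f + gain <= sup_norm W (f + y).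
  move=> j; have j0 : 0 < j.+1%:R^-1 :> R by rewrite invr_gt0.
  have j1 : j.+1%:R^-1 <= 1 :> R by rewrite invf_le1// ler1n.
  have [W [gain [WB g0 Wg]]] := level_norm Sz j0 j1.
  by exists W; split=> //; exists gain.
move=> /all_and2[WB Wgain].
exists (total_norm W); first exact: total_norm_equivalent.
move=> t t0.
have [ND NZ [_ [_ [_ _ _]]]] := total_norm_equivalent WB.
(* [N y = 1] gives [1 / 2 <= `|y|], hence [t / 2 <= `|t *: y|]. *)
pose k := Num.truncn (2 / t).
have kt : k.+1%:R^-1 <= t / 2.
  rewrite -[t / 2]invrK lef_pV2 ?posrE ?invr_gt0 ?divr_gt0//.
  by rewrite invf_div ltW// truncnS_gt.
have [gain [g0 Wg]] := Wgain k.
have Nlow f : 1 / 2 * `|f| <= total_norm W f.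
  by rewrite div1r; exact: total_norm_lower.
have Nup f : total_norm W f <= 2 * `|f|.
  by apply: total_norm_ub => // J; exact: partial_norm_le.
apply: (@lt_le_trans _ _ (wt k * gain / 2)%:E).
  by rewrite lte_fin divr_gt0// mulr_gt0// wt_gt0.
apply: le_ereal_inf_tmp => _ [x [_ Nx] <-].
have [|xs xsP] := @total_norm_gain W WB k gain x g0.
  by apply: Wg; have := Nlow x; have := Nup x; rewrite Nx; lra.
apply: le_ereal_sup_tmp; exists (ereal_inf [set (total_norm W (x + t *: y) - 1)%:E
   | y in norm_sphere (total_norm W) (ker_set xs)]).
  by exists (ker_set xs) => //; exact: ker_set_cof.
apply: le_ereal_inf_tmp => _ [y [yxs Ny] <-]; rewrite lee_fin.
have := xsP (t *: y); rewrite Nx => H.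
have : 1 + wt k * gain / 2 <= total_norm W (x + t *: y).
  apply: H.
    by move=> z zxs; rewrite dual_scaleE yxs// mulr0.
  rewrite normrZ gtr0_norm// (le_trans kt)//.
  have := Nup y; rewrite Ny => y2; nra.
lra.
Qed.

End AUC.

(** * Trees of vectors and embeddings of bundle graphs *)

Local Notation code t := (CodeSeq.code (rev t)).

Section Prelim.

(** Dependent choice in which the next term may depend on the whole past. *)
Lemma dependent_sequence (T : Type) (x0 : T) (Good : seq T -> T -> Prop) :
  (forall L, (forall i, (i < size L)%N -> Good (take i L) (nth x0 L i)) ->
     exists d, Good L d) ->
  exists g : nat -> T, forall n, Good (mkseq g n) (g n).
Proof.
move=> step.
have /choice[nxt nxtP] : forall L, exists d,
    (forall i, (i < size L)%N -> Good (take i L) (nth x0 L i)) -> Good L d.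
  move=> L.
  have [H|nH] := pselect (forall i, (i < size L)%N -> Good (take i L) (nth x0 L i)).
    by have [d Gd] := step L H; exists d.
  by exists x0.
pose pre := fix pre n := if n is m.+1 then rcons (pre m) (nxt (pre m)) else [::].
pose g n := nxt (pre n).
have preE n : pre n = mkseq g n by elim: n => [//|n IHn]; rewrite mkseqS -IHn.
exists g; elim/ltn_ind => n IH.
rewrite /g -preE; apply: nxtP => i; rewrite preE size_mkseq => ni.
rewrite nth_mkseq//; have -> : take i (mkseq g n) = mkseq g i; last exact: IH.
by rewrite /mkseq -map_take take_iota; congr (map _ (iota 0 _)); lia.
Qed.

Lemma subseq_rconsP (T : eqType) (u s : seq T) x : subseq u (rcons s x) ->
  subseq u s \/ exists2 u', subseq u' s & u = rcons u' x.
Proof.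
move=> /subseqP[m]; rewrite size_rcons => ms ->.
case/lastP: m ms => // m b; rewrite size_rcons => -[ms].
rewrite mask_rcons//; case: b; rewrite /= ?cats0 ?cats1.
  by right; exists (mask m s) => //; exact: mask_subseq.
by left; exact: mask_subseq.
Qed.

Lemma sum_supp (V : nmodType) (F : nat -> V) (L1 L2 : seq nat) :
  uniq L1 -> uniq L2 -> (forall i, i \notin L1 -> F i = 0) ->
  (forall i, i \notin L2 -> F i = 0) -> \sum_(i <- L1) F i = \sum_(i <- L2) F i.
Proof.
move=> u1 u2 F1 F2.
rewrite (bigID (mem L2)) [RHS](bigID (mem L1)) /=.
rewrite [X in _ + X]big1 ?addr0 => [|i /F2//].
rewrite [X in _ = _ + X]big1 ?addr0 => [|i /F1//].
rewrite -big_filter -[RHS]big_filter; apply: perm_big; apply: uniq_perm.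
- by rewrite filter_uniq.
- by rewrite filter_uniq.
- by move=> i; rewrite !mem_filter andbC.
Qed.

Lemma sum_prefix_rcons (V : nmodType) (F : seq nat -> V) t i :
  \sum_(j < (size (rcons t i)).+1) F (take j (rcons t i)) =
  \sum_(j < (size t).+1) F (take j t) + F (rcons t i).
Proof.
rewrite big_ord_recr /= take_size size_rcons; congr (_ + _).
by apply: eq_bigr => j _; rewrite -cats1 takel_cat// -ltnS.
Qed.

End Prelim.

Section Game.
Context {R : realType} (X : normedModType R).
Implicit Types (f g y : dual X) (xs : seq X) (s u : seq (dual X)).
Local Notation nat_ord n := (iter n osucc ozero).

(** Give the last vector the coefficient zero. *)
Lemma unconditional_belast (C : R) s y :
  unconditional C (rcons s y) -> unconditional C s.
Proof.
move=> U a e.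
have := U (fun i => if (i < size s)%N then a i else 0) e.
rewrite size_rcons !big_ord_recr /= ltnn mulr0 !scale0r !addr0.
have E (b : nat -> R) : \sum_(i < size s)
    (if (i < size s)%N then b i else 0) *: (rcons s y)`_i = \sum_(i < size s) b i *: s`_i.
  by apply: eq_bigr => i _; rewrite ltn_ord nth_rcons ltn_ord.
rewrite E -(E (fun i => (-1) ^+ e i * a i)); congr (`|_| <= _).
by apply: eq_bigr => i _; rewrite ltn_ord.
Qed.

(** Rounds that remain to be played can be padded with unit vectors. *)
Lemma cof_game_unconditional (C : R) k s :
  (forall Y, @cof_wstar R X Y -> exists2 y, Y y & `|y| = 1) ->
  cof_game (unconditional C) k s -> unconditional C s.
Proof.
move=> unit; elim: k s => [//|k IH] s /= [Y cY Yg].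
have [y Yy y1] := unit Y cY.
exact: (unconditional_belast (IH _ (Yg y Yy y1))).
Qed.

(** One kernel serves all the short subsequences of the vectors chosen so far, so
    that the game can be played on all of them simultaneously. *)
Lemma cof_game_step (C : R) n s : exists xs, forall y u, ker_set xs y -> `|y| = 1 ->
  subseq u s -> (size u < n)%N -> cof_game (unconditional C) (n - size u) u ->
  cof_game (unconditional C) (n - size (rcons u y)) (rcons u y).
Proof.
have /choice[xs_ xsP] : forall u, exists xs, forall y, ker_set xs y -> `|y| = 1 ->
    (size u < n)%N -> cof_game (unconditional C) (n - size u) u ->
    cof_game (unconditional C) (n - size (rcons u y)) (rcons u y).
  move=> u; have [un|nun] := ltnP (size u) n; last by exists [::].
  have [H|nH] := pselect (cof_game (unconditional C) (n - size u) u); last by exists [::].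
  have nu : (n - size u)%N = (n - (size u).+1).+1 by lia.
  move: (H); rewrite nu /= => -[Y /cof_wstar_ker[xs xsY] Yg].
  by exists xs => y yxs y1 _ _; rewrite size_rcons; apply: Yg => //; exact: xsY.
exists (flatten [seq xs_ (mask (val m) s) | m <- enum {: (size s).-tuple bool}]).
move=> y u yxs y1 /subseqP[m ms um] un gu; apply: xsP => //.
move=> x xu; apply: yxs; apply/flattenP; exists (xs_ u) => //.
apply/mapP; have mt : size m == size s by rewrite ms.
by exists (Tuple mt); rewrite ?mem_enum //= -um.
Qed.

End Game.

Section Tree.
Context {R : realType} (X : normedModType R).
Implicit Types (f g y z : dual X) (x : X) (xs : seq X).
Local Notation nat_ord n := (iter n osucc ozero).
Local Notation B eps k := (szlenk_iter eps (@dual_ball R X) (nat_ord k)).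

(** Every weak* neighbourhood of [z] has diameter above [eps] in the preceding
    derived set, so one of two distant points in it is [eps / 2] away from [z]. *)
Lemma szlenk_child (eps delta : R) k z xs : 0 < delta -> B eps k.+1 z ->
  exists z', [/\ B eps k z', eps / 2 < `|z' - z| &
    forall x, x \in xs -> `|(z' - z) x| < delta].
Proof.
move=> d0 /szlenk_derivP[Bz zU].
have [U oU [Uz UB]] := wball_open z xs d0.
have [f [g [[Bf Uf] [Bg Ug] fg]]] := lt_diam (zU U oU Uz).
have [fz|fz] := ltP (eps / 2) `|f - z|.
  by exists f; split=> // x /(UB _ Uf).
exists g; split=> // [|x /(UB _ Ug)//].
have := ler_normB (f - z) (g - z); rewrite opprB addrA subrK; lra.
Qed.

Lemma szlenk_child_ker (eps eta : R) k z xs : 0 < eta -> eta <= eps / 4 ->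
  B eps k.+1 z -> exists z' e b, [/\ B eps k z', ker_set xs e, `|e| = 1,
    eps / 4 <= b & `|z' - z - b *: e| <= eta].
Proof.
move=> eta0 etae Bz; have [M M0 xsM] := ker_set_near xs.
pose delta := eta / (M * (size xs)%:R + 1).
have P0 : 0 < M * (size xs)%:R + 1 by rewrite ltr_wpDl// mulr_ge0.
have d0 : 0 < delta by rewrite divr_gt0.
have [z' [Bz' zz' zx]] := szlenk_child xs d0 Bz.
have [y yxs zy] := xsM (z' - z).
have {}zy : `|z' - z - y| <= eta.
  rewrite (le_trans zy)//.
  have : \sum_(x <- xs) `|(z' - z) x| <= (size xs)%:R * delta.
    rewrite -sum1_size natr_sum mulr_suml big_seq [leRHS]big_seq.
    by apply: ler_sum => x /zx /ltW; rewrite mul1r.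
  move=> /(ler_wpM2l M0) /le_trans; apply.
  rewrite mulrA /delta mulrCA ler_piMr ?(ltW eta0)// ler_pdivrMr// mul1r.
  by rewrite lerDl.
have yb : eps / 4 <= `|y|.
  have : `|z' - z| <= `|z' - z - y| + `|y| by rewrite -{1}[z' - z](subrK y) ler_normD.
  lra.
have y0 : 0 < `|y| by lra.
exists z', (`|y|^-1 *: y), `|y|; split=> //.
- by move=> x /yxs yx; rewrite dual_scaleE yx mulr0.
- by rewrite normrZ gtr0_norm ?invr_gt0// mulVf// gt_eqF.
- by rewrite scalerA divff ?gt_eqF// scale1r.
Qed.

Lemma unit_in_cof (eps : R) : 0 < eps -> B eps 1 !=set0 ->
  forall Y, @cof_wstar R X Y -> exists2 y, Y y & `|y| = 1.
Proof.
move=> e0 [z Bz] Y /cof_wstar_ker[xs xsY].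
have e4 : 0 < eps / 4 by lra.
have [z' [e [b [_ xse e1 _ _]]]] := szlenk_child_ker xs e4 (lexx _) Bz.
by exists e => //; exact: xsY.
Qed.

Variables (eps C : R) (K n : nat).
Hypothesis e0 : 0 < eps.
Hypothesis BK : B eps K.+2 !=set0.
Hypothesis gameC : cof_game (@unconditional R X C) n [::].

(** Nodes are numbered so that parents come first. The node [t] carries a point
    in the derived set of order [K - size t + 1], its vector [b t *: e t] being,
    up to [eta], the difference with the point of the parent; these differences
    telescope along a branch. At depths above [K] the vectors only have to
    continue the game. *)
Lemma tree_vectors (eta : R) : 0 < eta -> eta <= eps / 4 ->
  exists (e : nat -> dual X) (b : nat -> R),
  [/\ forall m, `|e m| = 1, forall t, (size t <= K)%N -> eps / 4 <= b (code t),
    forall t, (size t <= K)%N ->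
      `|\sum_(j < (size t).+1) b (code (take j t)) *: e (code (take j t))|
         <= 2 + K.+1%:R * eta &
    forall M u, subseq u (mkseq e M) -> (size u <= n)%N -> unconditional C u].
Proof.
move=> eta0 etae; have [w0 Bw0] := BK.
have B1 : B eps 1 !=set0.
  by exists w0; apply: szlenk_iter_ole Bw0; exact: (@ole_nat 1 K.+2).
have unit := unit_in_cof e0 B1.
pose T := (dual X * (dual X * R))%type.
pose x0 : T := (w0, (w0, 0)).
(* The point of the parent; the root starts from [w0]. *)
pose prev (L : seq T) (t : seq nat) : dual X :=
  if t is _ :: t' then (nth x0 L (CodeSeq.code t')).1 else w0.
pose Good (L : seq T) (d : T) :=
  let t := CodeSeq.decode (size L) in
  [/\ (size t <= K)%N -> [/\ B eps (K - size t).+1 d.1, eps / 4 <= d.2.2 &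
       `|d.1 - prev L t - d.2.2 *: d.2.1| <= eta],
     `|d.2.1| = 1 &
     forall u, subseq u [seq p.2.1 | p <- L] -> (size u < n)%N ->
       cof_game (unconditional C) (n - size u) u ->
       cof_game (unconditional C) (n - size (rcons u d.2.1)) (rcons u d.2.1)].
have code_lt i t : (CodeSeq.code t < CodeSeq.code (i :: t))%N.
  by rewrite /=; have := expn_gt0 2 i; case: (2 ^ i)%N => //= k _; rewrite -/CodeSeq.code; nia.
have [g gG] : exists g : nat -> T, forall m, Good (mkseq g m) (g m).
  apply: (@dependent_sequence T x0) => L LG.
  have [xs xsP] := @cof_game_step R X C n [seq p.2.1 | p <- L].
  set t := CodeSeq.decode (size L).
  have prevB : (size t <= K)%N -> B eps (K - size t).+2 (prev L t).
    rewrite /prev; case Et : t => [|i t'] tK; first by rewrite subn0.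
    have t'L : (CodeSeq.code t' < size L)%N.
      by rewrite -[size L]CodeSeq.decodeK -/t Et code_lt.
    have [+ _ _] := LG _ t'L; rewrite size_take t'L CodeSeq.codeK.
    rewrite (_ : (K - size (i :: t')).+2 = (K - size t').+1); last first.
      by move: tK => /=; lia.
    by move=> /(_ (ltnW tK))[].
  have [tK|tK] := leqP (size t) K.
    have [z' [e [b [Bz' exs e1 eb zb]]]] := szlenk_child_ker xs eta0 etae (prevB tK).
    exists (z', (e, b)); split=> //.
    by move=> u us un; apply: xsP.
  have [y yxs y1] := unit _ (ker_set_cof xs).
  exists (w0, (y, 0)); split=> //; first by rewrite -/t leqNgt tK.
  by move=> u us un; apply: xsP.
pose e m := (g m).2.1; pose b m := (g m).2.2; pose z m := (g m).1.
have size_dec t : size (CodeSeq.decode (code t)) = size t.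
  by rewrite CodeSeq.codeK size_rev.
have tree t : (size t <= K)%N -> [/\ B eps (K - size t).+1 (z (code t)),
    eps / 4 <= b (code t) &
    `|z (code t) - prev (mkseq g (code t)) (rev t) - b (code t) *: e (code t)| <= eta].
  by move=> tK; have [+ _ _] := gG (code t); rewrite size_mkseq CodeSeq.codeK size_rev; apply.
have e_map M : [seq p.2.1 | p <- mkseq g M] = mkseq e M by rewrite /mkseq -map_comp.
exists e, b; split.
- by move=> m; have [] := gG m.
- by move=> t /tree[].
- move=> t tK.
  have main : `|z (code t) - w0 -
      \sum_(j < (size t).+1) b (code (take j t)) *: e (code (take j t))|
      <= (size t).+1%:R * eta.
    elim/last_ind: t tK => [|t i IH] tK.
      by have [_ _] := tree [::] tK; rewrite big_ord_recl big_ord0 addr0 mul1r.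
    have [|_ _] := tree (rcons t i); first by [].
    rewrite size_rcons in tK; have := IH (ltnW tK).
    rewrite (sum_prefix_rcons (fun p => b (code p) *: e (code p))).
    rewrite rev_rcons /prev nth_mkseq ?code_lt// -/(z _).
    set S := \sum_(j < _) _; set zi := z (CodeSeq.code (i :: rev t)).
    set zt := z (code t); set be := b (CodeSeq.code (i :: rev t)) *: _ => h1 h2.
    have -> : zi - w0 - (S + be) = (zi - zt - be) + (zt - w0 - S).
      by rewrite [RHS]addrAC !addrA subrK opprD addrA.
    rewrite (le_trans (ler_normD _ _))// size_rcons -[X in _ <= X * _]natr1 mulrDl mul1r.
    by rewrite addrC lerD.
  have zB m k : B eps k m -> `|m| <= 1 by exact: szlenk_iter_sub.
  have z1 : `|z (code t)| <= 1 by have [/zB] := tree t tK.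
  have w1 : `|w0| <= 1 by exact: zB Bw0.
  set S := \sum_(j < _) _ in main *.
  have -> : S = z (code t) - w0 - (z (code t) - w0 - S) by rewrite opprB addrC subrK.
  rewrite (le_trans (ler_normB _ _))// lerD//.
    by rewrite (le_trans (ler_normB _ _))//; lra.
  by rewrite (le_trans main)// ler_pM2r// ler_nat.
- move=> M u us un; apply: (@cof_game_unconditional _ _ C (n - size u)) => //.
  elim: M u us un => [|M IH] u; first by case: u => //= _; rewrite subn0.
  rewrite mkseqS => /subseq_rconsP[us|[u' us ->]] un; first exact: IH.
  rewrite size_rcons in un.
  have [_ _] := gG M; rewrite e_map => /(_ u' us un); apply; apply: IH => //.
  exact: ltnW.
Qed.

End Tree.

Definition chain (s : seq nat) : seq nat :=
  [seq code (take j s) | j <- iota 0 (size s).+1].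

Lemma chain_uniq s : uniq (chain s).
Proof.
rewrite map_inj_in_uniq ?iota_uniq// => i j; rewrite !mem_iota !add0n => /= si sj.
move=> /(can_inj CodeSeq.codeK) /(congr1 size); rewrite !size_rev !size_takel//.
Qed.

Lemma mem_chain s i : prefix (rev (CodeSeq.decode i)) s -> i \in chain s.
Proof.
move=> pis; apply/mapP; exists (size (CodeSeq.decode i)).
  by rewrite mem_iota add0n ltnS -size_rev size_prefix.
by move: pis; rewrite prefixE size_rev => /eqP->; rewrite revK CodeSeq.decodeK.
Qed.

Section Signs.
Context {R : realType} (X : normedModType R).
Variables (C : R) (n : nat) (e : nat -> dual X).
Hypothesis eC : forall M u, subseq u (mkseq e M) -> (size u <= n)%N -> unconditional C u.

Lemma unconditional_sum (L : seq nat) (a : nat -> R) (sg : nat -> bool) :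
  uniq L -> (size L <= n)%N ->
  `|\sum_(i <- L) ((-1) ^+ sg i * a i) *: e i| <= C * `|\sum_(i <- L) a i *: e i|.
Proof.
move=> uL Ln; pose M := (\max_(i <- L) i).+1.
pose l := [seq i <- iota 0 M | i \in L].
have lL : perm_eq l L.
  apply: uniq_perm => //; first by rewrite filter_uniq// iota_uniq.
  move=> i; rewrite mem_filter mem_iota add0n /=; case iL: (i \in L) => //=.
  by rewrite ltnS; apply: (@leq_bigmax_seq _ L xpredT id).
have := @eC M [seq e i | i <- l]; rewrite size_map (perm_size lL) => /(_ _ Ln) U.
have {}U : unconditional C [seq e i | i <- l].
  by apply: U; apply: map_subseq; exact: filter_subseq.
have E (b : nat -> R) : \sum_(i <- L) b i *: e i =
    \sum_(j < size [seq e i | i <- l]) b (nth 0%N l j) *: [seq e i | i <- l]`_j.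
  rewrite -(perm_big _ lL) /= (big_nth 0%N) big_mkord size_map.
  by apply: eq_bigr => j _; rewrite (nth_map 0%N).
rewrite (E a) (E (fun i => (-1) ^+ sg i * a i)).
exact: (U (fun j => a (nth 0%N l j)) (fun j => sg (nth 0%N l j))).
Qed.

End Signs.

Section Embedding.
Context {R : realType} (X : normedModType R).
Variables (G : tbgraph) (K h : nat) (c : vertex G -> seq nat -> nat).
Hypothesis Cc : coords K h c.
Variables (C eps : R) (e : nat -> dual X) (b : nat -> R).
Hypotheses (C1 : 1 <= C) (e0 : 0 < eps).
Hypothesis e1 : forall m, `|e m| = 1.
Hypothesis b_low : forall t, (size t <= K)%N -> eps / 4 <= b (code t).
Hypothesis chain_le : forall t, (size t <= K)%N ->
  `|\sum_(j < (size t).+1) b (code (take j t)) *: e (code (take j t))| <= 3.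
Hypothesis eC : forall M u, subseq u (mkseq e M) -> (size u <= K.+1 + K.+1)%N ->
  unconditional C u.

Let cr (v : vertex G) (i : nat) : R := (c v (rev (CodeSeq.decode i)))%:R.

Let supp (v : vertex G) : seq nat := chain (xget [::] [set s | (size s <= K)%N /\
   forall t, c v t != 0%N -> prefix t s]).

Lemma suppP v : [/\ uniq (supp v), (size (supp v) <= K.+1)%N &
  forall i, i \notin supp v -> cr v i = 0].
Proof.
rewrite /supp; case: xgetP => [s _ [sK sP]|nos].
  split; [exact: chain_uniq|by rewrite size_map size_iota|].
  move=> i; apply: contraNeq; rewrite pnatr_eq0 => /sP; exact: mem_chain.
by have [s sK sP] := coords_supp Cc v; case: (nos s).
Qed.

(** [supp v] lists the nodes on a branch that carries the coordinates of [v]. *)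
Definition tree_embedding (v : vertex G) : dual X :=
  \sum_(i <- supp v) (cr v i * b i) *: e i.

Lemma tree_embedding_sum v (L : seq nat) : uniq L ->
  (forall i, i \notin L -> cr v i = 0) ->
  tree_embedding v = \sum_(i <- L) (cr v i * b i) *: e i.
Proof.
move=> uL L0; have [us _ s0] := suppP v; apply: sum_supp => //.
  by move=> i /s0 ->; rewrite mul0r scale0r.
by move=> i /L0 ->; rewrite mul0r scale0r.
Qed.

Lemma tree_embedding_sub u v (L : seq nat) : uniq L ->
  (forall i, i \notin L -> cr u i = 0) -> (forall i, i \notin L -> cr v i = 0) ->
  tree_embedding u - tree_embedding v = \sum_(i <- L) ((cr u i - cr v i) * b i) *: e i.
Proof.
move=> uL u0 v0; rewrite (tree_embedding_sum uL u0) (tree_embedding_sum uL v0) -sumrB.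
by apply: eq_bigr => i _; rewrite -scalerBl -mulrBl.
Qed.

(** The coordinates vary by -1, 0 or 1 on one branch, so the difference is the
    half-sum of two signed sums over the whole branch. *)
Lemma tree_embedding_arc p q : arc p q ->
  `|tree_embedding p - tree_embedding q| <= 3 * C.
Proof.
move=> pq; have [s sK sP] := coords_chain Cc pq.
have [uL Ls] : uniq (chain s) /\ (size (chain s) <= K.+1 + K.+1)%N.
  split; first exact: chain_uniq.
  by rewrite size_map size_iota (leq_trans _ (leq_addr _ _)).
rewrite (@tree_embedding_sub p q (chain s)) //; last first.
- move=> i; apply: contraNeq; rewrite pnatr_eq0 => H; apply/mem_chain/sP.
  by right.
- move=> i; apply: contraNeq; rewrite pnatr_eq0 => H; apply/mem_chain/sP.
  by left.
pose S (sg : nat -> bool) := \sum_(i <- chain s) ((-1) ^+ sg i * b i) *: e i.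
have Sle sg : `|S sg| <= 3 * C.
  apply: le_trans (unconditional_sum eC b sg uL Ls) _; rewrite mulrC.
  rewrite ler_wpM2r ?(le_trans _ C1)//.
  have := chain_le sK; rewrite big_map.
  by rewrite -(big_mkord xpredT (fun j => b (code (take j s)) *: e (code (take j s)))) /index_iota subn0.
have -> : \sum_(i <- chain s) ((cr p i - cr q i) * b i) *: e i =
    2^-1 *: (S (fun i => cr p i - cr q i < 0) + S (fun i => cr p i - cr q i <= 0)).
  rewrite -big_split scaler_sumr /=; apply: eq_bigr => i _.
  rewrite -scalerDl scalerA; congr (_ *: _); rewrite -mulrDl mulrA; congr (_ * _).
  have [] := coords_arc1 Cc pq (rev (CodeSeq.decode i)).
  rewrite /cr; set x := c p _; set y := c q _ => xy yx.
  have [->|[->|->]] : x = y \/ x = y.+1 \/ y = x.+1 by lia.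
  - by rewrite subrr ltxx lexx expr0 expr1 subrr mulr0.
  - by rewrite -natr1 addrC addKr ltr10 ler10 expr0 -mulr2n mulVf.
  - by rewrite -natr1 opprD addrA subrr add0r ltrN10 lerN10 expr1 -opprD mulrN -mulr2n mulVf.
rewrite normrZ ger0_norm ?invr_ge0//.
have := ler_normD (S (fun i => cr p i - cr q i < 0)) (S (fun i => cr p i - cr q i <= 0)).
have := Sle (fun i => cr p i - cr q i < 0); have := Sle (fun i => cr p i - cr q i <= 0).
lra.
Qed.

Lemma tree_embedding_walk u v n : walk_length u v n ->
  `|tree_embedding u - tree_embedding v| <= 3 * C * n%:R.
Proof.
move: u n; apply: walk_ind => [|u w n uw _ IH]; first by rewrite subrr normr0 mulr0.
rewrite -(natr1 n) mulrDr mulr1 [leRHS]addrC.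
have -> : tree_embedding u - tree_embedding v = (tree_embedding u - tree_embedding w) +
  (tree_embedding w - tree_embedding v) by rewrite addrA subrK.
rewrite (le_trans (ler_normD _ _))// lerD//.
by case: uw => /tree_embedding_arc//; rewrite distrC.
Qed.

(** Changing all signs except the one at [t] and averaging isolates the term
    at [t]. *)
Lemma tree_embedding_coord u v t :
  eps / 4 * (2 / (1 + C)) * `|(c u t)%:R - (c v t)%:R| <=
  `|tree_embedding u - tree_embedding v|.
Proof.
have C10 : 0 < 1 + C by have := C1; lra.
have [uvt|uvt] := eqVneq (c u t) (c v t).
  by rewrite uvt subrr normr0 mulr0.
have [us uK u0] := suppP u; have [vs vK v0] := suppP v.
pose L := undup (supp u ++ supp v).
have uL : uniq L by exact: undup_uniq.
have Ls : (size L <= K.+1 + K.+1)%N.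
  by rewrite (leq_trans (size_undup _))// size_cat leq_add.
have tE : rev (CodeSeq.decode (code t)) = t by rewrite CodeSeq.codeK revK.
have tL : code t \in L.
  rewrite mem_undup mem_cat; apply/negPn/negP; rewrite negb_or => /andP[/u0 + /v0].
  rewrite /cr tE => /eqP + /eqP; rewrite !pnatr_eq0 => /eqP ut /eqP vt.
  by rewrite ut vt eqxx in uvt.
have tK : (size t <= K)%N.
  have [s sK sP] : exists2 s, (size s <= K)%N & prefix t s.
    have [ut|ut] := eqVneq (c u t) 0%N.
      have [s sK sP] := coords_supp Cc v; exists s => //; apply: sP.
      by apply: contra_neq uvt => ->; rewrite ut.
    by have [s sK sP] := coords_supp Cc u; exists s => //; apply: sP.
  exact: leq_trans (size_prefix sP) sK.
rewrite (@tree_embedding_sub u v L) //; last first.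
- by move=> i; rewrite mem_undup mem_cat negb_or => /andP[_ /v0].
- by move=> i; rewrite mem_undup mem_cat negb_or => /andP[/u0].
pose a i := (cr u i - cr v i) * b i.
rewrite -/(a _); set V := \sum_(i <- L) _.
have U := unconditional_sum eC a (fun i => i != code t) uL Ls.
set V' := \sum_(i <- L) _ in U.
have VV : V + V' = (2 * a (code t)) *: e (code t).
  rewrite /V /V' -big_split /= (bigD1_seq (code t)) //= eqxx expr0 mul1r.
  rewrite big1 ?addr0; first by rewrite -scalerDl -mulr2n mulr_natl.
  by move=> i it; rewrite it expr1 mulN1r scaleNr subrr.
have : `|2 * a (code t)| <= `|V| + C * `|V|.
  have <- : `|V + V'| = `|2 * a (code t)| by rewrite VV normrZ e1 mulr1.
  by rewrite (le_trans (ler_normD _ _))// lerD2l.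
rewrite /a /cr tE !normrM [ `|2|]ger0_norm//.
have bt := b_low tK; have b0 : 0 < b (code t) by have := e0; lra.
rewrite [ `|b _|]gtr0_norm// => H.
have -> : eps / 4 * (2 / (1 + C)) * `|(c u t)%:R - (c v t)%:R| =
   (2 * (`|(c u t)%:R - (c v t)%:R| * (eps / 4))) / (1 + C) by field; lra.
rewrite ler_pdivrMr// mulrDr mulr1 [_ * C]mulrC (le_trans _ H)//.
by rewrite ler_pM2l// ler_wpM2l.
Qed.

Lemma tree_embedding_bilipschitz u v :
  eps / 4 * (2 / (1 + C)) / 3 * (graph_dist u v)%:R <=
    `|tree_embedding u - tree_embedding v| /\
  `|tree_embedding u - tree_embedding v| <= 3 * C * (graph_dist u v)%:R.
Proof.
have [t [n uv nt]] := coords_dist Cc u v; split; last first.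
  exact: tree_embedding_walk (graph_dist_walk uv).
apply: le_trans (tree_embedding_coord u v t).
have dn : (graph_dist u v)%:R <= 3 * `|(c u t)%:R - (c v t)%:R| :> R.
  apply: (@le_trans _ _ n%:R); first by rewrite ler_nat graph_dist_le.
  case: nt => nt.
    rewrite distrC (le_trans _ (ler_wpM2l _ (ler_norm _)))// mulrBr lerBrDr.
    by rewrite -!natrM -natrD ler_nat.
  rewrite (le_trans _ (ler_wpM2l _ (ler_norm _)))// mulrBr lerBrDr.
  by rewrite -!natrM -natrD ler_nat.
have k0 : 0 <= eps / 4 * (2 / (1 + C)).
  have c1 := C1; have ee := e0.
  by apply: mulr_ge0; [lra|apply: divr_ge0; lra].
set k := _ * (2 / _) in k0 *; rewrite -mulrA ler_wpM2l//.
lra.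
Qed.

End Embedding.

Theorem szlenk_of_not_embeds (R : realType) (X : normedModType R) (G : tbgraph) :
  wstar_unconditional_asymptotic_structure X -> bundle_graph G ->
  ~ equi_lipschitz_embeds (dual X) (oslash_power G) ->
  xole (szlenk_index X) (Some omega).
Proof.
move=> [C C1 game] bG nE; apply: szlenk_index_le_omega => eps e0.
apply: contrapT => /forallNP Bn; apply: nE.
pose s := eps / 4 * (2 / (1 + C)) / 3.
have s0 : 0 < s by rewrite /s !mulr_gt0 ?invr_gt0//; lra.
exists (1 + 3 * C / s); split.
  by rewrite lerDl divr_ge0 ?(ltW s0)//; lra.
move=> n; have [K [h [c Cc]]] := coords_oslash_power n bG.
pose eta := Num.min (eps / 4) (K.+1%:R^-1).
have eta0 : 0 < eta by rewrite /eta lt_min divr_gt0// invr_gt0 ltr0n.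
have etae : eta <= eps / 4 by rewrite /eta ge_min lexx.
have etaK : K.+1%:R * eta <= 1.
  by rewrite -ler_pdivlMl ?ltr0n// mulr1 /eta ge_min lexx orbT.
have BK : szlenk_iter eps (@dual_ball R X) (iter K.+2 osucc ozero) !=set0.
  by apply/set0P/eqP; exact: Bn.
have gK := game (K.+1 + K.+1)%N isT.
have [e [b [e1 b_low chain_le eC]]] := tree_vectors e0 BK gK eta0 etae.
have chain3 t : (size t <= K)%N ->
    `|\sum_(j < (size t).+1) b (code (take j t)) *: e (code (take j t))| <= 3.
  by move=> tK; rewrite (le_trans (chain_le t tK))//; lra.
exists (tree_embedding K c e b), s; split=> // u v.
have [lo hi] := tree_embedding_bilipschitz Cc C1 e0 e1 b_low chain3 eC u v.
split=> //; rewrite (le_trans hi)// ler_wpM2r//.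
by rewrite mulrDr mulr1 [s * _]mulrC divfK ?gt_eqF// lerDr ltW.
Qed.

(** * Approximate midpoints and contraction along the powers *)

Lemma subrACA (V : zmodType) (a b c d : V) : a - b - (c - d) = a - c - (b - d).
Proof. by rewrite !opprD !opprK addrACA. Qed.

Lemma sub_rearrange (V : zmodType) (a b c d e p q : V) :
  a - b - (d - p - (e - q)) = (a - c - d) - (b - c - e) + (p - q).
Proof.
rewrite [a - c - d]addrAC [b - c - e]addrAC [- (b - e - c)]opprB subrKA.
rewrite [d - p - _]subrACA [a - d - _]subrACA.
by rewrite [- (d - e - (p - q))]opprB addrCA addrC.
Qed.

Section Pigeonhole.

(** Infinite sets of indices, which replace the extraction of subsequences. *)
Definition unbounded (S : set nat) := forall n, exists2 i, (n <= i)%N & S i.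

Lemma unbounded_pigeonhole (S : set nat) (cell : nat -> nat) (k : nat) :
  unbounded S -> (forall i, S i -> (cell i < k)%N) ->
  exists a, unbounded [set i | S i /\ cell i = a].
Proof.
move=> uS cellk; apply: contrapT => /forallNP nu.
have /choice[N NP] : forall a, exists N, forall i, (N <= i)%N -> ~ (S i /\ cell i = a).
  move=> a; have /existsNP[N HN] := nu a; exists N => i Ni Si; apply: HN.
  by exists i.
have [i Ni Si] := uS (\max_(a < k) N a).
apply: (NP (cell i) i) => //; apply: leq_trans Ni.
exact: (leq_bigmax (Ordinal (cellk i Si))).
Qed.

Context {R : realType} (V : normedModType R).

(** By induction on the number of generators modulo [Y]: a generator close to
    [Y] can be absorbed, and one at positive distance has bounded coefficients,
    to which the pigeonhole principle applies. *)
Lemma finite_codim_near (n : nat) (Y : set V) (v : 'I_n -> V) :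
  subspace_set Y -> (forall x, exists (y : V) (c : 'I_n -> R),
    Y y /\ x = y + \sum_(i < n) c i *: v i) ->
  forall (w : nat -> V) (S : set nat) (M eta : R), 0 < eta -> unbounded S ->
  (forall i, S i -> `|w i| <= M) ->
  exists2 S' : set nat, unbounded S' & forall i j, S' i -> S' j ->
    [/\ S i, S j & exists2 y, Y y & `|w i - w j - y| <= eta].
Proof.
elim: n Y v => [|n IH] Y v sY Yv w S M eta eta0 uS wM.
  exists S => // i j Si Sj; split=> //; exists (w i - w j).
    by have [y [c [Yy ->]]] := Yv (w i - w j); rewrite big_ord0 addr0.
  by rewrite subrr normr0 ltW.
have [Y0 YD] := sY.
have YZ (a : R) y : Y y -> Y (a *: y) by move=> Yy; rewrite -[_ *: _]addr0; exact: YD.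
(* [Z] is the sum of [Y] and the line of the last generator. *)
pose x := v ord_max.
pose Z : set V := [set f | exists2 a : R, Y (f - a *: x) & True].
have sZ : subspace_set Z.
  split; first by exists 0 => //; rewrite scale0r subr0.
  move=> a f g [b Yf _] [c Yg _]; exists (a * b + c) => //.
  have -> : a *: f + g - (a * b + c) *: x = a *: (f - b *: x) + (g - c *: x).
    by rewrite scalerDl scalerBr scalerA opprD addrACA.
  exact: YD.
have [||S1 uS1 S1P] := IH Z (fun i => v (widen_ord (leqnSn n) i)) sZ _ w S M (eta / 4) _ uS wM.
- move=> f; have [y [c [Yy ->]]] := Yv f.
  exists (y + c ord_max *: x), (fun i => c (widen_ord (leqnSn n) i)); split.
    by exists (c ord_max) => //; rewrite addrK.
  by rewrite big_ord_recr /= -/x -addrA [X in y + X]addrC.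
- by rewrite divr_gt0.
have [clo|/existsNP[z /not_implyP[z0 /forall2NP nclo]]] :=
    pselect (forall z : R, 0 < z -> exists2 y, Y y & `|x - y| <= z).
  exists S1 => // i j Si Sj; have [Swi Swj [f [a Yf _] fw]] := S1P i j Si Sj.
  split=> //; have a1 : 0 < `|a| + 1 by rewrite ltr_wpDl.
  have [|y Yy xy] := clo (eta / 4 / (`|a| + 1)); first by rewrite !divr_gt0.
  exists (a *: y + (f - a *: x)); first exact: YD.
  have -> : w i - w j - (a *: y + (f - a *: x)) = (w i - w j - f) + a *: (x - y).
    by rewrite scalerBr !opprD opprK addrCA addrC -!addrA [a *: x - _]addrC.
  rewrite (le_trans (ler_normD _ _))// normrZ.
  have : `|a| * `|x - y| <= eta / 4.
    apply: (@le_trans _ _ ((`|a| + 1) * `|x - y|)); first by rewrite ler_wpM2r// lerDl.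
    by rewrite mulrC -ler_pdivlMr.
  lra.
have [i0 _ S1i0] := uS1 0%N.
have /choice[c cP] : forall i, exists a : R, S1 i ->
    exists2 f, Y (f - a *: x) & `|w i - w i0 - f| <= eta / 4.
  move=> i; have [S1i|nS1i] := pselect (S1 i); last by exists 0.
  by have [_ _ [f [a Yf _] fw]] := S1P i i0 S1i S1i0; exists a => _; exists f.
pose B := (M + M + eta / 4) / z.
have cB i : S1 i -> `|c i| <= B.
  move=> S1i; have [f Yf fw] := cP i S1i.
  have [Swi Sw0 _] := S1P i i0 S1i S1i0.
  have fM : `|f| <= M + M + eta / 4.
    have -> : f = (w i - w i0) - (w i - w i0 - f) by rewrite opprB addrC subrK.
    rewrite (le_trans (ler_normB _ _))// lerD// (le_trans (ler_normB _ _))//.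
    by rewrite lerD// wM.
  have [->|ci0] := eqVneq (c i) 0.
    by rewrite normr0 divr_ge0 ?(ltW z0)// (le_trans _ fM).
  rewrite /B ler_pdivlMr// (le_trans _ fM)//.
  have /(YZ (- (c i)^-1)) Yf' := Yf.
  have [//|/negP] := nclo (- (c i)^-1 *: (f - c i *: x)).
  rewrite -ltNge => xz.
  have -> : f = c i *: (x - - (c i)^-1 *: (f - c i *: x)).
    rewrite scaleNr opprK scalerDr scalerA divff// scale1r addrC subrK.
    by [].
  by rewrite normrZ ler_wpM2l// ltW.
have x1 : 0 < 4 * (`|x| + 1) by rewrite mulr_gt0// ltr_wpDl.
have [kap kap0 kapE] : exists2 kap : R, 0 < kap & kap * (`|x| + 1) = eta / 4.
  exists (eta / (4 * (`|x| + 1))); first by rewrite divr_gt0.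
  by rewrite invfM mulrA mulfVK// gt_eqF// ltr_wpDl.
have cell0 i : S1 i -> 0 <= (c i + B) / kap.
  by move=> /cB; rewrite ler_norml => /andP[cl _]; rewrite divr_ge0 ?(ltW kap0)//; lra.
have [|a uS2] := @unbounded_pigeonhole S1 (fun i => Num.truncn ((c i + B) / kap))
    (Num.truncn ((B + B) / kap)).+1 uS1.
  move=> i /cB; rewrite ler_norml => /andP[_ cu].
  by rewrite ltnS le_truncn// ler_pM2r ?invr_gt0// lerD2r.
exists [set i | S1 i /\ Num.truncn ((c i + B) / kap) = a] => // i j [S1i ai] [S1j aj].
have [Swi Swj _] := S1P i j S1i S1j; split=> //.
have [f Yf fw] := cP i S1i; have [g Yg gw] := cP j S1j.
exists ((f - c i *: x) - (g - c j *: x)).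
  by rewrite addrC -scaleN1r; exact: YD.
have cij : `|c i - c j| <= kap.
  have := truncn_itv (cell0 i S1i); have := truncn_itv (cell0 j S1j).
  rewrite ai aj !ler_pdivlMr// !ltr_pdivrMr// -(natr1 a) => /andP[a1 a2] /andP[a3 a4].
  by rewrite ler_norml; apply/andP; split; lra.
rewrite (sub_rearrange _ _ (w i0)) -scalerBl.
have : `|(c i - c j) *: x| <= eta / 4.
  rewrite normrZ; apply: (@le_trans _ _ (kap * (`|x| + 1))).
    by apply: ler_pM => //; rewrite lerDl.
  by rewrite kapE.
have := ler_normD ((w i - w i0 - f) - (w j - w i0 - g)) ((c i - c j) *: x).
have := ler_normB (w i - w i0 - f) (w j - w i0 - g).
lra.
Qed.

End Pigeonhole.

Lemma dual_ext (R : realType) (X : normedModType R) (f g : dual X) :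
  (forall x, f x = g x) -> f = g.
Proof. by move=> fg; apply/val_inj/funext. Qed.

Definition dual_evalE := (@dual_addE, @dual_scaleE, @dual_oppE).

Section Midpoints.
Context {R : realType} (X : normedModType R).
Variables (N : dual X -> R).
Hypothesis ND : forall f g, N (f + g) <= N f + N g.
Hypothesis NZ : forall (a : R) f, N (a *: f) = `|a| * N f.
Variables (a0 b0 : R).
Hypotheses (a00 : 0 < a0) (b00 : 0 < b0).
Hypothesis Nlow : forall f, a0 * `|f| <= N f.
Hypothesis Nup : forall f, N f <= b0 * `|f|.

Lemma equiv_norm_ge0 f : 0 <= N f.
Proof. by apply: le_trans (Nlow f); rewrite mulr_ge0// ltW. Qed.

Lemma equiv_normN f : N (- f) = N f.
Proof. by rewrite -scaleN1r NZ normrN1 mul1r. Qed.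

Lemma equiv_normB f g : N (f - g) <= N f + N g.
Proof. by rewrite -(equiv_normN g); exact: ND. Qed.

Lemma equiv_norm_half f g M : N f <= M -> N g <= M -> N (2^-1 *: (f + g)) <= M.
Proof.
by move=> fM gM; rewrite NZ ger0_norm ?invr_ge0//; have := ND f g; lra.
Qed.

(** The quantifiers behind the nested extrema of [AMUC_star]. *)
Lemma AMUC_star_delta (t : R) : AMUC_star N -> 0 < t -> exists2 delta : R, 0 < delta &
  forall x, N x = 1 -> exists2 Y, @cof_wstar R X Y & forall y, Y y -> N y = 1 ->
    1 + delta <= Num.max (N (x + t *: y)) (N (x - t *: y)).
Proof.
move=> NA t0; have := NA t t0; set I := ereal_inf _ => I0.
have [d d0 dI] : exists2 d : R, 0 < d & (d%:E <= I)%E.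
  case: (I) I0 => [r||//]; first by rewrite lte_fin => r0; exists r.
  by move=> _; exists 1 => //; rewrite leey.
exists (d / 2); first by rewrite divr_gt0.
move=> x x1.
have dx : (d%:E <= ereal_sup [set ereal_inf
    [set (Num.max (N (x + t *: y)) (N (x - t *: y)) - 1)%R%:E | y in norm_sphere N Y]
    | Y in @cof_wstar R X])%E.
  by apply: le_trans dI _; apply: ereal_inf_lbound; exists x.
have dlt : ((d / 2)%:E < d%:E)%E by rewrite lte_fin; lra.
have /ereal_sup_gt[_ [Y cY <-] dY] := lt_le_trans dlt dx.
exists Y => // y Yy y1; rewrite addrC -lerBrDr -lee_fin; apply: (le_trans (ltW dY)).
by apply: ereal_inf_lbound; exists y.
Qed.

(** The points [u + w] and [u - w] with [w = (w_i - w_j) / 2] are again in the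
    ball of radius [rho]; for suitable [i] and [j] this [w] is close to the
    subspace [Y] given by AMUC* at [u], and convexity allows to shorten it to
    the length [t * N u]. *)
Lemma midpoints_close (t delta rho : R) (u : dual X) (w : nat -> dual X) :
  0 < t -> 0 < delta ->
  (forall x, N x = 1 -> exists2 Y, @cof_wstar R X Y & forall y, Y y -> N y = 1 ->
    1 + delta <= Num.max (N (x + t *: y)) (N (x - t *: y))) ->
  (forall i, N (u + w i) <= rho /\ N (u - w i) <= rho) ->
  (forall i j, i != j -> 4 * t * rho <= N (w i - w j)) ->
  (1 + delta) * N u <= rho.
Proof.
move=> t0 d0 dP mid sep.
have rho0 : 0 <= rho by have [+ _] := mid 0%N; apply: le_trans; exact: equiv_norm_ge0.
have [nu0|nu0] := eqVneq (N u) 0; first by rewrite nu0 mulr0.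
have {}nu0 : 0 < N u by rewrite lt0r nu0 equiv_norm_ge0.
have urho : N u <= rho.
  have -> : u = 2^-1 *: ((u + w 0%N) + (u - w 0%N)).
    by apply: dual_ext => x; rewrite !dual_evalE; field.
  by have [] := mid 0%N; exact: equiv_norm_half.
have [Y cY YP] : exists2 Y, @cof_wstar R X Y & forall y, Y y -> N y = 1 ->
    1 + delta <= Num.max (N ((N u)^-1 *: u + t *: y)) (N ((N u)^-1 *: u - t *: y)).
  by apply: dP; rewrite NZ gtr0_norm ?invr_gt0// mulVf// gt_eqF.
have [sY [k [v Yv]] _] := cY; have [Y0 YD] := sY.
have YZ (a : R) y : Y y -> Y (a *: y) by move=> Yy; rewrite -[_ *: _]addr0; exact: YD.
apply/ler_addgt0Pr => z z0.
(* An error below [z] spares the bound on [u + y], one below [t * rho] keeps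
   [y] long enough. *)
pose z' := Num.min z (t * rho); have z'0 : 0 < z'.
  by rewrite lt_min z0 mulr_gt0// (lt_le_trans nu0).
have wbd i : `|w i| <= a0^-1 * rho.
  rewrite ler_pdivlMl// (le_trans (Nlow _))//.
  have -> : w i = 2^-1 *: ((u + w i) - (u - w i)).
    by apply: dual_ext => x; rewrite !dual_evalE; field.
  by have [m1 m2] := mid i; apply: equiv_norm_half; rewrite ?equiv_normN.
have uT : unbounded setT by move=> n; exists n.
have [S uS SP] := finite_codim_near sY Yv (divr_gt0 z'0 b00) uT (fun i _ => wbd i).
have [i _ Si] := uS 0%N; have [j ij Sj] := uS i.+1.
have [_ _ [y2 Yy2 wy]] := SP i j Si Sj.
pose q := 2^-1 *: (w i - w j); pose y := 2^-1 *: y2.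
have Yy : Y y by exact: YZ.
have half : `|2^-1 : R| = 2^-1 by rewrite ger0_norm ?invr_ge0.
have qy : N (q - y) <= z' / 2.
  rewrite /q /y -scalerBr NZ half mulrC ler_pM2r ?invr_gt0//.
  by rewrite (le_trans (Nup _))// -ler_pdivlMl// mulrC.
have z'z : z' <= z by rewrite ge_min lexx.
have z't : z' <= t * rho by rewrite ge_min lexx orbT.
have [mi1 mi2] := mid i; have [mj1 mj2] := mid j.
have uq1 : N (u + q) <= rho.
  have -> : u + q = 2^-1 *: ((u + w i) + (u - w j)).
    by apply: dual_ext => x; rewrite /q !dual_evalE; field.
  exact: equiv_norm_half.
have uq2 : N (u - q) <= rho.
  have -> : u - q = 2^-1 *: ((u - w i) + (u + w j)).
    by apply: dual_ext => x; rewrite /q !dual_evalE; field.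
  exact: equiv_norm_half.
have uy1 : N (u + y) <= rho + z.
  have -> : u + y = (u + q) - (q - y) by rewrite opprB addrA addrAC addrK.
  have := equiv_normB (u + q) (q - y); lra.
have uy2 : N (u - y) <= rho + z.
  have -> : u - y = (u - q) + (q - y) by rewrite addrA subrK.
  have := ND (u - q) (q - y); lra.
have qlow : 2 * t * rho <= N q.
  have ij' : i != j by rewrite neq_ltn ij.
  by rewrite /q NZ half; have := sep i j ij'; lra.
have ylow : t * N u <= N y.
  have : N q <= N (q - y) + N y by rewrite -{1}[q](subrK y).
  have : t * N u <= t * rho by rewrite ler_pM2l.
  lra.
have Ny : 0 < N y by apply: lt_le_trans ylow; rewrite mulr_gt0.
pose al := t * N u / N y.
have al0 : 0 <= al by rewrite /al divr_ge0 ?(ltW Ny)// mulr_ge0// ltW.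
have al1 : al <= 1 by rewrite /al ler_pdivrMr// mul1r.
have shrink y' : N (u + y') <= rho + z -> N (u + al *: y') <= rho + z.
  move=> uy'; have -> : u + al *: y' = (1 - al) *: u + al *: (u + y').
    by rewrite scalerBl scale1r scalerDr addrA subrK.
  have := ND ((1 - al) *: u) (al *: (u + y')); rewrite !NZ.
  rewrite (ger0_norm al0) ger0_norm ?subr_ge0// => h.
  have h1 : al * N (u + y') <= al * (rho + z) by rewrite ler_wpM2l.
  have h2 : (1 - al) * N u <= (1 - al) * (rho + z).
    by rewrite ler_wpM2l ?subr_ge0//; lra.
  lra.
have := YP ((N y)^-1 *: y) (YZ _ _ Yy).
rewrite NZ gtr0_norm ?invr_gt0// mulVf ?gt_eqF// => /(_ erefl).
have scl (y' : dual X) : (N u)^-1 *: u + t *: ((N y)^-1 *: y') = (N u)^-1 *: (u + al *: y').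
  rewrite scalerDr !scalerA; congr (_ + _ *: _).
  by rewrite /al; field; rewrite !gt_eqF.
rewrite -scalerN -scalerN !scl !NZ gtr0_norm ?invr_gt0// le_max.
move=> H; have : 1 + delta <= (N u)^-1 * (rho + z).
  by case/orP: H => /le_trans; apply; rewrite ler_pM2l ?invr_gt0//; exact: shrink.
by rewrite ler_pdivlMl// mulrC.
Qed.

(** The points [w i] divide [A, B] in the ratio [k : l] and not at the middle.
    Moving each of them towards [B] by the factor [c] with
    [k + c * l = (1 - c) * l] makes them approximate midpoints, still separated
    as [1 - c >= 1 / 2]. *)
Lemma fork_contracts_le (t delta L : R) (k l : nat) (A B : dual X) (w : nat -> dual X) :
  (k <= l)%N -> (0 < l)%N -> 0 < t -> 0 < delta -> 0 <= L ->
  (forall x, N x = 1 -> exists2 Y, @cof_wstar R X Y & forall y, Y y -> N y = 1 ->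
    1 + delta <= Num.max (N (x + t *: y)) (N (x - t *: y))) ->
  (forall i, N (w i - A) <= k%:R * L /\ N (B - w i) <= l%:R * L) ->
  (forall i j, i != j -> 4 * (k + l)%:R * t * L <= N (w i - w j)) ->
  (1 + delta) * N (B - A) <= (k + l)%:R * L.
Proof.
move=> kl l0 t0 d0 L0 dP near sep.
have l0' : 0 < l%:R :> R by rewrite ltr0n.
have kl' : k%:R <= l%:R :> R by rewrite ler_nat.
pose c : R := (l%:R - k%:R) / (2 * l%:R).
have c0 : 0 <= c by rewrite divr_ge0 ?subr_ge0// mulr_ge0.
have cl : 2 * l%:R * c = l%:R - k%:R by rewrite /c mulrC divfK// gt_eqF// mulr_gt0.
have c1 : c <= 2^-1.
  rewrite /c ler_pdivrMr ?mulr_gt0// mulrA mulVf// mul1r gerBl//.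
pose u := 2^-1 *: (B - A).
pose m i := w i + c *: (B - w i).
pose v i := m i - 2^-1 *: (A + B).
have uv1 i : u + v i = (w i - A) + c *: (B - w i).
  by apply: dual_ext => z; rewrite /u /v /m !dual_evalE; field.
have uv2 i : u - v i = (1 - c) *: (B - w i).
  by apply: dual_ext => z; rewrite /u /v /m !dual_evalE; field.
have vv i j : v i - v j = (1 - c) *: (w i - w j).
  by apply: dual_ext => z; rewrite /u /v /m !dual_evalE; field.
have := @midpoints_close t delta ((k + l)%:R * L / 2) u v t0 d0 dP _ _.
rewrite /u NZ ger0_norm ?invr_ge0// => H.
have {}H : (1 + delta) * (2^-1 * N (B - A)) <= (k + l)%:R * L / 2.
  apply: H => [i|i j ij].
    have [wA wB] := near i; rewrite uv1 uv2 natrD; split.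
      apply: le_trans (ND _ _) _; rewrite NZ ger0_norm//.
      have : c * N (B - w i) <= c * (l%:R * L) by rewrite ler_wpM2l.
      have : 2 * (c * (l%:R * L)) = (l%:R - k%:R) * L by rewrite -cl; ring.
      lra.
    rewrite NZ ger0_norm; last by lra.
    have : (1 - c) * N (B - w i) <= (1 - c) * (l%:R * L) by rewrite ler_wpM2l//; lra.
    have : 2 * ((1 - c) * (l%:R * L)) = 2 * l%:R * L - (2 * l%:R * c) * L by ring.
    rewrite cl; lra.
  rewrite vv NZ ger0_norm; last by lra.
  have := sep i j ij.
  have : 2^-1 * N (w i - w j) <= (1 - c) * N (w i - w j).
    by rewrite ler_wpM2r ?equiv_norm_ge0//; lra.
  lra.
lra.
Qed.

Lemma fork_contracts (t delta L : R) (k l : nat) (A B : dual X) (w : nat -> dual X) :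
  (0 < k)%N -> (0 < l)%N -> 0 < t -> 0 < delta -> 0 <= L ->
  (forall x, N x = 1 -> exists2 Y, @cof_wstar R X Y & forall y, Y y -> N y = 1 ->
    1 + delta <= Num.max (N (x + t *: y)) (N (x - t *: y))) ->
  (forall i, N (w i - A) <= k%:R * L /\ N (B - w i) <= l%:R * L) ->
  (forall i j, i != j -> 4 * (k + l)%:R * t * L <= N (w i - w j)) ->
  (1 + delta) * N (B - A) <= (k + l)%:R * L.
Proof.
move=> k0 l0 t0 d0 L0 dP near sep; have [kl|/ltnW lk] := leqP k l.
  exact: (@fork_contracts_le t delta L k l A B w).
rewrite -equiv_normN opprB addnC; apply: (@fork_contracts_le t delta L l k B A w) => //.
  by move=> i; have [wA wB] := near i; rewrite -equiv_normN opprB -[N (A - _)]equiv_normN opprB.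
by move=> i j ij; rewrite addnC; exact: sep.
Qed.

End Midpoints.

Section NonEmbedding.
Context {R : realType} (X : normedModType R).
Variables (N : dual X -> R).
Hypothesis ND : forall f g, N (f + g) <= N f + N g.
Hypothesis NZ : forall (a : R) f, N (a *: f) = `|a| * N f.
Variables (a0 b0 : R).
Hypotheses (a00 : 0 < a0) (b00 : 0 < b0).
Hypothesis Nlow : forall f, a0 * `|f| <= N f.
Hypothesis Nup : forall f, N f <= b0 * `|f|.
Hypothesis NA : AMUC_star N.

Lemma walk_norm_le (G : tbgraph) (f : vertex G -> dual X) (L : R) :
  (forall p q, arc p q -> N (f q - f p) <= L) ->
  forall u v n, walk_length u v n -> N (f v - f u) <= n%:R * L.
Proof.
move=> fL u v; move: u; apply: walk_ind => [|u w n uw _ IH].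
  by rewrite subrr mul0r; have := NZ 0 0; rewrite scale0r normr0 mul0r => ->.
rewrite -(natr1 n) mulrDl mul1r.
have -> : f v - f u = (f v - f w) + (f w - f u) by rewrite addrA subrK.
rewrite (le_trans (ND _ _))// lerD//.
by case: uw => /fL//; rewrite -(equiv_normN NZ) opprB.
Qed.

(** Induction on [m]: the restrictions of [f] to the copies of [G^m] satisfy the
    same hypotheses, so by induction [L] bounds the images of the edges of
    [G]; the fork of [G] then gains the factor [q]. The separation of the fork,
    relative to [L], is at least [a0 / (b0 * D)] at every level, so that [q] does
    not depend on [m]. *)
Lemma power_contraction (G : tbgraph) h (r : vertex G -> nat) (D : R) :
  ranked h r -> fork G h -> 1 <= D ->
  exists2 q : R, 0 <= q < 1 & forall m,
    exists2 rm, @ranked (oslash_power G m) (h ^ m.+1) rm &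
    forall (f : vertex (oslash_power G m) -> dual X) (s : R), 0 < s ->
    (forall x y, s * (graph_dist x y)%:R <= `|f x - f y|) ->
    (forall p q, arc p q -> `|f q - f p| <= s * D) ->
    N (f top - f bot) <= q ^+ m * (b0 * (s * D) * (h ^ m.+1)%:R).
Proof.
move=> Gr [A [B [v [n1 [k [l [n2 [A1 v1 B1 vinj [k0 l0 hE]]]]]]]]] D1.
have D0 : 0 < D by apply: lt_le_trans D1.
have kl0 : 0 < (k + l)%:R :> R by rewrite ltr0n addn_gt0 k0.
(* The separation of the fork relative to the bound [L] on the edges. *)
pose sg := a0 / (b0 * D).
have sg0 : 0 < sg by rewrite divr_gt0// mulr_gt0.
pose t := sg / (4 * (k + l)%:R).
have t0 : 0 < t by rewrite divr_gt0// mulr_gt0.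
have [delta d0 dP] := AMUC_star_delta NA t0.
have hD : h%:R = n1%:R + (k + l)%:R + n2%:R :> R by rewrite -!natrD hE.
have h0 : 0 < h%:R :> R.
  by rewrite hD ltr_wpDr// ltr_wpDl.
have d1 : 0 < 1 + delta by lra.
pose q := (n1%:R + (k + l)%:R / (1 + delta) + n2%:R) / h%:R.
have qh : q * h%:R = n1%:R + (k + l)%:R / (1 + delta) + n2%:R by rewrite divfK// gt_eqF.
have q0 : 0 <= q by rewrite divr_ge0 ?(ltW h0)// !addr_ge0// divr_ge0// ltW.
have q1 : q < 1.
  rewrite ltr_pdivrMr// mul1r hD ltrD2r ltrD2l ltr_pdivrMr// ltr_pMr//.
  by rewrite ltrDl.
exists q; first by rewrite q0.
elim=> [|m [rm Hr IH]].
  exists r; first by rewrite expn1.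
  move=> f s s0 _ fD; rewrite expr0 mul1r expn1 mulrC.
  have fN p p' : arc p p' -> N (f p' - f p) <= b0 * (s * D).
    by move=> /fD pp'; rewrite (le_trans (Nup _))// ler_pM2l.
  by have := walk_norm_le fN (rank_up Gr top); rewrite (rank_top Gr).
have Pr := ranked_oslash Gr Hr.
exists (oslash_rank h (h ^ m.+1) r rm); first by rewrite expnS.
move=> f s s0 flow fD.
pose L := q ^+ m * (b0 * (s * D) * (h ^ m.+1)%:R).
have L0 : 0 <= L by rewrite !mulr_ge0 ?exprn_ge0// ?ltW.
pose g u := f (oslash_old (oslash_power G m) u).
have gL p p' : arc p p' -> N (g p' - g p) <= L.
  move=> pp'; pose e : edges G := exist _ (p, p') pp'.
  apply: (IH (fun x => f (oslash_copy e x)) s) => //.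
    move=> x y; apply: le_trans (flow _ _); rewrite ler_pM2l// ler_nat.
    exact: oslash_copy_dist Gr Hr e x y.
  by move=> x y xy; apply: fD; exact: oslash_copy_arc.
have gw := walk_norm_le gL.
have BA : (1 + delta) * N (g B - g A) <= (k + l)%:R * L.
  apply: (fork_contracts ND NZ a00 b00 Nlow Nup k0 l0 t0 d0 L0 dP (w := g \o v)) => [i|i j ij].
    by have [vA vB] := v1 i; split; exact: gw.
  apply: le_trans (Nlow _).
  have vij : v i <> v j by move=> /vinj /eqP; rewrite (negbTE ij).
  have hd := oslash_old_dist Gr Hr vij.
  apply: (@le_trans _ _ (a0 * (s * (h ^ m.+1)%:R))); last first.
    rewrite ler_pM2l//; apply: le_trans (flow _ _); rewrite ler_pM2l// ler_nat//.
  have -> : 4 * (k + l)%:R * t * L = q ^+ m * (a0 * (s * (h ^ m.+1)%:R)).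
    rewrite /t /L /sg; set qm := q ^+ m; set H := (h ^ m.+1)%:R.
    have bn : b0 != 0 by rewrite gt_eqF.
    have Dn : D != 0 by rewrite gt_eqF.
    have kn : (k + l)%:R != 0 :> R by rewrite gt_eqF.

    by field; rewrite bn Dn -natrD kn.
  by rewrite ler_piMl ?mulr_ge0 ?(ltW a00) ?(ltW s0)// exprn_ile1// ltW.
rewrite exprS expnS natrM.
have -> : q * q ^+ m * (b0 * (s * D) * (h%:R * (h ^ m.+1)%:R)) = (q * h%:R) * L.
  by rewrite /L; ring.
rewrite qh.
have e1 : f top - f bot = (g top - g B) + (g B - g A) + (g A - g bot).
  by rewrite -[f top]/(g top) -[f bot]/(g bot); apply: dual_ext => z; rewrite !dual_evalE; ring.
have w1 := gw _ _ _ A1; have w2 := gw _ _ _ B1.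
have BA' : N (g B - g A) <= (k + l)%:R / (1 + delta) * L.
  by rewrite mulrAC ler_pdivlMr// mulrC.
rewrite e1; have := ND (g top - g B + (g B - g A)) (g A - g bot).
have := ND (g top - g B) (g B - g A).
rewrite !mulrDl; lra.
Qed.

(** A uniform distortion [D] would keep [q ^+ m] above [a0 / (b0 * D)]. *)
Theorem AMUC_star_not_embeds (G : tbgraph) : nontrivial_bundle_graph G ->
  ~ equi_lipschitz_embeds (dual X) (oslash_power G).
Proof.
move=> /nontrivial_fork[K [h [c [C F]]]] [D [D1 emb]].
have Gr := coords_ranked C.
have [q /andP[q0 q1] qP] := power_contraction Gr F D1.
have D0 : 0 < D by apply: lt_le_trans D1.
have h0 : (0 < h)%N.
  by have [A [B [v [n1 [k [l [n2 [_ _ _ _ [k0 l0 hE]]]]]]]]] := F; lia.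
have low m : a0 / (b0 * D) <= q ^+ m.
  have [rm Hr mP] := qP m; have [f [s [s0 fP]]] := emb m.
  have H0 : 0 < (h ^ m.+1)%:R :> R by rewrite ltr0n expn_gt0 h0.
  have up : N (f top - f bot) <= q ^+ m * (b0 * (s * D) * (h ^ m.+1)%:R).
    apply: mP => // [x y|x y xy]; first by have [] := fP x y.
    have [_ /le_trans] := fP y x; apply.
    rewrite ler_piMr// ?mulr_ge0 ?(ltW s0) ?(ltW D0)// (_ : 1 = 1%:R)// ler_nat.
    by apply: graph_dist_le; apply: walk1; right.
  have lo : a0 * (s * (h ^ m.+1)%:R) <= N (f top - f bot).
    apply: le_trans (Nlow _); rewrite ler_pM2l// distrC.
    have [+ _] := fP bot top; apply: le_trans; rewrite ler_pM2l// ler_nat.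
    exact: ranked_dist Hr.
  rewrite ler_pdivrMr ?mulr_gt0//.
  have : a0 * (s * (h ^ m.+1)%:R) <= q ^+ m * (b0 * D) * (s * (h ^ m.+1)%:R).
    apply: le_trans lo (le_trans up _).
    by rewrite le_eqVlt; apply/orP; left; apply/eqP; ring.
  by rewrite ler_pM2r// mulr_gt0.
have sg0 : 0 < a0 / (b0 * D) by rewrite divr_gt0// mulr_gt0.
have q1' : `|q| < 1 by rewrite ger0_norm.
have /cvgrPdist_lt/(_ _ sg0)[m _ /(_ m (leqnn m))] := cvg_expr q1'.
by rewrite /= sub0r normrN ger0_norm ?exprn_ge0// ltNge low.
Qed.

End NonEmbedding.

(** * The equivalence *)

Lemma AUC_star_AMUC_star (R : realType) (X : normedModType R) (N : dual X -> R) :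
  AUC_star N -> AMUC_star N.
Proof.
move=> NA t t0; apply: lt_le_trans (NA t t0) _.
apply: le_ereal_inf_tmp => _ [x Sx <-].
apply: (@le_trans _ _ (ereal_sup [set ereal_inf
    [set (N (x + t *: y) - 1)%:E | y in norm_sphere N Y] | Y in @cof_wstar R X])).
  by apply: ereal_inf_lbound; exists x.
apply: ge_ereal_sup => _ [Y cY <-]; apply: le_ereal_sup_tmp.
exists (ereal_inf [set (Num.max (N (x + t *: y)) (N (x - t *: y)) - 1)%:E
  | y in norm_sphere N Y]); first by exists Y.
apply: le_ereal_inf_tmp => _ [y Sy <-].
apply: (@le_trans _ _ (N (x + t *: y) - 1)%:E).
  by apply: ereal_inf_lbound; exists y.
by rewrite lee_fin lerD2r le_max lexx.
Qed.

Lemma nontrivial_bundle (G : tbgraph) : nontrivial_bundle_graph G -> bundle_graph G.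
Proof.
by elim=> [{}G H _ bG bH|{}G H bG _ bH|{}G bG _];
  [exact: bundle_series|exact: bundle_series|exact: bundle_branch].
Qed.

Theorem mainTheorem12 (R : realType) (X : completeNormedModType R)
    (G : tbgraph) :
  WCG X ->
  wstar_unconditional_asymptotic_structure X ->
  nontrivial_bundle_graph G ->
  [<-> xole (szlenk_index X) (Some omega);
       exists2 N : dual X -> R, equivalent_norm N & AUC_star N;
       exists2 N : dual X -> R, equivalent_norm N & AMUC_star N;
       ~ equi_lipschitz_embeds (dual X) (oslash_power G)].
Proof.
move=> _ uX ntG; tfae.
- exact: szlenk_AUC_star.
- by move=> [N eN /AUC_star_AMUC_star NA]; exists N.
- move=> [N [ND NZ [a [b [a0 b0 Nab]]]] NA].
  exact: (AMUC_star_not_embeds ND NZ a0 b0 (fun f => (Nab f).1) (fun f => (Nab f).2)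
    NA ntG).
- exact: szlenk_of_not_embeds uX (nontrivial_bundle ntG).
Qed.
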